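(* Let $\Gamma\subset SL_2(\mathbb R)$ be a lattice, and let $F$ be a quasimodular form of weight $K$ and depth $n$ on $\Gamma$. Then for every positive integer $k$ the operator $$L_{F,k}=\sum_{r=0}^n\frac{(-1)^r}{r!\,(k)_r}\,\delta^r(F)\,D^r$$ is a modular linear differential operator of order $n$ and type $(k,k+K)$ on $\Gamma$. For fixed $k>0$, the map $F\mapsto L_{F,k}$ gives an isomorphism $$\widetilde M_*(\Gamma)\xrightarrow{\ \sim\ }\mathrm{MLDO}_{k,k+*}(\Gamma)$$ of filtered graded $M_*(\Gamma)$-modules, where $\widetilde M_*(\Gamma)$ is filtered by depth and $\mathrm{MLDO}_{k,k+*}(\Gamma)$ by order, and the inverse isomorphism maps a differential operator $\sum_{r}a_r(\tau)D^r$ to its coefficient $a_0(\tau)$.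
   Context: A lattice is a discrete subgroup of $SL_2(\mathbb R)$ of finite covolume acting on the upper half-plane $\mathfrak H$. For $\gamma=\begin{pmatrix}a&b\\c&d\end{pmatrix}$, $(f|_k\gamma)(\tau)=(c\tau+d)^{-k}f(\gamma\tau)$; $D=\frac1{2\pi i}\frac d{d\tau}$; $(x)_r=x(x+1)\cdots(x+r-1)$. $M_k(\Gamma)$: holomorphic modular forms of weight $k$, $M_*(\Gamma)=\bigoplus_kM_k(\Gamma)$. A quasimodular form of weight $K$ on $\Gamma$ is a holomorphic function $F$ on $\mathfrak H$ of moderate growth for which there are holomorphic functions $F_0,\dots,F_n$ on $\mathfrak H$ (of moderate growth, independent of $\gamma$) with $(F|_K\gamma)(\tau)=\sum_{r=0}^nF_r(\tau)\bigl(\frac1{2\pi i}\frac{c}{c\tau+d}\bigr)^r$ for all $\gamma\in\Gamma$; the depth is the largest $r$ with $F_r\neq0$. Then $F_0=F$, and the operator $\delta$ on quasimodular forms is defined by $\delta(F)=F_1$; one has $F_r=\delta^rF/r!$. $\widetilde M_K(\Gamma)$ is the space of quasimodular forms of weight $K$, $\widetilde M_*(\Gamma)=\bigoplus_K\widetilde M_K(\Gamma)$, an $M_*(\Gamma)$-module under multiplication. A modular linear differential operator (MLDO) of type $(k,k+K)$ on $\Gamma$ is a linear differential operator of finite order with coefficients holomorphic on $\mathfrak H$ (and at the cusps) such that $L(f|_k\gamma)=L(f)|_{k+K}\gamma$ for all holomorphic $f$ and all $\gamma\in\Gamma$; $\mathrm{MLDO}_{k,k+*}(\Gamma)=\bigoplus_K\mathrm{MLDO}_{k,k+K}(\Gamma)$,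 an $M_*(\Gamma)$-module by left multiplication of operators. *)

(* Defs.v *)
From HB Require Import structures.
From mathcomp Require Import all_boot all_order all_algebra.
From mathcomp Require Import complex ring.
From mathcomp Require Import all_classical all_reals all_analysis.

Set Implicit Arguments.
Unset Strict Implicit.
Unset Printing Implicit Defensive.

Import Order.TTheory GRing.Theory Num.Theory.
Import numFieldNormedType.Exports.

Local Open Scope classical_set_scope.
Local Open Scope ring_scope.
Local Open Scope complex_scope.

Record uhp (R : realType) := Uhp { uval :> R[i] ; uvalP : 0 < complex.Im uval }.

HB.instance Definition _ (R : realType) := [isSub for @uval R].
HB.instance Definition _ (R : realType) := [Choice of uhp R by <:].

Lemma uhp_i_subproof (R : realType) : 0 < complex.Im (0 +i* 1 : R[i]).
Proof. exact: ltr01. Qed.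

HB.instance Definition _ (R : realType) :=
  isPointed.Build (uhp R) (Uhp (uhp_i_subproof R)).

(* A ring for the pointwise operations. *)
Notation ufun R := (uhp R -> R[i]).

Section UpperHalfPlane.
Context {R : realType}.
Implicit Types (f : ufun R) (g : 'M[R]_2) (t : uhp R).

(* The values off the upper half-plane, which is open, do not affect
   derivatives at its points. *)
Definition uext f : R[i]^o -> R[i]^o :=
  fun z => if insub z is Some t then f t else 0.

Definition holomorphic f : Prop :=
  forall t, derivable (uext f) (uval t : R[i]^o) 1.

Definition two_pi_i : R[i] := 0 +i* (2 * pi).

Definition Dq f : ufun R :=
  fun t => two_pi_i^-1 * derive1 (uext f) (uval t).

(* At most polynomial growth in (1 + |t|^2) / Im t = 2 cosh d(t, 'i): a
   condition invariant under all slash actions of SL_2(R), hence one that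
   treats all the cusps of a lattice alike.  For a modular form it amounts to
   being holomorphic at the cusps. *)
Definition moderate f : Prop :=
  exists (C : R) (N : nat), forall t,
    ComplexField.Normc.normc (f t) <=
    C * ((1 + ComplexField.Normc.normc (uval t) ^+ 2)
           / complex.Im (uval t)) ^+ N.

Definition cfac g t : R[i] := (g 1 0)%:C * uval t + (g 1 1)%:C.

(* Total in [g]; see [moebE] for the case of interest. *)
Definition moeb g t : uhp R :=
  insubd t (((g 0 0)%:C * uval t + (g 0 1)%:C) / cfac g t).

Definition slash (k : int) g f : ufun R :=
  fun t => cfac g t ^ (- k) * f (moeb g t).

Lemma moebE g t : \det g = 1 ->
  uval (moeb g t) = ((g 0 0)%:C * uval t + (g 0 1)%:C) / cfac g t.
Proof.
move=> dg; apply: insubdK; case: t => -[x y] /= y0.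
have {dg} : g 0 0 * g 1 1 - g 0 1 * g 1 0 = 1.
  rewrite -dg (expand_det_row _ 0) !big_ord_recl big_ord0 addr0 /cofactor.
  rewrite !det_mx11 !mxE /= expr0 expr1 mul1r mulN1r mulrN.
  by congr (_ * g _ _ - g _ _ * g _ _); apply/val_inj.
rewrite unfold_in /cfac /=.
set a := g 0 0; set b := g 0 1; set c := g 1 0; set d := g 1 1 => dg.
rewrite !(mul0r, subr0, addr0); set n := _ + (c * y) ^+ 2.
have n0 : 0 < n.
  rewrite lt0r addr_ge0 ?sqr_ge0// andbT paddr_eq0 ?sqr_ge0// !sqrf_eq0.
  apply/negP => /andP[/eqP e]; rewrite mulf_eq0 (gt_eqF y0) orbF.
  move=> /eqP c0; move: e dg; rewrite c0 mul0r add0r => ->.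
  by rewrite !mulr0 subrr => /eqP; rewrite eq_sym oner_eq0.
have -> : (a * x + b) * - (c * y / n) + a * y * ((c * x + d) / n) =
    (a * d - b * c) * y / n by ring.
by rewrite dg mul1r divr_gt0.
Qed.

Definition SL2_subgroup (G : set 'M[R]_2) : Prop :=
  [/\ forall g, G g -> \det g = 1,
      G 1%:M,
      forall g h, G g -> G h -> G (g *m h)
    & forall g, G g -> G (invmx g)].

Definition uhp_coords t : R * R :=
  (complex.Re (uval t), complex.Im (uval t)).

Definition hyp_area (A : set (uhp R)) : \bar R :=
  (\int[lebesgue_measure \x lebesgue_measure]_(p in uhp_coords @` A)
     ((p.2 ^+ 2)^-1)%:E)%E.

Definition fundamental_domain (G : set 'M[R]_2) (A : set (uhp R)) : Prop :=
  measurable (uhp_coords @` A) /\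
  forall t, exists! s, A s /\ exists2 g, G g & s = moeb g t.

Definition lattice (G : set 'M[R]_2) : Prop :=
  [/\ SL2_subgroup G,
      G `<=` isolated G
    & exists2 A, fundamental_domain G A & (hyp_area A < +oo)%E].

Definition modular_form (G : set 'M[R]_2) (k : int) : set (ufun R) :=
  [set f | [/\ holomorphic f, moderate f
             & forall g, G g -> slash k g f = f]].

(* [P] gathers F_0, ..., F_n as the coefficients of a polynomial, so that
   the depth is [(size P).-1]. *)
Definition qm_expansion (G : set 'M[R]_2) (K : int) (F : ufun R)
    (P : {poly ufun R}) : Prop :=
  [/\ holomorphic F /\ moderate F,
      forall r, holomorphic P`_r /\ moderate P`_r
    & forall g, G g -> forall t, slash K g F t =
        \sum_(r < size P)
           P`_r t * (two_pi_i^-1 * ((g 1 0)%:C / cfac g t)) ^+ r].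

Definition quasimodular (G : set 'M[R]_2) (K : int) : set (ufun R) :=
  [set F | exists P, qm_expansion G K F P].

(* The expansion, which is unique when [G] is a lattice. *)
Definition qm_poly G K F : {poly ufun R} :=
  xget 0 [set P | qm_expansion G K F P].

(* Junk value 0 for [F = 0], which has no depth. *)
Definition depth G K F : nat := (size (qm_poly G K F)).-1.

Definition has_depth G K F (n : nat) : Prop := size (qm_poly G K F) = n.+1.

Definition delta G K F : ufun R := (qm_poly G K F)`_1.

(* [delta] lowers the weight by 2. *)
Fixpoint delta_iter G (K : int) (r : nat) F : ufun R :=
  if r is r'.+1 then delta_iter G (K - 2) r' (delta G K F) else F.

(* A differential operator \sum_r a_r D^r is encoded by the polynomial with
   coefficients a_r.  Only addition and left multiplication by functions
   carry over: the product of polynomials is not the composition. *)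
Definition diffop := {poly ufun R}.

Definition diffop_apply (L : diffop) f : ufun R :=
  \sum_(r < size L) L`_r * iter r Dq f.

Definition has_order (L : diffop) (n : nat) : Prop := size L = n.+1.

Definition MLDO (G : set 'M[R]_2) (k K : int) : set diffop :=
  [set L : diffop | (forall r, holomorphic L`_r /\ moderate L`_r) /\
     forall f, holomorphic f -> forall g, G g ->
       diffop_apply L (slash k g f) = slash (k + K) g (diffop_apply L f)].

Definition rising (k r : nat) : nat := \prod_(i < r) (k + i).

Definition qm_diffop G (k : nat) (K : int) F : diffop :=
  \poly_(r < (depth G K F).+1)
     (fun t => (-1) ^+ r / (r`! * rising k r)%:R * delta_iter G K r F t).

End UpperHalfPlane.

(* External direct sums, as finitely supported families of elements of the
   homogeneous pieces. *)
Definition dsum (V : zmodType) (X : int -> set V) : set (int -> V) :=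
  [set u | finite_set [set K | u K <> 0] /\ forall K, X K (u K)].

Definition gr_add (V : zmodType) (u v : int -> V) : int -> V :=
  fun K => u K + v K.

(* The action of the direct sum of graded scalars. *)
Definition gr_scale (A : pzRingType) (V : lmodType A) (m : int -> A)
    (u : int -> V) : int -> V :=
  fun K => \sum_(l \in [set: int]) m l *: u (K - l).

Definition homogeneous (V : zmodType) (K : int) (u : int -> V) : Prop :=
  forall l, l <> K -> u l = 0.

Record fgmod (V : Type) :=
  FGMod { piece : int -> set V ; fil : nat -> int -> set V }.

Definition dsum_fil (V : zmodType) (X : fgmod V) (p : nat) : set (int -> V) :=
  dsum (fil X p).

(* The axioms of a filtered graded module over the graded ring with
   homogeneous pieces [M], for given families of subsets of a module. *)
Definition is_fgmod (A : pzRingType) (V : lmodType A) (M : int -> set A)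
    (X : fgmod V) : Prop :=
  [/\ forall K, piece X K = \bigcup_p fil X p K,
      forall p K, fil X p K `<=` fil X p.+1 K,
      forall p K, fil X p K 0,
      forall p K x y, fil X p K x -> fil X p K y -> fil X p K (x - y)
    & forall p l K a x, M l a -> fil X p K x -> fil X p (l + K) (a *: x)].

(* [phi] is an isomorphism of filtered graded modules, with inverse [psi]. *)
Definition fgmod_iso (A : pzRingType) (V W : lmodType A) (M : int -> set A)
    (X : fgmod V) (Y : fgmod W)
    (phi : (int -> V) -> (int -> W)) (psi : (int -> W) -> (int -> V)) : Prop :=
  let SX := dsum (piece X) in let SY := dsum (piece Y) in
  (is_fgmod M X /\ is_fgmod M Y) /\
  ([/\ forall u, SX u -> SY (phi u),
       forall w, SY w -> SX (psi w),
       forall u, SX u -> psi (phi u) = u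
     & forall w, SY w -> phi (psi w) = w] /\
   [/\ forall u v, SX u -> SX v -> phi (gr_add u v) = gr_add (phi u) (phi v),
       forall m u, dsum M m -> SX u -> phi (gr_scale m u) = gr_scale m (phi u),
       forall K u, SX u -> (homogeneous K u <-> homogeneous K (phi u))
     & forall p u, SX u -> (dsum_fil X p u <-> dsum_fil Y p (phi u))]).

Section QuasimodularModules.
Context {R : realType}.
Implicit Type G : set 'M[R]_2.

(* Functions as a module over the ring of functions. *)
Definition QM_fgmod G : fgmod (ufun R)^o :=
  FGMod (fun K => quasimodular G K)
    (fun p K => [set F | quasimodular G K F /\
                         (size (qm_poly G K F) <= p.+1)%N]).

Definition MLDO_fgmod G (k : nat) : fgmod {poly ufun R} :=
  FGMod (fun K => MLDO G k%:Z K)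
    (fun p K => [set L : {poly ufun R} | MLDO G k%:Z K L /\ (size L <= p.+1)%N]).

Definition qm_to_MLDO G (k : nat) (u : int -> (ufun R)^o) :
    int -> {poly ufun R} :=
  fun K => qm_diffop G k K (u K).

Definition constant_coef (L : int -> {poly ufun R}) : int -> (ufun R)^o :=
  fun K => (L K)`_0.

End QuasimodularModules.

(* Main.v *)
Require Import Defs.
From HB Require Import structures.
From mathcomp Require Import all_boot all_order all_algebra.
From mathcomp Require Import complex ring lra zify.
From mathcomp Require Import all_classical all_reals all_analysis.
From mathcomp Require Import measurable_realfun.

Set Implicit Arguments.
Unset Strict Implicit.
Unset Printing Implicit Defensive.

Import Order.TTheory GRing.Theory Num.Theory.
Import numFieldNormedType.Exports.

Local Open Scope classical_set_scope.
Local Open Scope ring_scope.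

(** The derivative of a holomorphic function is holomorphic (Goursat's theorem
    on rectangles and Cauchy's formula on a square), so D may be iterated, and
    with X_g = (1 / 2 pi i) c / (c tau + d) one gets by induction
      D^r (f |_k g) =
        sum_j C(r, j) (k + j)_(r - j) (- X_g)^(r - j) (D^j f) |_(k + 2 j) g.
    At a fixed tau the values X_g are in bijection with the orbit of infinity
    under the lattice; once this orbit is known to be infinite, an expansion
    F |_K g = sum_r F_r X_g^r is unique, and comparing F |_K (g h) with
    (F |_K g) |_K h for all g gives
      F_j |_(K - 2 j) h = sum_r C(r, j) F_r X_h^(r - j).
    This is exactly what makes sum_r (-1)^r F_r / (k)_r D^r equivariant.
    Conversely, evaluating an equivariant sum_r a_r D^r on the constant function
    1 shows that a_0 is quasimodular with F_r = (-1)^r (k)_r a_r.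

    If the orbit of infinity were finite, its stabiliser, a discrete group of
    upper triangular matrices, would have finite covolume.  It consists either
    of translations or, up to conjugation, of dilations, and each of the lines
    Im tau = const, resp. Re tau / Im tau = const, would meet a set of
    representatives in length bounded below, so that the area is infinite. *)

(** * Holomorphic functions *)

(** The winding number of a square is never evaluated: once the integral N of 1 / (w - z) is known
    not to vanish, f = F / N is a quotient of Cauchy integrals and 2 pi i drops out. Hyperbolic area
    would call for a change of variables in two dimensions; in the coordinates (x / y, ln y) it is
    Lebesgue measure and every Moebius map is a composition of shears and reflections, so its
    invariance reduces to Cavalieri's principle. The ring of functions on the half-plane has zero
    divisors, so polynomial identities are tested at a fixed tau, over a field. The expansion behind
    [delta] and [depth] is picked by a choice operator, so even the additivity of F |-> L_{F,k}
    rests on uniqueness. The denominators come from (k)_r = (k)_j (k + j)_(r - j): the last factor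
    is the one created by differentiating a slash, and cancelling it leaves C(r, j), the coefficient
    of a Taylor expansion in X_g. For k > 0 they do not vanish, so order equals depth. *)

Local Notation normc := ComplexField.Normc.normc.

(** * Complex differentiability through moduli and slopes *)

Section ComplexCalculus.
Context {R : realType}.
Implicit Types (z w l : R[i]) (f g : R[i]^o -> R[i]^o).

Lemma norm_normc z : `|z| = (normc z)%:C%C.
Proof. by case: z => a b; rewrite normc_def. Qed.

Lemma normc_ge0 z : 0 <= normc z.
Proof. by have := normr_ge0 z; rewrite norm_normc lecR. Qed.

Lemma normc_gt0 z : (0 < normc z) = (z != 0).
Proof. by rewrite -normr_gt0 norm_normc ltcR. Qed.

Lemma normcD z w : normc (z + w) <= normc z + normc w.
Proof. exact: le_normcD. Qed.

Lemma normcB z w : normc (z - w) <= normc z + normc w.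
Proof. by rewrite -(normcN w); exact: le_normcD. Qed.

Lemma normcC z w : normc (z - w) = normc (w - z).
Proof. by rewrite -opprB; exact: normcN. Qed.

Lemma normc_real (x : R) : normc (x%:C)%C = `|x|.
Proof. by rewrite /= expr0n/= addr0 sqrtr_sqr. Qed.

Lemma normc_geRe z : `|complex.Re z| <= normc z.
Proof. by have := normc_ge_Re z; rewrite norm_normc lecR. Qed.

Lemma normc_geIm z : `|complex.Im z| <= normc z.
Proof.
case: z => a b /=; rewrite -(sqrtr_sqr b); apply: ler_wsqrtr.
by rewrite lerDr sqr_ge0.
Qed.

Lemma normc_leReIm z : normc z <= `|complex.Re z| + `|complex.Im z|.
Proof.
case: z => a b /=; rewrite -[leRHS]ger0_norm ?addr_ge0//.
rewrite -sqrtr_sqr; apply: ler_wsqrtr.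
rewrite sqrrD !real_normK ?num_real//.
by rewrite lerD2r lerDl mulrn_wge0// mulr_ge0.
Qed.

(** The order on [R[i]] compares only numbers with equal imaginary parts, so a positive number is
    real; complex radii can thus be replaced by real ones. *)
Lemma gt0_complex (e : R[i]) : 0 < e -> exists2 r : R, 0 < r & e = r%:C%C.
Proof.
by case: e => a b; rewrite ltcE /= => /andP[/eqP b0 a0]; exists a; rewrite ?b0.
Qed.

Lemma nbhs_complexP z (P : set R[i]^o) :
  nbhs (z : R[i]^o) P <->
  exists2 d : R, 0 < d & forall w, normc (w - z) < d -> P w.
Proof.
split=> [/nbhs_ballP[e /= /gt0_complex[r r0 ->]] H|[d d0 H]].
  exists r => // w wz; apply: H; rewrite -ball_normE /ball_ /=.
  by rewrite norm_normc ltcR normcC.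
apply/nbhs_ballP; exists d%:C%C => /=; first by rewrite ltcR.
by move=> w; rewrite -ball_normE /ball_ /= norm_normc ltcR normcC; exact: H.
Qed.

Lemma continuous_complexP f z :
  {for z, continuous f} <-> forall e : R, 0 < e ->
    exists2 d : R, 0 < d & forall w, normc (w - z) < d -> normc (f w - f z) < e.
Proof.
split=> [cf e e0|H].
  have /cvgrPdist_lt/(_ e%:C%C) : f @ (z : R[i]^o) --> f z by exact: cf.
  rewrite ltcR => /(_ e0)/nbhs_complexP[d d0 Hd]; exists d => // w /Hd.
  by rewrite norm_normc ltcR normcC.
have FF : Filter (nbhs (z : R[i]^o)) by exact: nbhs_filter.
apply/(@cvgrPdist_lt _ _ _ _ FF) => e /gt0_complex[r /H[d d0 Hd] ->].
apply/nbhs_complexP; exists d => // w /Hd.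
by rewrite norm_normc ltcR normcC.
Qed.

(** Caratheodory's form of differentiability; the slope [g] is continuous at [z] only. As no
    division occurs in it, the chain rule and differentiation under a contour integral become
    identities between slopes. *)
Lemma is_derive_complexP f z l :
  is_derive (z : R[i]^o) 1 f l <->
  exists g, [/\ {for (z : R[i]^o), continuous g}, g z = l &
                forall w, f w - f z = g w * (w - z)].
Proof.
split=> [[df dl]|[g [cg gz fg]]].
  have : (fun h : R[i]^o => h^-1 *: ((f \o shift (z : R[i]^o)) (h *: 1) - f z)) @
    (0 : R[i]^o)^' --> (l : R[i]^o).
    by rewrite -dl; exact: df.
  move=> /cvgrPdist_lt H.
  exists (fun w => if w == z then l else (f w - f z) / (w - z)); split.
  - apply/continuous_complexP => e e0; rewrite eqxx.
    have /= := H e%:C%C; rewrite ltcR => /(_ e0) /nbhs_complexP[d d0 Hd].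
    exists d => // w wz; case: eqP => [_|/eqP wnz].
      by rewrite subrr ComplexField.Normc.normc0.
    have /= := Hd (w - z); rewrite subr0 subr_eq0 => /(_ wz wnz).
    by rewrite norm_normc ltcR normcC /GRing.scale /= mulr1 subrK mulrC.
  - by rewrite eqxx.
  - move=> w; case: eqP => [->|/eqP wnz]; first by rewrite !subrr mulr0.
    by rewrite divfK// subr_eq0.
have H : (fun h : R[i]^o => h^-1 *: ((f \o shift (z : R[i]^o)) (h *: 1) - f z)) @
    (0 : R[i]^o)^' --> (l : R[i]^o).
  have FF : Filter (0 : R[i]^o)^' by exact: dnbhs_filter.
  apply/(@cvgrPdist_lt _ _ _ _ FF) => e /gt0_complex[r r0 ->].
  have [d d0 Hd] := (continuous_complexP _ _).1 cg r r0.
  apply/nbhs_complexP; exists d => // h /=; rewrite subr0 => hd h0.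
  have -> : h%:A + z = h + z by rewrite /GRing.scale/= mulr1.
  rewrite fg addrK /GRing.scale /= mulrCA mulVf// mulr1 -gz.
  by rewrite norm_normc ltcR normcC; apply: Hd; rewrite addrK.
by split; [apply/cvg_ex; exists l|exact: cvg_lim].
Qed.

Lemma is_derive_complex_eps f z l : is_derive (z : R[i]^o) 1 f l ->
  forall e : R, 0 < e -> exists2 d : R, 0 < d & forall w, normc (w - z) < d ->
    normc (f w - (f z + l * (w - z))) <= e * normc (w - z).
Proof.
move=> /is_derive_complexP[g [/continuous_complexP cg <- fg]] e /cg[d d0 H].
exists d => // w /H h; rewrite opprD addrA fg -mulrBl ComplexField.Normc.normcM.
by rewrite ler_wpM2r ?normc_ge0// ltW.
Qed.

Lemma is_derive_continuous f z l :
  is_derive (z : R[i]^o) 1 f l -> {for (z : R[i]^o), continuous f}.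
Proof.
by case=> df _; apply/differentiable_continuous/derivable1_diffP.
Qed.

Lemma is_derive_comp f g z l m :
  is_derive (g z : R[i]^o) 1 f l -> is_derive (z : R[i]^o) 1 g m ->
  is_derive (z : R[i]^o) 1 (f \o g) (l * m).
Proof.
move=> /is_derive_complexP[F [cF <- fF]] dg.
have cg := is_derive_continuous dg.
move: dg => /is_derive_complexP[H [cH <- gH]]; apply/is_derive_complexP.
exists (fun w => F (g w) * H w); split; [|by []|].
- apply: (@continuousM _ R[i]^o (fun w => F (g w)) H); last exact: cH.
  by move=> A FA; exact: (cg _ (cF _ FA)).
- by move=> w; rewrite [LHS]fF gH mulrA.
Qed.

Lemma is_derive_inv z : z != 0 ->
  is_derive (z : R[i]^o) 1 (fun w : R[i]^o => w^-1 : R[i]^o) (- z ^- 2).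
Proof.
move=> z0.
have -> : - z ^- 2 = - z ^- 2 *: 1 :> R[i]^o by rewrite /GRing.scale/= mulr1.
have := @derivable_id _ R[i]^o z 1 => d.
split; first exact: derivableV.
by rewrite (@deriveV _ _ id) ?derive_id.
Qed.

Lemma is_derive_near f g z l :
  (exists2 d : R, 0 < d & forall w, normc (w - z) < d -> f w = g w) ->
  is_derive (z : R[i]^o) 1 f l -> is_derive (z : R[i]^o) 1 g l.
Proof.
move=> H; have {}H : \forall w \near (z : R[i]^o), f w = g w.
  by apply/nbhs_complexP.
by move=> df; apply: near_eq_is_derive df; apply: filterS H.
Qed.

End ComplexCalculus.

(** * Integrals of complex-valued functions over a segment *)

Section ComplexIntegral.
Context {R : realType}.
Notation mu := (@lebesgue_measure R).
Implicit Types (a b c : R) (g h : R -> R[i]) (z k : R[i]).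

Definition cint g a b : R[i] :=
  ((\int[mu]_(x in `[a, b]) complex.Re (g x)) +i*
   (\int[mu]_(x in `[a, b]) complex.Im (g x)))%C.

(** Two-sided even at the endpoints, since [y] may leave the segment; the integrands come from
    functions continuous in the plane at each boundary point, which gives this stronger form. *)
Definition ccont g a b := forall x, a <= x <= b ->
  forall e, 0 < e -> exists2 d, 0 < d &
    forall y, `|y - x| < d -> normc (g y - g x) < e.

Let ReB z k : complex.Re (z - k) = complex.Re z - complex.Re k.
Proof. by case: z k => ? ? []. Qed.

Let ImB z k : complex.Im (z - k) = complex.Im z - complex.Im k.
Proof. by case: z k => ? ? []. Qed.

Lemma ccont_integrable g a b : ccont g a b ->
  mu.-integrable `[a, b] (EFin \o (fun x => complex.Re (g x))) /\
  mu.-integrable `[a, b] (EFin \o (fun x => complex.Im (g x))).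
Proof.
move=> cg.
have H (p : R[i] -> R) : (forall z k, `|p z - p k| <= normc (z - k)) ->
    mu.-integrable `[a, b] (EFin \o (fun x => p (g x))).
  move=> pl; apply: continuous_compact_integrable; first exact: segment_compact.
  apply: continuous_in_subspaceT => x; rewrite inE /= in_itv /= => /cg cgx.
  apply/cvgrPdist_lt => e /cgx[d d0 Hd]; near=> y.
  rewrite distrC; apply: le_lt_trans (pl _ _) _; apply: Hd.
  near: y; apply/nbhs_ballP; exists d => //= y.
  by rewrite /ball/= distrC.
split; apply: H => z k; first by rewrite -ReB; exact: normc_geRe.
by rewrite -ImB; exact: normc_geIm.
Unshelve. all: by end_near. Qed.

Lemma eq_cint g h a b : (forall x, a <= x <= b -> g x = h x) ->
  cint g a b = cint h a b.
Proof.
move=> gh; congr Complex; apply: eq_Rintegral => x; rewrite inE/= in_itv/= => xab;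
  by rewrite gh.
Qed.

Lemma cintD g h a b : ccont g a b -> ccont h a b ->
  cint (fun x => g x + h x) a b = cint g a b + cint h a b.
Proof.
move=> /ccont_integrable[g1 g2] /ccont_integrable[h1 h2].
rewrite /cint; apply/eqP; rewrite eq_complex /=.
rewrite -!RintegralD//; apply/andP; split; apply/eqP; apply: eq_Rintegral => x _;
  by case: (g x); case: (h x).
Qed.

Lemma cintZ k g a b : ccont g a b ->
  cint (fun x => k * g x) a b = k * cint g a b.
Proof.
move=> /ccont_integrable[g1 g2]; case: k => p q.
rewrite /cint; apply/eqP; rewrite eq_complex /=.
have I (r : R) (f : R -> R) : mu.-integrable `[a, b] (EFin \o f) ->
    mu.-integrable `[a, b] (EFin \o (fun x => r * f x)).
  by move=> If; rewrite (_ : _ \o _ = (fun x => r%:E * (f x)%:E)%E)//; exact: integrableZl.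
rewrite -!RintegralZl// -RintegralB// -?RintegralD//; try exact: I.
apply/andP; split; apply/eqP; apply: eq_Rintegral => x _; by case: (g x).
Qed.

(** Real and imaginary parts are bounded separately, whence the factor 2; only the order of
    magnitude of the bound matters below. *)
Lemma normc_cint g a b M : a <= b -> ccont g a b ->
  (forall x, a <= x <= b -> normc (g x) <= M) ->
  normc (cint g a b) <= 2 * M * (b - a).
Proof.
move=> ab /ccont_integrable[g1 g2] gM.
have H (f : R -> R) : mu.-integrable `[a, b] (EFin \o f) ->
    (forall x, a <= x <= b -> `|f x| <= M) ->
    `|\int[mu]_(x in `[a, b]) f x| <= M * (b - a).
  move=> If fM; apply: le_trans (le_normr_Rintegral _ _) _ => //.
  have -> : M * (b - a) = \int[mu]_(x in `[a, b]) M.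
    rewrite Rintegral_cst//= lebesgue_measure_itv/= lte_fin.
    move: ab; rewrite le_eqVlt => /predU1P[->|->//].
    by rewrite ltxx subrr.
  apply: le_Rintegral => //.
  - by have := integrable_norm If; apply: eq_integrable.
  - by apply: continuous_compact_integrable => [|x]; [exact: segment_compact|exact: cvg_cst].
apply: le_trans (normc_leReIm _) _ => /=.
rewrite -mulrA mulr_natl mulr2n; apply: lerD; apply: H => // x /gM; apply: le_trans.
  exact: normc_geRe.
exact: normc_geIm.
Qed.

Lemma cint_cat g a b c : a <= c -> c <= b -> ccont g a b ->
  cint g a b = cint g a c + cint g c b.
Proof.
move=> ac cb /ccont_integrable[g1 g2].
have H (f : R -> R) : mu.-integrable `[a, b] (EFin \o f) ->
    \int[mu]_(x in `[a, b]) f x =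
    \int[mu]_(x in `[a, c]) f x + \int[mu]_(x in `[c, b]) f x.
  move=> If; apply/eqP; rewrite addrC -subr_eq; apply/eqP.
  have := @Rintegral_itvB R f (BLeft a) (BRight b) c If.
  rewrite !bnd_simp => ->//.
  rewrite Rintegral_itv_obnd_cbnd//; apply: integrableS If => //.
  by apply: subset_itvr; rewrite bnd_simp.
by rewrite /cint; apply/eqP; rewrite eq_complex /= -!H// !eqxx.
Qed.

Lemma cint_cst k a b : a <= b -> cint (fun=> k) a b = k * (b - a)%:C%C.
Proof.
move=> ab; have H (r : R) : \int[mu]_(x in `[a, b]) r = r * (b - a).
  rewrite Rintegral_cst//= lebesgue_measure_itv/= lte_fin.
  move: ab; rewrite le_eqVlt => /predU1P[->|->//].
  by rewrite ltxx subrr.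
case: k => p q; rewrite /cint /= !H; apply/eqP; rewrite eq_complex /=.
by rewrite !mulr0 subr0 add0r !eqxx.
Qed.

End ComplexIntegral.

(** * Integrals along the boundary of a rectangle *)

Section Rectangles.
Context {R : realType}.
Implicit Types (a b c d e M : R) (f g : R[i]^o -> R[i]^o) (z w k : R[i]).

Definition rect a b c d : set R[i] :=
  [set w | a <= complex.Re w <= b /\ c <= complex.Im w <= d].

Definition frame a b c d : set R[i] :=
  [set w | rect a b c d w /\
    [\/ complex.Re w = a, complex.Re w = b, complex.Im w = c | complex.Im w = d]].

Definition cont_on (A : set R[i]) f :=
  forall w, A w -> {for (w : R[i]^o), continuous f}.

(** Counterclockwise: dz is dx along the horizontal sides and i dy along the vertical ones. *)
Definition contour f a b c d : R[i] :=
  cint (fun x => f (x +i* c)%C) a b - cint (fun x => f (x +i* d)%C) a b +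
  ('i * cint (fun y => f (b +i* y)%C) c d - 'i * cint (fun y => f (a +i* y)%C) c d)%C.

Lemma frame_rect a b c d : frame a b c d `<=` rect a b c d.
Proof. by move=> w []. Qed.

Lemma ccont_horizontal f y a b :
  (forall x, a <= x <= b -> {for (x +i* y)%C, continuous f}) ->
  ccont (fun x => f (x +i* y)%C) a b.
Proof.
move=> cf x /cf /continuous_complexP H e /H[d d0 Hd]; exists d => // u ux.
apply: Hd; rewrite (_ : _ - _ = (u - x)%:C%C) ?normc_real//.
by apply/eqP; rewrite eq_complex /= subrr !eqxx.
Qed.

Lemma ccont_vertical f x a b :
  (forall y, a <= y <= b -> {for (x +i* y)%C, continuous f}) ->
  ccont (fun y => f (x +i* y)%C) a b.
Proof.
move=> cf y /cf /continuous_complexP H e /H[d d0 Hd]; exists d => // u uy.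
apply: Hd; apply: le_lt_trans (normc_leReIm _) _ => /=.
by rewrite subrr normr0 add0r.
Qed.

Lemma frame_ccont f a b c d : a <= b -> c <= d -> cont_on (frame a b c d) f ->
  [/\ ccont (fun x => f (x +i* c)%C) a b, ccont (fun x => f (x +i* d)%C) a b,
      ccont (fun y => f (b +i* y)%C) c d & ccont (fun y => f (a +i* y)%C) c d].
Proof.
move=> ab cd cf; split; [apply: ccont_horizontal => x ?|apply: ccont_horizontal => x ?|
  apply: ccont_vertical => x ?|apply: ccont_vertical => x ?]; apply: cf;
  split; rewrite /rect /= ?lexx ?ab ?cd//;
  by [constructor 1|constructor 2|constructor 3|constructor 4].
Qed.

Lemma eq_contour f g a b c d : a <= b -> c <= d ->
  (forall w, frame a b c d w -> f w = g w) ->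
  contour f a b c d = contour g a b c d.
Proof.
move=> ab cd fg; rewrite /contour; congr (_ - _ + (_ * _ - _ * _)); apply: eq_cint => x ?;
  apply: fg; split; rewrite /rect /= ?lexx ?ab ?cd//;
  by [constructor 1|constructor 2|constructor 3|constructor 4].
Qed.

Lemma contourD f g a b c d : a <= b -> c <= d ->
  cont_on (frame a b c d) f -> cont_on (frame a b c d) g ->
  contour (fun w => f w + g w) a b c d = contour f a b c d + contour g a b c d.
Proof.
move=> ab cd /(frame_ccont ab cd)[? ? ? ?] /(frame_ccont ab cd)[? ? ? ?].
by rewrite /contour !cintD//; ring.
Qed.

Lemma contourZ k f a b c d : a <= b -> c <= d ->
  cont_on (frame a b c d) f ->
  contour (fun w => k * f w) a b c d = k * contour f a b c d.
Proof.
move=> ab cd /(frame_ccont ab cd)[? ? ? ?].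
by rewrite /contour !cintZ//; ring.
Qed.

Lemma normc_contour f a b c d M : a <= b -> c <= d ->
  cont_on (frame a b c d) f ->
  (forall w, frame a b c d w -> normc (f w) <= M) ->
  normc (contour f a b c d) <= 4 * M * ((b - a) + (d - c)).
Proof.
move=> ab cd /(frame_ccont ab cd)[c1 c2 c3 c4] fM.
have ni z : normc ('i * z)%C = normc z.
  by rewrite ComplexField.Normc.normcM /= expr0n expr1n/= add0r sqrtr1 mul1r.
have -> : 4 * M * ((b - a) + (d - c)) =
  (2 * M * (b - a) + 2 * M * (b - a)) + (2 * M * (d - c) + 2 * M * (d - c)) by ring.
apply: le_trans (normcD _ _) _; apply: lerD;
  (apply: le_trans (normcB _ _) _; apply: lerD; rewrite ?ni; apply: normc_cint => // x ?;
   apply: fM; split; rewrite /rect /= ?lexx ?ab ?cd//;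
  by [constructor 1|constructor 2|constructor 3|constructor 4]).
Qed.

Lemma contour_catx f a b c d e : a <= e -> e <= b -> c <= d ->
  cont_on (rect a b c d) f ->
  contour f a b c d = contour f a e c d + contour f e b c d.
Proof.
move=> ae eb cd cf; have ab := le_trans ae eb.
have [c1 c2 _ _] : [/\ ccont (fun x => f (x +i* c)%C) a b,
    ccont (fun x => f (x +i* d)%C) a b, True & True].
  by split => //; apply: ccont_horizontal => x ?; apply: cf; rewrite /rect/= ?lexx ?cd.
by rewrite /contour (cint_cat ae eb c1) (cint_cat ae eb c2); ring.
Qed.

Lemma contour_caty f a b c d e : a <= b -> c <= e -> e <= d ->
  cont_on (rect a b c d) f ->
  contour f a b c d = contour f a b c e + contour f a b e d.
Proof.
move=> ab ce ed cf; have cd := le_trans ce ed.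
have [c1 c2 _ _] : [/\ ccont (fun y => f (a +i* y)%C) c d,
    ccont (fun y => f (b +i* y)%C) c d, True & True].
  by split => //; apply: ccont_vertical => x ?; apply: cf; rewrite /rect/= ?lexx ?ab.
by rewrite /contour (cint_cat ce ed c1) (cint_cat ce ed c2); ring.
Qed.

Lemma continuous_complex_id z : {for (z : R[i]^o), continuous (id : R[i]^o -> R[i]^o)}.
Proof. exact: cvg_id. Qed.

Lemma continuous_complex_cst k z : {for (z : R[i]^o), continuous (fun=> k : R[i]^o)}.
Proof.
apply/continuous_complexP => e e0; exists 1 => // w _.
by rewrite subrr ComplexField.Normc.normc0.
Qed.

(** A direct computation in place of a primitive; in Goursat's argument it removes the first-order
    part of the integrand. *)
Lemma contour_affine p q a b c d : a <= b -> c <= d ->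
  contour (fun w => p + q * w) a b c d = 0.
Proof.
move=> ab cd.
have K k : cont_on (frame a b c d) (fun=> k) by move=> w _; exact: continuous_complex_cst.
have I : cont_on (frame a b c d) id by move=> w _; exact: continuous_complex_id.
have L : cont_on (frame a b c d) (fun w => q * w).
  move=> w wf; apply: (@continuousM _ R[i]^o (fun=> q) id); last exact: I.
  exact: continuous_complex_cst.
have EI : contour (fun w => q * w) a b c d = q * contour id a b c d.
  exact: (contourZ q ab cd I).
rewrite (contourD ab cd (K p) L) {}EI.
have -> : contour (fun=> p) a b c d = 0 by rewrite /contour !cint_cst//; ring.
suff -> : contour id a b c d = 0 by rewrite mulr0; exact: addr0.
rewrite /contour.
(* [X] and [Y] are common to opposite sides and cancel; the remaining terms are - i (d - c) (b - a)
   from the horizontal sides and i (b - a) (d - c) from the vertical ones. *)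
pose X := cint (fun x => x%:C%C) a b; pose Y := cint (fun y => ('i * y%:C)%C) c d.
have hor y : cint (fun x => (x +i* y)%C) a b = X + ('i * y%:C)%C * (b - a)%:C%C.
  rewrite -cint_cst// -cintD.
  - by apply: eq_cint => x _; apply/eqP;
      rewrite eq_complex /= !mul0r !mul1r subr0 ?addr0 ?add0r !eqxx.
  - by apply: (@ccont_horizontal id 0) => x _; exact: continuous_complex_id.
  - by apply: (@ccont_horizontal (fun=> _) 0) => x _; exact: continuous_complex_cst.
have ver x : cint (fun y => (x +i* y)%C) c d = Y + x%:C%C * (d - c)%:C%C.
  rewrite -cint_cst// -cintD.
  - by apply: eq_cint => y _; apply/eqP;
      rewrite eq_complex /= !mul0r !mul1r subr0 ?addr0 ?add0r !eqxx.
  - have -> : (fun y : R => ('i * y%:C)%C) = (fun y => id (0 +i* y)%C).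
      by apply/funext => y; apply/eqP;
        rewrite eq_complex /= !mul0r !mul1r subr0 ?addr0 ?add0r !eqxx.
    by apply: (@ccont_vertical id 0) => x' _; exact: continuous_complex_id.
  - by apply: (@ccont_vertical (fun=> _) 0) => x' _; exact: continuous_complex_cst.
by rewrite !hor !ver !rmorphB /=; ring.
Qed.

End Rectangles.

(** * Goursat's theorem on rectangles *)

Section Goursat.
Context {R : realType}.
Implicit Types (a b c d e M r : R) (f g : R[i]^o -> R[i]^o) (z w k : R[i]).

Lemma nested_segments (u v : nat -> R) :
  (forall n, u n <= u n.+1) -> (forall n, v n.+1 <= v n) ->
  (forall n, u n <= v n) -> exists x, forall n, u n <= x <= v n.
Proof.
move=> ndu niv uv.
have Hu m n : (m <= n)%N -> u m <= u n.
  by move=> mn; apply/(@homo_leq _ u <=%R le_refl le_trans).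
have Hv m n : (m <= n)%N -> v n <= v m.
  move=> mn; have := @homo_leq _ (fun n => - v n) <=%R le_refl le_trans.
  by move=> /(_ _ _ _ mn); rewrite lerN2; apply => k; rewrite lerN2.
have uvmn m n : u m <= v n.
  apply: le_trans (Hu _ _ (leq_maxl m n)) _; apply: le_trans (uv _) _.
  exact/Hv/leq_maxr.
exists (sup (range u)) => n; apply/andP; split.
  by apply: ub_le_sup; [exists (v 0%N) => _ [m _ <-]|exists n].
by apply: ge_sup; [exists (u 0%N), 0%N|move=> _ [m _ <-]].
Qed.

(** A compactness principle: a property inherited by one quarter of each rectangle concentrates at a
    point. It serves for a contour integral that is too large and for unboundedness. *)
Lemma rect_bisection (P : R -> R -> R -> R -> Prop) a b c d :
  a <= b -> c <= d -> P a b c d ->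
  (forall a b c d, a <= b -> c <= d -> P a b c d ->
     [\/ P a ((a + b) / 2) c ((c + d) / 2), P ((a + b) / 2) b c ((c + d) / 2),
         P a ((a + b) / 2) ((c + d) / 2) d | P ((a + b) / 2) b ((c + d) / 2) d]) ->
  exists2 z, rect a b c d z & forall e, 0 < e -> exists a' b' c' d',
    [/\ a' <= b' /\ c' <= d', rect a' b' c' d' z,
        (b' - a') + (d' - c') < e & P a' b' c' d'].
Proof.
move=> ab cd Pabcd HP.
(* Rectangles are bundled with the property, so that choosing a quarter is a function on [T] and can
   be iterated. *)
pose T := {q : R * R * R * R | [/\ q.1.1.1 <= q.1.1.2, q.1.2 <= q.2 &
                                   P q.1.1.1 q.1.1.2 q.1.2 q.2]}.
pose A (q : T) := (sval q).1.1.1; pose B (q : T) := (sval q).1.1.2.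
pose C (q : T) := (sval q).1.2; pose D (q : T) := (sval q).2.
have step (q : T) : {q' : T | [/\ A q <= A q', B q' <= B q, C q <= C q' & D q' <= D q] /\
    (B q' - A q' = (B q - A q) / 2 /\ D q' - C q' = (D q - C q) / 2)}.
  apply: cid; case: q => -[[[p1 p2] p3] p4]; rewrite /A /B /C /D /= => -[h1 h2 h3].
  case: (HP _ _ _ _ h1 h2 h3) => H.
  - have ok : p1 <= (p1 + p2) / 2 /\ p3 <= (p3 + p4) / 2 by split; lra.
    exists (exist _ (p1, (p1 + p2) / 2, p3, (p3 + p4) / 2) (And3 ok.1 ok.2 H)) => /=.
    by do !split; lra.
  - have ok : (p1 + p2) / 2 <= p2 /\ p3 <= (p3 + p4) / 2 by split; lra.
    exists (exist _ ((p1 + p2) / 2, p2, p3, (p3 + p4) / 2) (And3 ok.1 ok.2 H)) => /=.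
    by do !split; lra.
  - have ok : p1 <= (p1 + p2) / 2 /\ (p3 + p4) / 2 <= p4 by split; lra.
    exists (exist _ (p1, (p1 + p2) / 2, (p3 + p4) / 2, p4) (And3 ok.1 ok.2 H)) => /=.
    by do !split; lra.
  - have ok : (p1 + p2) / 2 <= p2 /\ (p3 + p4) / 2 <= p4 by split; lra.
    exists (exist _ ((p1 + p2) / 2, p2, (p3 + p4) / 2, p4) (And3 ok.1 ok.2 H)) => /=.
    by do !split; lra.
pose q0 : T := exist _ (a, b, c, d) (And3 ab cd Pabcd).
pose q n := iter n (fun x => sval (step x)) q0.
have qS n := svalP (step (q n)).
have [x Hx] : exists x, forall n, A (q n) <= x <= B (q n).
  apply: nested_segments => n; first by have [[]] := qS n.
    by have [[]] := qS n.
  by case: (svalP (q n)).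
have [y Hy] : exists y, forall n, C (q n) <= y <= D (q n).
  apply: nested_segments => n; first by have [[]] := qS n.
    by have [[]] := qS n.
  by case: (svalP (q n)).
have size n : (B (q n) - A (q n)) + (D (q n) - C (q n)) =
    ((b - a) + (d - c)) / 2 ^+ n.
  elim: n => [|n IH]; first by rewrite expr0 divr1.
  have [_ [e1 e2]] := qS n.
  transitivity (((B (q n) - A (q n)) + (D (q n) - C (q n))) / 2).
    by rewrite mulrDl; congr (_ + _).
  by rewrite IH exprSr invfM mulrA.
exists (x +i* y)%C; first by split => /=; [exact: (Hx 0%N)|exact: (Hy 0%N)].
move=> e e0; pose s := (b - a) + (d - c).
have s0 : 0 <= s by rewrite addr_ge0// subr_ge0.
have [n sn] : exists n : nat, s / 2 ^+ n < e.
  exists (Num.bound (s / e)); rewrite ltr_pdivrMr ?exprn_gt0// mulrC -ltr_pdivrMr//.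
  apply: lt_le_trans (archi_boundP _) _; first by rewrite divr_ge0// ltW.
  by rewrite -natrX ler_nat ltnW// ltn_expl.
exists (A (q n)), (B (q n)), (C (q n)), (D (q n)).
have [h1 h2 h3] := svalP (q n).
split; [by []| |by rewrite size|by []].
by split => /=; [exact: Hx|exact: Hy].
Qed.

Lemma cont_onW (A B : set R[i]) f : A `<=` B -> cont_on B f -> cont_on A f.
Proof. by move=> AB Bf w /AB /Bf. Qed.

Lemma rect_sub a b c d a' b' c' d' : a <= a' -> b' <= b -> c <= c' -> d' <= d ->
  rect a' b' c' d' `<=` rect a b c d.
Proof. by move=> ? ? ? ? w; rewrite /rect /= => -[/andP[? ?] /andP[? ?]]; lra. Qed.

Lemma goursat f a b c d : a <= b -> c <= d ->
  (forall z, rect a b c d z -> derivable f (z : R[i]^o) 1) ->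
  contour f a b c d = 0.
Proof.
move=> ab cd df.
have cf : cont_on (rect a b c d) f.
  by move=> w /df /derivableP /is_derive_continuous.
apply/eqP/negPn/negP; rewrite -normc_gt0 => I0.
pose s := (b - a) + (d - c).
have s0 : 0 <= s by rewrite addr_ge0// subr_ge0.
(* Chosen so that e s^2 is less than the modulus of the integral; the [+ 1] keeps the denominator
   positive for a degenerate rectangle, where s = 0. *)
pose e := normc (contour f a b c d) / (2 * (s ^+ 2 + 1)).
have ss : 0 < s ^+ 2 + 1 by rewrite ltr_wpDl// sqr_ge0.
have e0 : 0 < e by rewrite divr_gt0// mulr_gt0.
have Ie : e * s ^+ 2 < normc (contour f a b c d).
  rewrite /e -mulrA gtr_pMr// mulrC ltr_pdivrMr ?mulr_gt0//.
  by rewrite mul1r; have := sqr_ge0 s; lra.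
(* Passing to a quarter divides the squared half-perimeter by 4, so if all four quarters failed the
   lower bound, their sum would fail it too. *)
pose P a' b' c' d' := [/\ a <= a', b' <= b, c <= c' & d' <= d] /\
  e * ((b' - a') + (d' - c')) ^+ 2 < normc (contour f a' b' c' d').
have [] := @rect_bisection P a b c d ab cd.
- by split.
- move=> p1 p2 p3 p4 p12 p34 [[h1 h2 h3 h4] H].
  have cf' : cont_on (rect p1 p2 p3 p4) f by apply: cont_onW cf; exact: rect_sub.
  set m := (p1 + p2) / 2; set n := (p3 + p4) / 2.
  have [m1 m2 n1 n2] : [/\ p1 <= m, m <= p2, p3 <= n & n <= p4].
    by rewrite /m /n; split; lra.
  have E : contour f p1 p2 p3 p4 =
    (contour f p1 m p3 n + contour f m p2 p3 n) +
    (contour f p1 m n p4 + contour f m p2 n p4).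
    rewrite (contour_caty p12 n1 n2 cf') (contour_catx m1 m2) ?(contour_catx m1 m2 n2)//.
      by apply: cont_onW cf'; exact: rect_sub.
    by apply: cont_onW cf'; exact: rect_sub.
  case: (pselect (P p1 m p3 n)) => [?|k1]; first by constructor 1.
  case: (pselect (P m p2 p3 n)) => [?|k2]; first by constructor 2.
  case: (pselect (P p1 m n p4)) => [?|k3]; first by constructor 3.
  case: (pselect (P m p2 n p4)) => [?|k4]; first by constructor 4.
  exfalso.
  have in4 : [/\ a <= m, m <= b, c <= n & n <= d] by split; lra.
  case: in4 => i1 i2 i3 i4.
  have K p q r t : a <= p -> q <= b -> c <= r -> t <= d -> ~ P p q r t ->
     normc (contour f p q r t) <= e * ((q - p) + (t - r)) ^+ 2.
    move=> *; rewrite leNgt; apply/negP => ?.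
    by have : P p q r t by split.
  have := K _ _ _ _ h1 i2 h3 i4 k1; have := K _ _ _ _ i1 h2 h3 i4 k2.
  have := K _ _ _ _ h1 i2 i3 h4 k3; have := K _ _ _ _ i1 h2 i3 h4 k4.
  move: H; rewrite E.
  have := normcD (contour f p1 m p3 n + contour f m p2 p3 n)
    (contour f p1 m n p4 + contour f m p2 n p4).
  have := normcD (contour f p1 m p3 n) (contour f m p2 p3 n).
  have := normcD (contour f p1 m n p4) (contour f m p2 n p4).
  have -> : m - p1 = (p2 - p1) / 2 by rewrite /m; field.
  have -> : p2 - m = (p2 - p1) / 2 by rewrite /m; field.
  have -> : n - p3 = (p4 - p3) / 2 by rewrite /n; field.
  have -> : p4 - n = (p4 - p3) / 2 by rewrite /n; field.
  have -> : e * ((p2 - p1) / 2 + (p4 - p3) / 2) ^+ 2 =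
    e * (p2 - p1 + (p4 - p3)) ^+ 2 / 4 by field.
  lra.
move=> z zr Hz.
(* With e / 8, the estimate of [normc_contour] for half-perimeter t is 4 (e / 8) t t = e t^2 / 2,
   which contradicts the lower bound e t^2 carried by [P]. *)
have e8 : 0 < e / 8 by rewrite divr_gt0.
have [del del0 Hd] := is_derive_complex_eps (derivableP (df z zr)) e8.
have [p1 [p2 [p3 [p4 [[p12 p34] zp small [[h1 h2 h3 h4] H]]]]]] := Hz _ del0.
set l := 'D_1 f z in Hd.
have cf' : cont_on (frame p1 p2 p3 p4) f.
  by apply: cont_onW cf => w /frame_rect; exact: rect_sub.
have clin q k : cont_on (frame p1 p2 p3 p4) (fun w => q + k * w).
  move=> w _; apply: continuousD; first exact: continuous_complex_cst.
  apply: (@continuousM _ R[i]^o (fun=> k) id); last exact: continuous_complex_id.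
  exact: continuous_complex_cst.
pose err w := f w + (- (f z) + l * z + (- l) * w).
have cerr : cont_on (frame p1 p2 p3 p4) err.
  by move=> w wf; apply: continuousD; [exact: cf'|exact: clin].
have E : contour f p1 p2 p3 p4 = contour err p1 p2 p3 p4.
  by rewrite (contourD p12 p34 cf' (clin _ _)) contour_affine//; apply/esym; exact: addr0.
pose t := (p2 - p1) + (p4 - p3).
have t0 : 0 <= t by rewrite addr_ge0// subr_ge0.
have errb w : frame p1 p2 p3 p4 w -> normc (err w) <= e / 8 * t.
  move=> /frame_rect [/andP[w1 w2] /andP[w3 w4]].
  have wzt : normc (w - z) <= t.
    apply: le_trans (normc_leReIm _) _.
    case: zp => /andP[z1 z2] /andP[z3 z4]; rewrite /t; apply: lerD.
      have -> : complex.Re (w - z) = complex.Re w - complex.Re z by case: (w) (z) => ? ? [].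
      by rewrite ler_norml; lra.
    have -> : complex.Im (w - z) = complex.Im w - complex.Im z by case: (w) (z) => ? ? [].
    by rewrite ler_norml; lra.
  have -> : err w = f w - (f z + l * (w - z)) by rewrite /err; ring.
  apply: le_trans (Hd _ (le_lt_trans wzt small)) _.
  by rewrite ler_wpM2l// divr_ge0// ltW.
have := normc_contour p12 p34 cerr errb; rewrite -E -/t.
move: H; rewrite -/t.
have -> : 4 * (e / 8 * t) * t = e * t ^+ 2 / 2 by field.
have : 0 <= e * t ^+ 2 by rewrite mulr_ge0 ?sqr_ge0// ltW.
lra.
Qed.

End Goursat.

(** * Cauchy's formula on a rectangle and differentiation under a contour integral *)

Section CauchyFormula.
Context {R : realType}.
Implicit Types (a b c d e M r : R) (f g : R[i]^o -> R[i]^o) (z w u k l : R[i]).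

Lemma is_derive_subc f w l k :
  is_derive (w : R[i]^o) 1 f l -> is_derive (w : R[i]^o) 1 (fun x => f x - k) l.
Proof.
move=> /is_derive_complexP[g [cg gw fg]]; apply/is_derive_complexP; exists g.
split; [exact: cg|exact: gw|] => x; rewrite -fg.
by rewrite opprB addrA subrK.
Qed.

Lemma is_derive_mulc f g w l k :
  is_derive (w : R[i]^o) 1 f l -> is_derive (w : R[i]^o) 1 g k ->
  is_derive (w : R[i]^o) 1 (fun x => f x * g x) (f w * k + g w * l).
Proof. exact: is_deriveM. Qed.

Lemma is_derive_invB z w : w != z ->
  is_derive (w : R[i]^o) 1 (fun x : R[i]^o => (x - z)^-1 : R[i]^o) (- (w - z) ^- 2).
Proof.
move=> wz; have wz0 : w - z != 0 by rewrite subr_eq0.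
have d1 : is_derive (w : R[i]^o) 1 (fun x : R[i]^o => x - z : R[i]^o) 1.
  exact: (@is_derive_subc id).
have := @is_derive_comp _ (fun y => y^-1) (fun x => x - z) w _ _ (is_derive_inv wz0) d1.
by rewrite mulr1.
Qed.

Lemma continuous_invB z w : w != z ->
  {for (w : R[i]^o), continuous (fun x : R[i]^o => (x - z)^-1 : R[i]^o)}.
Proof. by move=> wz; have /is_derive_continuous := is_derive_invB wz. Qed.

(** Four rectangles avoiding [z] are cut off, with integral 0; what remains is a square of half-side
    r around [z], near which [f] is bounded, so the integral is O(r). *)
Lemma goursat_punctured f a b c d z :
  a < complex.Re z < b -> c < complex.Im z < d ->
  (forall w, rect a b c d w -> w != z -> derivable f (w : R[i]^o) 1) ->
  {for (z : R[i]^o), continuous f} -> contour f a b c d = 0.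
Proof.
move=> /andP[az zb] /andP[cz zd] df cfz.
have cf : cont_on (rect a b c d) f.
  move=> w wr; case: (eqVneq w z) => [->//|wz].
  by have /derivableP /is_derive_continuous := df w wr wz.
have [del del0 Hd] := (continuous_complexP _ _).1 cfz 1 ltr01.
pose M := normc (f z) + 1.
have M0 : 0 < M by rewrite ltr_wpDl// normc_ge0.
pose x := complex.Re z; pose y := complex.Im z.
have key r : 0 < r -> a < x - r -> x + r < b -> c < y - r -> y + r < d ->
    2 * r < del -> normc (contour f a b c d) <= 16 * M * r.
  move=> r0 h1 h2 h3 h4 h5.
  have sub p q s t : a <= p -> q <= b -> c <= s -> t <= d -> cont_on (rect p q s t) f.
    by move=> *; apply: cont_onW cf; exact: rect_sub.
  have G p q s t : p <= q -> s <= t -> a <= p -> q <= b -> c <= s -> t <= d ->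
      [\/ q < x, x < p, t < y | y < s] -> contour f p q s t = 0.
    move=> pq st ap qb cs td H; apply: (goursat pq st) => w wr; apply: df.
      exact: rect_sub wr.
    apply/eqP => wz; move: wr; rewrite wz => -[/andP[? ?] /andP[? ?]].
    by case: H; rewrite /x /y => ?; lra.
  have -> : contour f a b c d = contour f (x - r) (x + r) (y - r) (y + r).
    have ac : a <= x - r by lra. have bc : x - r <= b by lra.
    have cd : c <= d by lra.
    have xx : x - r <= x + r by lra. have xb : x + r <= b by lra.
    have yy : y - r <= y + r by lra. have yd : y + r <= d by lra.
    have cy : c <= y - r by lra. have yd' : y - r <= d by lra.
    have cyy : c <= y + r by lra.
    have e1 : contour f a (x - r) c d = 0 by apply: G => //; try lra; constructor 1; lra.
    have e2 : contour f (x + r) b c d = 0 by apply: G => //; try lra; constructor 2; lra.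
    have e3 : contour f (x - r) (x + r) c (y - r) = 0.
      by apply: G => //; try lra; constructor 3; lra.
    have e4 : contour f (x - r) (x + r) (y + r) d = 0.
      by apply: G => //; try lra; constructor 4; lra.
    have s1 : cont_on (rect (x - r) b c d) f by apply: sub; lra.
    have s2 : cont_on (rect (x - r) (x + r) c d) f by apply: sub; lra.
    have s3 : cont_on (rect (x - r) (x + r) (y - r) d) f by apply: sub; lra.
    rewrite (contour_catx ac bc cd cf) e1 add0r (contour_catx xx xb cd s1) e2 addr0.
    by rewrite (contour_caty xx cy yd' s2) e3 add0r (contour_caty xx yy yd s3) e4 addr0.
  have -> : 16 * M * r = 4 * M * (((x + r) - (x - r)) + ((y + r) - (y - r))) by ring.
  apply: normc_contour; [lra|lra| |].
    by apply: cont_onW (@frame_rect _ _ _ _ _) _; apply: sub; lra.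
  move=> w /frame_rect [/andP[w1 w2] /andP[w3 w4]].
  have wz : normc (w - z) < del.
    apply: le_lt_trans (normc_leReIm _) _; apply: le_lt_trans h5.
    rewrite mulr_natl mulr2n; apply: lerD.
      have -> : complex.Re (w - z) = complex.Re w - x by rewrite /x; case: (w) (z) => ? ? [].
      by rewrite ler_norml; lra.
    have -> : complex.Im (w - z) = complex.Im w - y by rewrite /y; case: (w) (z) => ? ? [].
    by rewrite ler_norml; lra.
  have -> : f w = (f w - f z) + f z by rewrite subrK.
  apply: le_trans (normcD _ _) _; rewrite addrC lerD2l ltW//; exact: Hd.
apply/eqP/negPn/negP; rewrite -normc_gt0; set I := normc _ => I0.
(* The first term forces 16 M r <= I / 2; [del / 4] keeps the square where [M] bounds [f], and the
   others keep it inside the rectangle. *)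
pose r := Num.min (I / (32 * M)) (Num.min (del / 4)
  (Num.min (Num.min ((x - a) / 2) ((b - x) / 2)) (Num.min ((y - c) / 2) ((d - y) / 2)))).
have M32 : 0 < 32 * M by rewrite mulr_gt0.
have r0 : 0 < r.
  by rewrite /r !lt_min !divr_gt0 ?mulr_gt0// subr_gt0.
have [rI rd ra rb [rc re]] : [/\ r <= I / (32 * M), r <= del / 4, r <= (x - a) / 2,
    r <= (b - x) / 2 & r <= (y - c) / 2 /\ r <= (d - y) / 2].
  by rewrite /r; split; rewrite ?ge_min ?lexx ?orbT//; split; rewrite ?ge_min ?lexx ?orbT.
have := key r r0; rewrite -/I => K.
have {K} : I <= 16 * M * r by apply: K; rewrite -/x -/y in az zb cz zd *; lra.
move: rI; rewrite ler_pdivlMr// => rI.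
have : 16 * M * r = (r * (32 * M)) / 2 by field.
lra.
Qed.

Lemma frame_neq a b c d z : a < complex.Re z < b -> c < complex.Im z < d ->
  forall w, frame a b c d w -> w != z.
Proof.
move=> /andP[? ?] /andP[? ?] w [[_ _] H]; apply/eqP => wz; move: H; rewrite wz.
by case => ?; lra.
Qed.

(** The slope of [f] at [z] is (f w - f z) / (w - z) away from [z] and continuous at [z], so
    [goursat_punctured] annihilates its integral. The integral of 1 / (w - z) stays as a factor. *)
Lemma cauchy_formula f a b c d z :
  a < complex.Re z < b -> c < complex.Im z < d ->
  (forall w, rect a b c d w -> derivable f (w : R[i]^o) 1) ->
  contour (fun w => f w * (w - z)^-1) a b c d =
    f z * contour (fun w => (w - z)^-1) a b c d.
Proof.
move=> zab zcd df.
have [ab cd] : a <= b /\ c <= d.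
  by case/andP: zab => ? ?; case/andP: zcd => ? ?; split; lra.
have zr : rect a b c d z.
  by case/andP: zab => ? ?; case/andP: zcd => ? ?; rewrite /rect /=; lra.
have [g [cg gz fg]] := (is_derive_complexP _ _ _).1 (derivableP (df z zr)).
have gE w : w != z -> g w = (f w - f z) * (w - z)^-1.
  by move=> wz; rewrite fg mulfK// subr_eq0.
have G0 : contour g a b c d = 0.
  apply: (goursat_punctured zab zcd _ cg) => w wr wz.
  have dq : is_derive (w : R[i]^o) 1 (fun x : R[i]^o => (f x - f z) * (x - z)^-1 : R[i]^o)
     ((f w - f z) * (- (w - z) ^- 2) + (w - z)^-1 * ('D_1 f w)).
    have H := is_derive_subc (f z) (derivableP (df w wr)).
    by have := is_derive_mulc H (is_derive_invB wz).
  suff : is_derive (w : R[i]^o) 1 g ((f w - f z) * (- (w - z) ^- 2) + (w - z)^-1 * ('D_1 f w)).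
    by case.
  apply: is_derive_near dq; exists (normc (w - z)).
    by rewrite normc_gt0 subr_eq0.
  move=> x xw; rewrite gE//; apply: contraTneq xw => ->.
  by rewrite normcC ltxx.
have nz := frame_neq zab zcd.
have cinv : cont_on (frame a b c d) (fun w => (w - z)^-1).
  by move=> w /nz; exact: continuous_invB.
have cgf : cont_on (frame a b c d) g.
  move=> w wf; have wz := nz w wf.
  have /derivableP /is_derive_continuous cfw := df w (frame_rect wf).
  have /continuous_complexP H : {for (w : R[i]^o), continuous
      (fun x : R[i]^o => (f x - f z) * (x - z)^-1 : R[i]^o)}.
    apply: (@continuousM _ R[i]^o (fun x => f x - f z) (fun x => (x - z)^-1)).
      by apply: continuousB; [exact: cfw|exact: continuous_complex_cst].
    exact: continuous_invB.
  apply/continuous_complexP => e /H[del del0 Hd].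
  exists (Num.min del (normc (w - z))); first by rewrite lt_min del0 normc_gt0 subr_eq0.
  move=> x; rewrite lt_min => /andP[/Hd + xw]; rewrite -!gE//.
  by apply: contraTneq xw => ->; rewrite normcC ltxx.
have cfz : cont_on (frame a b c d) (fun w => f z * (w - z)^-1).
  move=> w wf; apply: (@continuousM _ R[i]^o (fun=> f z) (fun x => (x - z)^-1)).
    exact: continuous_complex_cst.
  exact: cinv.
rewrite -(contourZ (f z) ab cd cinv) -[RHS]add0r -G0 -(contourD ab cd cgf cfz).
apply: eq_contour => // w wf; rewrite gE ?nz// -mulrDl.
by congr (_ * _); exact/esym/subrK.
Qed.

(** [phi' u] is the difference quotient of [phi] between [z] and [u], not a derivative at [u]; its
    contour integral is the slope that [is_derive_complexP] asks for, and the Lipschitz bound makes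
    this slope continuous at [z]. *)
Lemma is_derive_contour (phi phi' : R[i] -> R[i] -> R[i]) a b c d z C r :
  a <= b -> c <= d -> 0 < r ->
  (forall u, normc (u - z) < r -> cont_on (frame a b c d) (phi u)) ->
  (forall u, normc (u - z) < r -> cont_on (frame a b c d) (phi' u)) ->
  (forall u w, normc (u - z) < r -> frame a b c d w ->
     phi u w - phi z w = (u - z) * phi' u w) ->
  (forall u w, normc (u - z) < r -> frame a b c d w ->
     normc (phi' u w - phi' z w) <= C * normc (u - z)) ->
  is_derive (z : R[i]^o) 1 (fun u : R[i]^o => contour (phi u) a b c d : R[i]^o)
    (contour (phi' z) a b c d).
Proof.
move=> ab cd r0 cphi cphi' E B; apply/is_derive_complexP.
have zz : normc (z - z) < r by rewrite subrr ComplexField.Normc.normc0.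
have cB p q : cont_on (frame a b c d) p -> cont_on (frame a b c d) q ->
    cont_on (frame a b c d) (fun w => p w - q w).
  by move=> cp cq w wf; apply: continuousB; [exact: cp|exact: cq].
have contourB p q : cont_on (frame a b c d) p -> cont_on (frame a b c d) q ->
    contour (fun w => p w - q w) a b c d = contour p a b c d - contour q a b c d.
  move=> cp cq; apply/eqP; rewrite eq_sym subr_eq; apply/eqP.
  rewrite -(contourD ab cd (cB _ _ cp cq) cq).
  by apply: eq_contour => // w _; exact/esym/subrK.
(* Nothing is known of [phi' u] beyond distance [r]; the plain quotient is used there, which does
   not affect continuity at [z]. *)
exists (fun u => if normc (u - z) < r then contour (phi' u) a b c d else
   (contour (phi u) a b c d - contour (phi z) a b c d) / (u - z)); split.
- apply/continuous_complexP => e e0; rewrite zz.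
  pose L := 4 * (`|C| + 1) * ((b - a) + (d - c)) + 1.
  have L0 : 0 < L.
    have ba : 0 <= (b - a) + (d - c) by lra.
    have C1 : 0 <= 4 * (`|C| + 1) by have := normr_ge0 C; lra.
    by have := mulr_ge0 C1 ba; rewrite /L; lra.
  exists (Num.min r (e / L)); first by rewrite lt_min r0 divr_gt0.
  move=> u; rewrite lt_min => /andP[ur]; rewrite ur ltr_pdivlMr// => ue.
  rewrite -contourB; [|exact: cphi'|exact: cphi'].
  apply: le_lt_trans ue.
  apply: le_trans (normc_contour (M := (`|C| + 1) * normc (u - z)) ab cd _ _) _.
  + by apply: cB; exact: cphi'.
  + move=> w wf; apply: le_trans (B u w ur wf) _.
    by rewrite ler_wpM2r ?normc_ge0// ler_wpDr// ler_norm.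
  + have := normc_ge0 (u - z); rewrite /L.
    have -> : 4 * ((`|C| + 1) * normc (u - z)) * (b - a + (d - c)) =
      normc (u - z) * (4 * (`|C| + 1) * (b - a + (d - c))) by ring.
    by lra.
- by rewrite zz.
- move=> u; case: ifPn => ur.
    rewrite mulrC -(contourZ (u - z) ab cd (cphi' u ur)).
    rewrite -(contourB _ _ (cphi u ur) (cphi z zz)).
    by apply: eq_contour => // w wf; exact: E.
  rewrite divfK//; rewrite subr_eq0; apply: contraNneq ur => ->.
  by rewrite zz.
Qed.

End CauchyFormula.

(** * The derivative of a holomorphic function is holomorphic *)

Section HolomorphicDerivative.
Context {R : realType}.
Implicit Types (a b c d e M r : R) (f g : R[i]^o -> R[i]^o) (z w u k l : R[i]).

Lemma rect_bounded f a b c d : a <= b -> c <= d -> cont_on (rect a b c d) f ->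
  exists M, forall w, rect a b c d w -> normc (f w) <= M.
Proof.
move=> ab cd cf; apply: contrapT => nM.
pose P a' b' c' d' := ~ exists M, forall w, rect a' b' c' d' w -> normc (f w) <= M.
have [] := @rect_bisection _ P a b c d ab cd nM.
  move=> p1 p2 p3 p4 _ _ H.
  set m := (p1 + p2) / 2; set n := (p3 + p4) / 2.
  case: (pselect (P p1 m p3 n)) => [?|/contrapT[M1 k1]]; first by constructor 1.
  case: (pselect (P m p2 p3 n)) => [?|/contrapT[M2 k2]]; first by constructor 2.
  case: (pselect (P p1 m n p4)) => [?|/contrapT[M3 k3]]; first by constructor 3.
  case: (pselect (P m p2 n p4)) => [?|/contrapT[M4 k4]]; first by constructor 4.
  exfalso; apply: H.
  exists (Num.max (Num.max M1 M2) (Num.max M3 M4)) => w [/andP[w1 w2] /andP[w3 w4]].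
  rewrite !le_max; have [x1|/ltW x1] := leP (complex.Re w) m;
    have [y1|/ltW y1] := leP (complex.Im w) n.
  - by rewrite k1//; split; apply/andP.
  - by rewrite k3 ?orbT//; split; apply/andP.
  - by rewrite k2 ?orbT//; split; apply/andP.
  - by rewrite k4 ?orbT//; split; apply/andP.
move=> z zr Hz.
have /continuous_complexP/(_ 1 ltr01)[del del0 Hd] := cf z zr.
have [p1 [p2 [p3 [p4 [[p12 p34] zp small]]]]] := Hz _ del0; apply.
exists (1 + normc (f z)) => w [/andP[w1 w2] /andP[w3 w4]].
have wzt : normc (w - z) < del.
  apply: le_lt_trans (normc_leReIm _) _; apply: le_lt_trans small.
  case: zp => /andP[z1 z2] /andP[z3 z4]; apply: lerD.
    have -> : complex.Re (w - z) = complex.Re w - complex.Re z by case: (w) (z) => ? ? [].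
    by rewrite ler_norml; lra.
  have -> : complex.Im (w - z) = complex.Im w - complex.Im z by case: (w) (z) => ? ? [].
  by rewrite ler_norml; lra.
have -> : f w = (f w - f z) + f z by rewrite subrK.
by apply: le_trans (normcD _ _) _; rewrite lerD2r ltW//; exact: Hd.
Qed.

Lemma cont_onM (A : set R[i]) f g : cont_on A f -> cont_on A g ->
  cont_on A (fun w => f w * g w).
Proof.
by move=> cf cg w wA; apply: (@continuousM _ R[i]^o f g); [exact: cf|exact: cg].
Qed.

Lemma cont_onD (A : set R[i]) f g : cont_on A f -> cont_on A g ->
  cont_on A (fun w => f w + g w).
Proof.
by move=> cf cg w wA; apply: (@continuousD _ _ _ f g); [exact: cf|exact: cg].
Qed.

Lemma frame_far z0 u e w : 0 < e -> normc (u - z0) < e / 2 ->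
  frame (complex.Re z0 - e) (complex.Re z0 + e)
        (complex.Im z0 - e) (complex.Im z0 + e) w -> e / 2 < normc (w - u).
Proof.
move=> e0 uz [_ H].
have wz : e <= normc (w - z0).
  have ReB : complex.Re (w - z0) = complex.Re w - complex.Re z0 by case: (w) (z0) => ? ? [].
  have ImB : complex.Im (w - z0) = complex.Im w - complex.Im z0 by case: (w) (z0) => ? ? [].
  case: H => H; [apply: le_trans (normc_geRe _)|apply: le_trans (normc_geRe _)|
    apply: le_trans (normc_geIm _)|apply: le_trans (normc_geIm _)];
    rewrite ?ReB ?ImB H ler_normr; apply/orP; first [left; lra|right; lra].
have : normc (w - z0) <= normc (w - u) + normc (u - z0).
  by apply: le_trans (normcD _ _); rewrite addrA subrK.
lra.
Qed.

Section CauchyKernel.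
Variables (z0 : R[i]) (e : R) (e0 : 0 < e) (psi : R[i]^o -> R[i]^o).
Let a := complex.Re z0 - e.
Let b := complex.Re z0 + e.
Let c := complex.Im z0 - e.
Let d := complex.Im z0 + e.
Hypothesis cpsi : cont_on (frame a b c d) psi.
Variable M : R.
Hypothesis psiM : forall w, frame a b c d w -> normc (psi w) <= M.

Let ab : a <= b. Proof. by have := e0; rewrite /a /b; lra. Qed.
Let cd : c <= d. Proof. by have := e0; rewrite /c /d; lra. Qed.

(** Cauchy integrals of [psi] over the square of half-side [e] around [z0]; the kernel of [ckernel2]
    is the derivative in [u] of that of [ckernel]. *)
Definition ckernel u := contour (fun w => psi w * (w - u)^-1) a b c d.
Definition ckernel2 u := contour (fun w => psi w * ((w - u)^-1 * (w - u)^-1)) a b c d.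

Let near2 z u : normc (z - z0) < e / 4 -> normc (u - z) < e / 4 ->
  normc (u - z0) < e / 2.
Proof.
move=> ? ?; have : normc (u - z0) <= normc (u - z) + normc (z - z0).
  by apply: le_trans (normcD _ _); rewrite addrA subrK.
lra.
Qed.

Let far u w : normc (u - z0) < e / 2 -> frame a b c d w ->
  w != u /\ normc (w - u)^-1 <= 2 / e.
Proof.
move=> uz wf; have H := frame_far e0 uz wf.
have p : 0 < normc (w - u) by apply: le_lt_trans H; rewrite divr_ge0// ltW.
split; first by rewrite -subr_eq0 -normc_gt0.
rewrite ComplexField.Normc.normcV -[2 / e]invf_div lef_pV2 ?posrE ?divr_gt0//.
exact: ltW.
Qed.

Let cinv u : normc (u - z0) < e / 2 -> cont_on (frame a b c d) (fun w => (w - u)^-1).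
Proof. by move=> uz w wf; apply: continuous_invB; have [] := far uz wf. Qed.

Let M0 w : frame a b c d w -> 0 <= M.
Proof. by move=> /psiM; apply: le_trans; exact: normc_ge0. Qed.

Let nM x y (p q : R) : normc x <= p -> normc y <= q -> normc (x * y) <= p * q.
Proof.
move=> xp yq; rewrite ComplexField.Normc.normcM; apply: ler_pM => //; exact: normc_ge0.
Qed.

Let invB z u w : w != u -> w != z ->
  (w - u)^-1 - (w - z)^-1 = (u - z) * ((w - u)^-1 * (w - z)^-1).
Proof.
rewrite -[w == u]subr_eq0 -[w == z]subr_eq0 => wu wz.
by field; rewrite wu wz.
Qed.

Lemma is_derive_ckernel z : normc (z - z0) < e / 4 ->
  is_derive (z : R[i]^o) 1 (ckernel : R[i]^o -> R[i]^o) (ckernel2 z).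
Proof.
move=> zz; have z2 : normc (z - z0) < e / 2 by have := e0; lra.
apply: (@is_derive_contour _ (fun u w => psi w * (w - u)^-1)
  (fun u w => psi w * ((w - u)^-1 * (w - z)^-1)) a b c d z
  (M * (2 / e * (2 / e) * (2 / e))) (e / 4) ab cd).
- by rewrite divr_gt0.
- move=> u uz; have u2 := near2 zz uz.
  exact: (cont_onM cpsi (cinv u2)).
- move=> u uz; have u2 := near2 zz uz.
  exact: (cont_onM cpsi (cont_onM (cinv u2) (cinv z2))).
- move=> u w uz wf; have u2 := near2 zz uz.
  have [wu _] := far u2 wf; have [wz _] := far z2 wf.
  by rewrite -mulrBr invB// mulrCA.
- move=> u w uz wf; have u2 := near2 zz uz.
  have [wu Bu] := far u2 wf; have [wz Bz] := far z2 wf.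
  rewrite -mulrBr -mulrBl invB//.
  have -> : psi w * ((u - z) * ((w - u)^-1 * (w - z)^-1) * (w - z)^-1) =
    (psi w * ((w - u)^-1 * (w - z)^-1 * (w - z)^-1)) * (u - z) by ring.
  apply: nM => //; apply: nM; first exact: psiM.
  by apply: nM => //; apply: nM.
Qed.

Lemma derivable_ckernel2 : derivable (ckernel2 : R[i]^o -> R[i]^o) (z0 : R[i]^o) 1.
Proof.
have zz : normc (z0 - z0) < e / 4 by rewrite subrr ComplexField.Normc.normc0 divr_gt0.
have z2 : normc (z0 - z0) < e / 2 by rewrite subrr ComplexField.Normc.normc0 divr_gt0.
(* The difference quotient of the squared kernel: with A = 1 / (w - u) and B = 1 / (w - z0) one has
   A - B = (u - z0) A B, hence A^2 - B^2 = (u - z0) A B (A + B). *)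
pose K u w := ((w - u)^-1 * (w - z0)^-1) * ((w - u)^-1 + (w - z0)^-1).
suff : is_derive (z0 : R[i]^o) 1 (ckernel2 : R[i]^o -> R[i]^o)
   (contour (fun w => psi w * K z0 w) a b c d) by case.
apply: (@is_derive_contour _ (fun u w => psi w * ((w - u)^-1 * (w - u)^-1))
  (fun u w => psi w * K u w) a b c d z0
  (M * ((2 / e * (2 / e)) * (2 / e) * (2 / e + (2 / e + 2 / e)))) (e / 4) ab cd).
- by rewrite divr_gt0.
- move=> u uz; have u2 := near2 zz uz.
  exact: (cont_onM cpsi (cont_onM (cinv u2) (cinv u2))).
- move=> u uz; have u2 := near2 zz uz.
  exact: (cont_onM cpsi (cont_onM (cont_onM (cinv u2) (cinv z2))
    (cont_onD (cinv u2) (cinv z2)))).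
- move=> u w uz wf; have u2 := near2 zz uz.
  have [wu _] := far u2 wf; have [wz _] := far z2 wf.
  rewrite -mulrBr mulrCA; congr (_ * _); rewrite /K mulrA -invB//.
  ring.
- move=> u w uz wf; have u2 := near2 zz uz.
  have [wu Bu] := far u2 wf; have [wz Bz] := far z2 wf.
  (* In the same notation, A B (A + B) - 2 B^3 = (A - B) B (A + 2 B). *)
  have -> : psi w * K u w - psi w * K z0 w =
    (psi w * (((w - u)^-1 * (w - z0)^-1) * (w - z0)^-1 *
      ((w - u)^-1 + ((w - z0)^-1 + (w - z0)^-1)))) * (u - z0).
    transitivity (psi w * (((u - z0) * ((w - u)^-1 * (w - z0)^-1)) * (w - z0)^-1 *
      ((w - u)^-1 + ((w - z0)^-1 + (w - z0)^-1)))); last by ring.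
    by rewrite -invB// /K; ring.
  apply: nM => //; apply: nM; first exact: psiM.
  apply: nM; first by apply: nM => //; apply: nM.
  apply: le_trans (normcD _ _) _; apply: lerD => //.
  by apply: le_trans (normcD _ _) _; apply: lerD.
Qed.

End CauchyKernel.

(* The sides of a square run counterclockwise around its centre, so each of
   them contributes positively to the winding number. *)
Lemma Im_contour_inv z0 e : 0 < e ->
  0 < complex.Im (contour (fun w => (w - z0)^-1) (complex.Re z0 - e)
    (complex.Re z0 + e) (complex.Im z0 - e) (complex.Im z0 + e)).
Proof.
move=> e0; set a := _ - e; set b := _ + e; set c := _ - e; set d := _ + e.
have [ab cd] : a <= b /\ c <= d by rewrite /a /b /c /d; split; lra.
have [ha hb] : a < complex.Re z0 < b /\ c < complex.Im z0 < d.
  by rewrite /a /b /c /d; split; lra.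
have cinv : cont_on (frame a b c d) (fun w => (w - z0)^-1).
  by move=> w /(frame_neq ha hb); exact: continuous_invB.
have [c1 c2 c3 c4] := frame_ccont ab cd cinv.
have [[_ i1] [_ i2] [i3 _] [i4 _]] := (And4 (ccont_integrable c1)
  (ccont_integrable c2) (ccont_integrable c3) (ccont_integrable c4)).
have cst (p q : R) : lebesgue_measure.-integrable `[p, q] (EFin \o (fun=> (2 * e)^-1 : R)).
  by apply: continuous_compact_integrable => [|x]; [exact: segment_compact|exact: cvg_cst].
have low (p q : R) (h : R -> R) : p < q -> lebesgue_measure.-integrable `[p, q] (EFin \o h) ->
    (forall x, p <= x <= q -> (2 * e)^-1 <= h x) ->
    0 < \int[lebesgue_measure]_(x in `[p, q]) h x.
  move=> pq Ih hx; apply: (@lt_le_trans _ _ ((2 * e)^-1 * (q - p))).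
    by rewrite mulr_gt0// ?subr_gt0// invr_gt0 mulr_gt0.
  have -> : (2 * e)^-1 * (q - p) = \int[lebesgue_measure]_(x in `[p, q]) ((2 * e)^-1).
    by rewrite Rintegral_cst//= lebesgue_measure_itv/= lte_fin pq.
  apply: le_Rintegral => // x /=; rewrite in_itv/=; exact: hx.
(* On a side, one coordinate of w - z0 has absolute value e and the other at most e, so the relevant
   part of 1 / (w - z0) is at least e / (2 e^2) in absolute value. *)
have bnd (p q : R) : `|p| <= e -> `|q| = e -> (2 * e)^-1 <= e / (p ^+ 2 + q ^+ 2).
  move=> pe qe; rewrite -[q ^+ 2]real_normK ?num_real// qe.
  have p2 : p ^+ 2 <= e ^+ 2 by rewrite -[p ^+ 2]real_normK ?num_real// ler_sqr ?nnegrE// ltW.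
  have e2 : 0 < e ^+ 2 by rewrite exprn_gt0.
  have s0 : 0 < p ^+ 2 + e ^+ 2 by rewrite ltr_wpDl// sqr_ge0.
  rewrite ler_pdivlMr// mulrC ler_pdivrMr ?mulr_gt0//.
  have -> : e * (2 * e) = e ^+ 2 + e ^+ 2 by ring.
  by rewrite lerD2r.
have E : complex.Im (contour (fun w => (w - z0)^-1) a b c d) =
  ((\int[lebesgue_measure]_(x in `[a, b]) complex.Im ((x +i* c)%C - z0)^-1) -
   (\int[lebesgue_measure]_(x in `[a, b]) complex.Im ((x +i* d)%C - z0)^-1)) +
  ((\int[lebesgue_measure]_(x in `[c, d]) complex.Re ((b +i* x)%C - z0)^-1) -
   (\int[lebesgue_measure]_(x in `[c, d]) complex.Re ((a +i* x)%C - z0)^-1)).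
  by rewrite /contour /cint /= !mul0r !mul1r !add0r.
have neg (p q : R) (h : R -> R) : lebesgue_measure.-integrable `[p, q] (EFin \o h) ->
    (- (\int[lebesgue_measure]_(x in `[p, q]) h x) =
      \int[lebesgue_measure]_(x in `[p, q]) (- h x)) /\
    lebesgue_measure.-integrable `[p, q] (EFin \o (fun x => - h x)).
  move=> Ih; split; last by have := integrableN Ih.
  by rewrite -[LHS]mulN1r -RintegralZl//; apply: eq_Rintegral => x _; rewrite mulN1r.
rewrite {}E.
have [-> j2] := neg _ _ _ i2; have [-> j4] := neg _ _ _ i4.
have ab' : a < b by rewrite /a /b; lra.
have cd' : c < d by rewrite /c /d; lra.
have absN : `| - e| = e by rewrite normrN gtr0_norm.
have absP : `|e| = e by rewrite gtr0_norm.
have e1 : c - complex.Im z0 = - e by rewrite /c; ring.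
have e2 : d - complex.Im z0 = e by rewrite /d; ring.
have e3 : a - complex.Re z0 = - e by rewrite /a; ring.
have e4 : b - complex.Re z0 = e by rewrite /b; ring.
clearbody a b c d.
move: e1 e2 e3 e4 i1 j2 i3 j4; case: z0 {ha hb cinv c1 c2 c3 c4 i2 i4} => x0 y0 /=.
move=> e1 e2 e3 e4 i1 j2 i3 j4.
have absx x : a <= x <= b -> `|x - x0| <= e by rewrite ler_norml; lra.
have absy y : c <= y <= d -> `|y - y0| <= e by rewrite ler_norml; lra.
rewrite !addr_gt0//; apply: low => // x xab.
- by rewrite e1 -mulNr opprK; apply: bnd; [exact: absx|].
- by rewrite e2 opprK; apply: bnd; [exact: absx|].
- by rewrite e4 addrC; apply: bnd; [exact: absy|].
- by rewrite e3 -mulNr opprK addrC; apply: bnd; [exact: absy|].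
Qed.

(* Near [z0], [f] is the quotient of two Cauchy integrals over a square centred
   at [z0], of [f] and of [1]; both are twice differentiable. *)
Theorem derivable_derive f z0 r : 0 < r ->
  (forall z, normc (z - z0) < r -> derivable f (z : R[i]^o) 1) ->
  derivable (fun z : R[i]^o => 'D_1 f z) (z0 : R[i]^o) 1.
Proof.
move=> r0 df; pose e := r / 4; have e0 : 0 < e by rewrite divr_gt0.
pose a := complex.Re z0 - e; pose b := complex.Re z0 + e.
pose c := complex.Im z0 - e; pose d := complex.Im z0 + e.
have [ab cd] : a <= b /\ c <= d by rewrite /a /b /c /d; split; lra.
have ReB w z : complex.Re (w - z) = complex.Re w - complex.Re z by case: w z => ? ? [].
have ImB w z : complex.Im (w - z) = complex.Im w - complex.Im z by case: w z => ? ? [].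
have dfr w : rect a b c d w -> derivable f (w : R[i]^o) 1.
  move=> [/andP[w1 w2] /andP[w3 w4]]; apply: df.
  apply: le_lt_trans (normc_leReIm _) _.
  apply: (@le_lt_trans _ _ (e + e)); last by rewrite /e; lra.
  by apply: lerD; rewrite ?ReB ?ImB ler_norml; move: w1 w2 w3 w4; rewrite /a /b /c /d; lra.
have cf : cont_on (rect a b c d) f.
  by move=> w /dfr /derivableP /is_derive_continuous.
have [M fM] := rect_bounded ab cd cf.
have cff : cont_on (frame a b c d) f by apply: cont_onW cf; exact: frame_rect.
have fMf w : frame a b c d w -> normc (f w) <= M by move=> /frame_rect /fM.
pose one : R[i]^o -> R[i]^o := fun=> 1.
have c1 : cont_on (frame a b c d) one by move=> w _; exact: continuous_complex_cst.
have oneM w : frame a b c d w -> normc (one w) <= 1.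
  by move=> _; rewrite ComplexField.Normc.normc1.
pose F : R[i]^o -> R[i]^o := ckernel z0 e f.
pose N : R[i]^o -> R[i]^o := ckernel z0 e one.
pose F2 : R[i]^o -> R[i]^o := ckernel2 z0 e f.
pose N2 : R[i]^o -> R[i]^o := ckernel2 z0 e one.
have dF z : normc (z - z0) < e / 4 -> is_derive (z : R[i]^o) 1 F (F2 z).
  by move=> ze; exact: (is_derive_ckernel e0 cff fMf ze).
have dN z : normc (z - z0) < e / 4 -> is_derive (z : R[i]^o) 1 N (N2 z).
  by move=> ze; exact: (is_derive_ckernel e0 c1 oneM ze).
have dF2 := derivableP (derivable_ckernel2 e0 cff fMf).
have dN2 := derivableP (derivable_ckernel2 e0 c1 oneM).
have zz : normc (z0 - z0) < e / 4 by rewrite subrr ComplexField.Normc.normc0 divr_gt0.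
have Nz0 : 0 < normc (N z0).
  rewrite normc_gt0; apply/eqP => Nz; have := Im_contour_inv z0 e0.
  rewrite -/a -/b -/c -/d (_ : contour _ _ _ _ _ = N z0).
    by rewrite Nz ltxx.
  by apply: eq_contour => // w _; rewrite /one mul1r.
have [del del0 Hd] := (continuous_complexP _ _).1 (is_derive_continuous (dN _ zz)) _ Nz0.
have Nn0 z : normc (z - z0) < del -> N z != 0.
  by move=> /Hd; apply: contraTneq => ->; rewrite sub0r normcN ltxx.
(* On the ball of radius s the function N does not vanish, and points within a further e / 8 remain
   in the ball of radius e / 4, where F = f N. *)
pose s := Num.min del (e / 8).
have s0 : 0 < s by rewrite lt_min del0 divr_gt0.
have fE z : normc (z - z0) < e / 4 -> F z = f z * N z.
  move=> ze; rewrite /F /ckernel -/a -/b -/c -/d.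
  have zab : a < complex.Re z < b.
    have := le_lt_trans (normc_geRe _) ze; rewrite ReB ltr_norml /a /b; lra.
  have zcd : c < complex.Im z < d.
    have := le_lt_trans (normc_geIm _) ze; rewrite ImB ltr_norml /c /d; lra.
  rewrite (cauchy_formula zab zcd dfr); congr (_ * _).
  by apply: eq_contour => // w _; rewrite /one mul1r.
have dI z : normc (z - z0) < s ->
    is_derive (z : R[i]^o) 1 (fun u => (N u)^-1) (- (N z) ^- 2 * N2 z).
  rewrite lt_min => /andP[z1 z2].
  have ze : normc (z - z0) < e / 4 by lra.
  exact: (@is_derive_comp _ (fun u => u^-1) N z _ _ (is_derive_inv (Nn0 _ z1)) (dN _ ze)).
have Df z : normc (z - z0) < s ->
    'D_1 f z = F z * (- ((N z)^-1 * (N z)^-1) * N2 z) + (N z)^-1 * F2 z.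
  move=> zs; have [z1 z2] : normc (z - z0) < del /\ normc (z - z0) < e / 8.
    by move: zs; rewrite lt_min => /andP[].
  have ze : normc (z - z0) < e / 4 by lra.
  have H := is_derive_mulc (dF z ze) (dI z zs).
  have -> : - ((N z)^-1 * (N z)^-1) = - (N z) ^- 2 by rewrite expr2 invfM.
  suff : is_derive (z : R[i]^o) 1 f (F z * (- (N z) ^- 2 * N2 z) + (N z)^-1 * F2 z) by case.
  apply: is_derive_near H; exists (Num.min (del - normc (z - z0)) (e / 8)).
    by rewrite lt_min subr_gt0 z1 divr_gt0.
  move=> w; rewrite lt_min => /andP[w1 w2].
  have wz : normc (w - z0) <= normc (w - z) + normc (z - z0).
    by apply: le_trans (normcD _ _); rewrite addrA subrK.
  rewrite fE ?mulfK//; last lra.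
  by apply: Nn0; lra.
have zs : normc (z0 - z0) < s by rewrite subrr ComplexField.Normc.normc0.
have dIz := dI z0 zs.
have dNII := is_derive_mulc (is_derive_mulc dIz dIz) dN2.
have dG := is_derive_mulc (dF z0 zz) dNII.
have [H _] := is_derive_mulc dIz dF2.
have dH := derivableB H (ex_derive (is_derive:=dG)).
suff : is_derive (z0 : R[i]^o) 1 (fun z => 'D_1 f z)
   ('D_1 ((fun x : R[i]^o => (N x)^-1 * F2 x) -
      (fun x : R[i]^o => F x * ((N x)^-1 * (N x)^-1 * N2 x))) z0) by case.
apply: is_derive_near (derivableP dH); exists s => // z /Df ->.
by rewrite addrC mulNr mulrN.
Qed.

End HolomorphicDerivative.

(** * The orbit of infinity under a lattice *)

Lemma exists_pushforward d d' (T1 : measurableType d) (T2 : measurableType d')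
    (R : realType) (m : {measure set T1 -> \bar R}) (f : T1 -> T2) :
  measurable_fun setT f ->
  exists nu : {measure set T2 -> \bar R}, forall A, nu A = m (f @^-1` A).
Proof.
move=> mf.
by exists (measure_function_pushforward__canonical__measure_function_Measure m mf).
Qed.

Section DensityMeasure.
Local Open Scope ereal_scope.
Context d (T : measurableType d) (R : realType).
Variables (m : {measure set T -> \bar R}) (f : T -> \bar R).
Hypotheses (mf : measurable_fun setT f) (f0 : forall x, 0 <= f x).

Definition density_measure (A : set T) : \bar R := \int[m]_(x in A) f x.

Let density0 : density_measure set0 = 0.
Proof. exact: integral_set0. Qed.

Let density_ge0 A : 0 <= density_measure A.
Proof. exact: integral_ge0. Qed.

Let density_sigma_additive : semi_sigma_additive density_measure.
Proof.
move=> F mF tF mUF; rewrite /density_measure ge0_integral_bigcup//; last first.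
  exact: measurable_funTS.
by apply: is_cvg_ereal_nneg_natsum_cond => n _ _; exact: density_ge0.
Qed.

HB.instance Definition _ := isMeasure.Build _ _ _
  density_measure density0 density_ge0 density_sigma_additive.

Lemma exists_density :
  exists nu : {measure set T -> \bar R}, forall A, nu A = \int[m]_(x in A) f x.
Proof. by exists density_measure. Qed.

End DensityMeasure.

(** * Lebesgue measure on the line and separated translates *)

Section LineMeasure.
Context {R : realType}.
Notation mu := (@lebesgue_measure R).
Implicit Types (B : set R) (a u p q : R).

Lemma lebesgue_measure_shift B u : measurable B ->
  mu ((fun x => x + u) @^-1` B) = mu B.
Proof.
move=> mB; have mf : measurable_fun setT (fun x : R => x + u) by exact: measurable_funD.
suff : pushforward mu (fun x : R => x + u : measurableTypeR R) B = mu B by [].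
apply/esym/lebesgue_measure_unique => //= _ [[a b]] _ <-.
rewrite /pushforward.
have -> : (fun x : R => x + u) @^-1` `]a, b] = `]a - u, b - u]%classic.
  by apply/seteqP; split=> x /=; rewrite !in_itv/= ltrBlDr lerBrDr.
rewrite !lebesgue_measure_itv /= !lte_fin ltrD2r.
by case: ifPn => // _; rewrite -!EFinB; congr EFin; ring.
Qed.

Lemma lebesgue_measure_opp B : measurable B -> mu (-%R @^-1` B) = mu B.
Proof. exact: lebesgue_measureN. Qed.

(** The pushforward under x |-> a x, multiplied by a, gives half-open intervals their length, and
    this characterises Lebesgue measure. *)
Lemma lebesgue_measure_scale B a : measurable B -> 0 < a ->
  mu ((fun x => a * x) @^-1` B) = (a^-1%:E * mu B)%E.
Proof.
move=> mB a0; have mf : measurable_fun setT (fun x : R => a * x) by exact: measurable_funM.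
have [nu nuE] := @exists_pushforward _ _ _ (measurableTypeR R) R mu _ mf.
suff : mscale (NngNum (ltW a0)) nu B = mu B.
  rewrite /mscale /= nuE => <-.
  by rewrite muleA -EFinM mulVf ?gt_eqF// mul1e.
apply/esym; apply: lebesgue_measure_unique => //= _ [[p q]] _ <-.
rewrite /mscale /= nuE.
have -> : (fun x : R => a * x) @^-1` `]p, q] = `]p / a, q / a]%classic.
  by apply/seteqP; split=> x /=; rewrite !in_itv/= ltr_pdivrMr// ler_pdivlMr// ![_ * a]mulrC.
rewrite [X in (_ * X)%E](_ : _ = mu (`]p / a, q / a]%classic : set R))//.
rewrite !lebesgue_measure_itv /= !lte_fin ltr_pM2r ?invr_gt0//.
case: ifPn => _; last by rewrite mule0.
by rewrite -!EFinB -EFinM; congr EFin; field; rewrite gt_eqF.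
Qed.

(* Translates of the segment by distinct elements of [T] are disjoint. *)
Lemma separated_translates_measure (T : set R) B (del : R) : 0 < del ->
  (forall x y, T x -> T y -> x != y -> del <= `|x - y|) ->
  measurable B -> (forall x, exists2 t, T t & B (x + t)) ->
  ((del / 2)%:E <= mu B)%E.
Proof.
move=> d0 sep mB cov.
have /countable_injP[f finj] : countable T.
  apply/countable_injP.
  (* Two points of [T] whose quotients by [del] have the same floor would be closer than [del]. *)
  exists (fun x => pickle (Num.floor (x / del))) => x y.
  rewrite !inE => Tx Ty /(pcan_inj pickleK) xy.
  apply/eqP/negPn/negP => /(sep _ _ Tx Ty); apply/negP; rewrite -ltNge.
  rewrite -(mulfVK (lt0r_neq0 d0) x) -(mulfVK (lt0r_neq0 d0) y) -mulrBl.
  rewrite normrM [`|del|]gtr0_norm// gtr_pMl//.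
  have := floor_itv (x / del); have := floor_itv (y / del).
  by rewrite xy intrD ltr_norml => /andP[? ?] /andP[? ?]; lra.
pose J t := `[t, t + del / 2]%classic : set R.
(* [E n] is the translate of the segment by the element of [T] numbered [n], or empty; [F n] below
   is the part of [B] in [E n] moved back into [J 0]. The sets [F n] cover [J 0], while the parts of
   [B] are disjoint. *)
pose E n := if pselect (exists2 t, T t & f t = n) is left e
  then J (sval (cid2 e)) else set0.
have mE n : measurable (E n) by rewrite /E; case: pselect => // e; exact: measurable_itv.
have ET n x : E n x -> exists t, [/\ T t, f t = n & J t x].
  by rewrite /E; case: pselect => // e; case: cid2 => t Tt ft /= Jt; exists t.
have trivE : trivIset setT (fun n => B `&` E n).
  apply/trivIsetP => m n _ _ mn; apply/seteqP;
    split=> // x [[_ /ET[t [Tt ft Jt]]] [_ /ET[s [Ts fs Js]]]].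
  have ts : t != s by apply: contraNneq mn => ts; rewrite -ft -fs ts.
  have := sep _ _ Tt Ts ts; apply/negP; rewrite -ltNge ltr_norml.
  by move: Jt Js; rewrite /J /= !in_itv /= => /andP[? ?] /andP[? ?]; lra.
have -> : (del / 2)%:E = mu (J 0).
  by rewrite lebesgue_measure_itv /= lte_fin add0r divr_gt0// sube0.
pose F n := if pselect (exists2 t, T t & f t = n) is left e
  then (fun x => x + sval (cid2 e)) @^-1` (B `&` E n) else set0.
have mF n : measurable (F n).
  rewrite /F; case: pselect => // e; rewrite -[X in measurable X]setTI.
  by apply: measurable_funD => //; exact: measurableI.
have FE n : mu (F n) = mu (B `&` E n).
  rewrite /F /E; case: pselect => [e|_]; last by rewrite setI0.
  by rewrite lebesgue_measure_shift//; apply: measurableI => //; exact: measurable_itv.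
apply: (@le_trans _ _ (\sum_(n <oo) mu (F n))%E).
  apply: measure_sigma_subadditive => //; first exact: measurable_itv.
  move=> x Jx; have [t Tt Bxt] := cov x; exists (f t) => //.
  rewrite /F /E; case: pselect => [e|]; last by case; exists t.
  case: cid2 => s Ts fs /=; have -> : s = t by apply: finj; rewrite ?inE.
  split => //.
  by move: Jx; rewrite /J /= !in_itv /= => /andP[? ?]; lra.
have mBE n : measurable (B `&` E n) by apply: measurableI; [|exact: mE].
have mUBE : measurable (\bigcup_n (B `&` E n)) by exact: bigcup_measurable.
rewrite (eq_eseriesr (fun n _ => FE n)) -measure_semi_bigcup//.
by apply: le_measure; rewrite ?inE// => x [n _ []].
Qed.

End LineMeasure.

(** * Hyperbolic area in logarithmic coordinates *)

Section LogCoordinates.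
Context {R : realType}.
Notation mu := (@lebesgue_measure R).
Implicit Types (A B : set R) (E : set (R * R)).
Local Open Scope ereal_scope.

Lemma measurable_invr : measurable_fun setT (fun x : R => x^-1 : R)%R.
Proof.
have -> : [set: R] = [set 0%R] `|` ~` [set 0%R] by rewrite setUv.
apply/measurable_funU; [exact: measurable_set1|exact: measurableC|split].
  exact: measurable_fun_set1.
apply: open_continuous_measurable_fun.
  by apply: closed_openC; exact: closed_eq.
move=> x; rewrite inE /= => /eqP x0; exact: inv_continuous.
Qed.

(** For []a, b]] the left side is the integral of 1 / y from e^a to e^b, that is b - a, and
    half-open intervals determine the measure. Intersecting with the positive axis discards the
    default values of [ln]. *)
Lemma lebesgue_measure_ln B : measurable B ->
  \int[mu]_(y in (@ln R) @^-1` B `&` `]0%R, +oo[%classic) (y^-1)%:E = mu B.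
Proof.
move=> mB; pose f := (fun y : R => (y^-1)%:E) \_ `]0%R, +oo[%classic.
have mf : measurable_fun setT f.
  apply/(measurable_restrictT _ _).1 => //.
  by apply: measurable_funTS; apply/measurable_EFinP; exact: measurable_invr.
have f0 y : 0 <= f y.
  by rewrite /f patchE; case: ifPn => //; rewrite inE/= in_itv/= andbT => y0;
    rewrite lee_fin invr_ge0 ltW.
have [nu nuE] := exists_density mu mf f0.
have [nu' nuE'] := @exists_pushforward _ _ _ (measurableTypeR R) R nu _ (@measurable_ln R).
rewrite integral_mkcondr -/f -nuE -nuE'.
apply/esym; apply: lebesgue_measure_unique => //= _ [[a b]] _ <-.
rewrite nuE' nuE /f -integral_mkcondr.
have -> : (@ln R) @^-1` `]a, b] `&` `]0%R, +oo[%classic = `]expR a, expR b]%classic.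
  apply/seteqP; split=> x /=; rewrite !in_itv /= andbT.
    by move=> [/andP[ax xb] x0]; rewrite -[x]lnK ?posrE// ltr_expR ler_expR ax.
  move=> /andP[ax xb]; have x0 : (0 < x)%R by apply: lt_trans ax; exact: expR_gt0.
  by split => //; rewrite -ltr_expR -ler_expR lnK ?posrE// ax.
rewrite lebesgue_measure_itv /= lte_fin; case: ifPn => [ab|]; last first.
  rewrite -leNgt => ba; rewrite set_itv_ge ?integral_set0// bnd_simp -leNgt.
  by rewrite ler_expR.
rewrite integral_itv_obnd_cbnd; last first.
  by apply: measurable_funTS; apply/measurable_EFinP; exact: measurable_invr.
have pos x : (expR a <= x)%R -> (0 < x)%R by apply: lt_le_trans; exact: expR_gt0.
rewrite (@continuous_FTC2 _ _ (@ln R)) ?ltr_expR//.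
- by rewrite !expRK.
- apply: continuous_in_subspaceT => x; rewrite inE/= in_itv/= => /andP[/pos x0 _].
  by apply: inv_continuous; rewrite gt_eqF.
- split.
  + move=> x; rewrite in_itv/= => /andP[/ltW/pos x0 _].
    by have [] := is_derive1_ln x0.
  + by apply: cvg_at_right_filter; apply: continuous_ln; exact: expR_gt0.
  + by apply: cvg_at_left_filter; apply: continuous_ln; exact: expR_gt0.
- move=> x; rewrite in_itv/= => /andP[/ltW/pos x0 _].
  by rewrite derive1E; have [_ ->] := is_derive1_ln x0.
Qed.

(** The substitution w = x / y, s = ln y is verified on products of sets only, where Tonelli
    separates the variables; uniqueness of the product measure gives the rest. *)
Lemma area_log E : measurable E -> (forall q, E q -> 0 < q.2)%R ->
  (mu \x mu) ((fun q : R * R => (q.1 * expR q.2, expR q.2)%R) @^-1` E) =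
  \int[mu \x mu]_(q in E) ((q.2 ^+ 2)^-1)%:E.
Proof.
move=> mE Epos; pose P : set (R * R) := [set: R] `*` `]0%R, +oo[%classic.
have mP : measurable P by exact: measurableX.
have PE q : P q <-> (0 < q.2)%R.
  by rewrite /P /= in_itv/= andbT; split=> [[]|].
pose f := (fun q : R * R => ((q.2 ^+ 2)^-1)%:E) \_ P.
have minv2 : measurable_fun setT (fun q : R * R => ((q.2 ^+ 2)^-1)%R).
  apply: (measurableT_comp (f := fun x : R => (x^-1)%R)); first exact: measurable_invr.
  by apply: measurable_funX; exact: measurable_snd.
have mf : measurable_fun setT f.
  apply/(measurable_restrictT _ _).1 => //.
  by apply: measurable_funTS; apply/measurable_EFinP.
have f0 q : 0 <= f q.
  by rewrite /f patchE; case: ifPn => // _; rewrite lee_fin invr_ge0 sqr_ge0.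
pose psi (q : R * R) : R * R := (q.1 / q.2, ln q.2)%R.
have mpsi : measurable_fun setT psi.
  apply: measurable_fun_pair.
    apply: measurable_funM; first exact: measurable_fst.
    apply: (measurableT_comp (f := fun x : R => (x^-1)%R)); first exact: measurable_invr.
    exact: measurable_snd.
  apply: (measurableT_comp (f := @ln R)); first exact: measurable_ln.
  exact: measurable_snd.
have [nu nuE] := exists_density (mu \x mu) mf f0.
have [nu' nuE'] := @exists_pushforward _ _ _
  (measurableTypeR R * measurableTypeR R)%type R nu _ mpsi.
set X := (X in (mu \x mu) X).
have mX : measurable X.
  rewrite -[X]setTI; apply: (_ : measurable_fun setT _) => //.
  apply: measurable_fun_pair.
    apply: measurable_funM; first exact: measurable_fst.
    apply: (measurableT_comp (f := @expR R)); first exact: measurable_expR.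
    exact: measurable_snd.
  apply: (measurableT_comp (f := @expR R)); first exact: measurable_expR.
  exact: measurable_snd.
have -> : (mu \x mu) X = nu' X.
  apply: (product_measure_unique (m1 := mu) (m2 := mu)) => //.
  move=> A B mA mB; rewrite nuE' nuE.
  have mAB : measurable (psi @^-1` (A `*` B)).
    by rewrite -[X in measurable X]setTI; apply: mpsi => //; exact: measurableX.
  pose g := f \_ (psi @^-1` (A `*` B)).
  have mg : measurable_fun setT g.
    by apply/(measurable_restrictT _ _).1 => //; exact: measurable_funTS.
  have g0 q : 0 <= g q by rewrite /g patchE; case: ifPn.
  have -> : \int[mu \x mu]_(q in psi @^-1` (A `*` B)) f q = \int[mu \x mu]_q g q.
    by rewrite integral_mkcond.
  transitivity (\int[mu]_y fubini_G mu g y).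
    exact: (fubini_tonelli2 (m1 := mu) (m2 := mu) g mg g0).
  pose h := (fun y : R => (y^-1)%:E) \_ ((@ln R) @^-1` B `&` `]0%R, +oo[%classic).
  (* For fixed y > 0 the inner integral is y^-2 times the measure of y A, that is y^-1 times the
     measure of A. *)
  have -> : fubini_G mu g = fun y => h y * mu A.
    apply/funext => y; rewrite /fubini_G /h patchE; case: ifPn; last first.
      move=> ny; rewrite mul0e; apply: integral0_eq => x _.
      rewrite /g patchE; case: ifPn => // /set_mem[/= _ By].
      rewrite /f patchE; case: ifPn => // /set_mem/PE /= y0.
      by case/negP: ny; rewrite inE /= in_itv/= andbT.
    rewrite inE /= in_itv/= andbT => -[By y0].
    have yi0 : (0 < y^-1)%R by rewrite invr_gt0.
    have mA' : measurable ((fun x : R => y^-1 * x)%R @^-1` A).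
      rewrite -[X in measurable X]setTI.
      have : measurable_fun setT (fun x : R => y^-1 * x)%R by exact: measurable_funM.
      by apply.
    have -> : y^-1%:E * mu A = ((y ^+ 2)^-1)%:E * mu ((fun x : R => y^-1 * x)%R @^-1` A).
      rewrite lebesgue_measure_scale// muleA -EFinM; congr (_%:E * _).
      by field; rewrite gt_eqF.
    rewrite -integral_cst// [RHS]integral_mkcond; apply: eq_integral => x _.
    rewrite /g !patchE.
    have -> : ((x, y) \in psi @^-1` (A `*` B)) = (x \in (fun x : R => y^-1 * x)%R @^-1` A).
      apply/idP/idP; rewrite !inE /psi /=; first by move=> [+ _]; rewrite mulrC.
      by rewrite mulrC.
    case: ifPn => // _; rewrite /f patchE ifT//.
    by rewrite inE; exact/PE.
  have mD : measurable ((@ln R) @^-1` B `&` `]0%R, +oo[%classic).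
    apply: measurableI => //; rewrite -[X in measurable X]setTI.
    by apply: measurable_ln.
  have h0 y : 0 <= h y.
    rewrite /h patchE; case: ifPn => // /set_mem[_] /=; rewrite in_itv/= andbT => y0.
    by rewrite lee_fin invr_ge0 ltW.
  have mh : measurable_fun setT h.
    apply/(measurable_restrictT _ _).1 => //.
    by apply: measurable_funTS; apply/measurable_EFinP; exact: measurable_invr.
  rewrite ge0_integralZr//.
  by rewrite /h -integral_mkcond lebesgue_measure_ln// muleC.
rewrite nuE' nuE -integral_mkcondr; congr (integral _ _ _).
apply/seteqP; split=> [[x y] [/=]|[x y] /= Exy].
  rewrite /X /psi /= => + /PE/= y0.
  by rewrite lnK ?posrE// divfK ?gt_eqF.
have /= y0 := Epos _ Exy; split; last exact/PE.
by rewrite /X /psi /= lnK ?posrE// divfK ?gt_eqF.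
Qed.

End LogCoordinates.

(** * Area-preserving maps of the plane, Moebius maps among them *)

Section PlaneMaps.
Context {R : realType}.
Notation mu := (@lebesgue_measure R).
Notation mu2 := (mu \x mu)%E.
Implicit Types (E : set (R * R)) (phi : R * R -> R * R) (u : R -> R).

Definition area_preserving phi := forall E, measurable E ->
  measurable (phi @^-1` E) /\ mu2 (phi @^-1` E) = mu2 E.

Lemma area_preserving_comp phi psi : area_preserving phi -> area_preserving psi ->
  area_preserving (psi \o phi).
Proof.
move=> hphi hpsi E mE; have [m1 e1] := hpsi E mE; have [m2 e2] := hphi _ m1.
by split; [exact: m2|rewrite -e1 -e2].
Qed.

(** The product measure integrates over columns by definition; its uniqueness permits slicing by
    rows. *)
Lemma plane_measure_ysection E : measurable E ->
  mu2 E = (\int[mu]_s mu (ysection E s))%E.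
Proof.
move=> mE; apply: (@product_measure_unique _ _ _ _ _ mu mu (mu \x^ mu)%E) => // A B mA mB.
exact: product_measure2E.
Qed.

(** Cavalieri's principle, meant for horizontal shears and reflections. *)
Lemma area_preserving_rows phi :
  measurable_fun setT phi ->
  (forall E s, measurable E ->
     mu (ysection (phi @^-1` E) s) = mu (ysection E s)) ->
  area_preserving phi.
Proof.
move=> mphi H E mE; have mpE : measurable (phi @^-1` E).
  by rewrite -[X in measurable X]setTI; exact: mphi.
split; first exact: mpE.
rewrite (plane_measure_ysection mE) (plane_measure_ysection mpE).
by apply: eq_integral => s _; exact: H.
Qed.

Lemma area_preserving_columns phi :
  measurable_fun setT phi ->
  (forall E w, measurable E ->
     mu (xsection (phi @^-1` E) w) = mu (xsection E w)) ->
  area_preserving phi.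
Proof.
move=> mphi H E mE; have mpE : measurable (phi @^-1` E).
  by rewrite -[X in measurable X]setTI; exact: mphi.
split; first exact: mpE.
rewrite /product_measure1 /=.
by apply: eq_integral => s _; exact: H.
Qed.

Lemma area_preserving_shear1 u : measurable_fun setT u ->
  area_preserving (fun q => (q.1 + u q.2, q.2)).
Proof.
move=> mu_; apply: area_preserving_rows => [|E s mE].
  apply: measurable_fun_pair; last exact: measurable_snd.
  apply: measurable_funD; first exact: measurable_fst.
  by apply: (measurableT_comp mu_); exact: measurable_snd.
rewrite -[RHS](lebesgue_measure_shift (u s) (measurable_ysection s mE)); congr (mu _).
Qed.

Lemma area_preserving_shear2 u : measurable_fun setT u ->
  area_preserving (fun q => (q.1, q.2 + u q.1)).
Proof.
move=> mu_; apply: area_preserving_columns => [|E s mE].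
  apply: measurable_fun_pair; first exact: measurable_fst.
  apply: measurable_funD; first exact: measurable_snd.
  by apply: (measurableT_comp mu_); exact: measurable_fst.
rewrite -[RHS](lebesgue_measure_shift (u s) (measurable_xsection s mE)); congr (mu _).
Qed.

Lemma area_preserving_opp1 : area_preserving (fun q => (- q.1, q.2)).
Proof.
apply: area_preserving_rows => [|E s mE].
  apply: measurable_fun_pair; last exact: measurable_snd.
  by apply: measurable_funN; exact: measurable_fst.
rewrite -[RHS](lebesgue_measure_opp (measurable_ysection s mE)); congr (mu _).
Qed.

Lemma area_preserving_opp2 : area_preserving (fun q => (q.1, - q.2)).
Proof.
apply: area_preserving_columns => [|E s mE].
  apply: measurable_fun_pair; first exact: measurable_fst.
  by apply: measurable_funN; exact: measurable_snd.
rewrite -[RHS](lebesgue_measure_opp (measurable_xsection s mE)); congr (mu _).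
Qed.

Lemma log_point_subproof (q : R * R) :
  0 < complex.Im ((q.1 * expR q.2) +i* expR q.2)%C.
Proof. exact: expR_gt0. Qed.

(* In the coordinates [w = x / y] and [s = ln y] the hyperbolic area is Lebesgue
   measure. *)
Definition log_point (q : R * R) : uhp R := Uhp (log_point_subproof q).

(** These three are z + b, e^r z and -1 / z in the coordinates w = x / y, s = ln y; for the last
    one, Im (-1 / z) = y / (x^2 + y^2) = 1 / (y (1 + w^2)). *)
Definition translate_log b (q : R * R) : R * R := (q.1 + b * expR (- q.2), q.2).
Definition dilate_log r (q : R * R) : R * R := (q.1, q.2 + r).
Definition invert_log (q : R * R) : R * R := (- q.1, - q.2 - ln (1 + q.1 ^+ 2)).

Lemma area_preserving_translate b : area_preserving (translate_log b).
Proof.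
apply: (@area_preserving_shear1 (fun s => b * expR (- s))).
apply: measurable_funM => //; apply: (measurableT_comp (@measurable_expR R)).
exact: measurable_funN.
Qed.

Lemma area_preserving_dilate r : area_preserving (dilate_log r).
Proof. exact: (@area_preserving_shear2 (fun=> r)). Qed.

Lemma area_preserving_invert : area_preserving invert_log.
Proof.
have mk : measurable_fun setT (fun w : R => ln (1 + w ^+ 2)).
  apply: (measurableT_comp (@measurable_ln R)); apply: measurable_funD.
    exact: measurable_cst.
  exact: (exprn_measurable (D := setT) 2).
have := area_preserving_comp (area_preserving_comp (area_preserving_shear2 mk)
  area_preserving_opp2) area_preserving_opp1.
suff -> : invert_log = (fun q : R * R => (- q.1, q.2)) \o
  ((fun q : R * R => (q.1, - q.2)) \o (fun q : R * R => (q.1, q.2 + ln (1 + q.1 ^+ 2)))) by [].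
by apply/funext => q; rewrite /invert_log /= opprD.
Qed.

Lemma uval_translate b q : uval (log_point (translate_log b q)) = uval (log_point q) + b%:C%C.
Proof.
apply/eqP; rewrite eq_complex /= mulrDl -mulrA -expRD addNr expR0 mulr1 addr0.
by rewrite !eqxx.
Qed.

Lemma uval_dilate r q : uval (log_point (dilate_log r q)) = (expR r)%:C%C * uval (log_point q).
Proof.
apply/eqP; rewrite eq_complex /= !mul0r subr0 addr0 expRD.
by rewrite [expR q.2 * _]mulrC mulrCA !eqxx.
Qed.

Lemma uval_invert q : uval (log_point (invert_log q)) = - (uval (log_point q))^-1.
Proof.
have w0 : 0 < 1 + q.1 ^+ 2 by rewrite ltr_pwDl// sqr_ge0.
apply/eqP; rewrite eq_complex /=.
rewrite expRD !expRN lnK ?posrE// opprK.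
set y := expR q.2; have y0 : 0 < y by exact: expR_gt0.
have -> : (q.1 * y) ^+ 2 + y ^+ 2 = y ^+ 2 * (1 + q.1 ^+ 2) by ring.
by apply/andP; split; apply/eqP; field; rewrite !gt_eqF.
Qed.

Lemma uval_inj : injective (@uval R).
Proof. exact: val_inj. Qed.

Lemma det_mx2 (g : 'M[R]_2) : \det g = g 0 0 * g 1 1 - g 0 1 * g 1 0.
Proof.
rewrite (expand_det_row _ 0) !big_ord_recl big_ord0 addr0 /cofactor.
rewrite !det_mx11 !mxE /= expr0 expr1 mul1r mulN1r mulrN.
by congr (_ * g _ _ - g _ _ * g _ _); apply/val_inj.
Qed.

(** With c = 0 the determinant gives d = 1 / a, and the action is z |-> a^2 z + a b. *)
Lemma moeb_log_upper (g : 'M[R]_2) q : \det g = 1 -> g 1 0 = 0 ->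
  moeb g (log_point q) =
    log_point (translate_log (g 0 0 * g 0 1) (dilate_log (ln (g 0 0 ^+ 2)) q)).
Proof.
move=> dg c0; have := dg; rewrite det_mx2 c0 mulr0 subr0 => ad.
have a0 : g 0 0 != 0 by apply: contra_eq_neq ad => ->; rewrite mul0r eq_sym oner_eq0.
have d0 : g 1 1 != 0 by apply: contra_eq_neq ad => ->; rewrite mulr0 eq_sym oner_eq0.
apply: uval_inj; rewrite moebE// uval_translate uval_dilate /cfac c0 lnK ?posrE; last first.
  by rewrite lt0r sqr_ge0 sqrf_eq0 a0.
rewrite mul0r add0r rmorphXn /= rmorphM /=.
have -> : (g 1 1)%:C%C = (g 0 0)%:C%C^-1.
  by rewrite -fmorphV; congr (_%:C%C); apply: (mulfI a0); rewrite ad mulfV.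
by rewrite invrK; ring.
Qed.

(** Bruhat decomposition: for c <> 0, g z = a / c - 1 / (c^2 (z + d / c)), a composition of the
    three elementary maps. *)
Lemma moeb_log (g : 'M[R]_2) : \det g = 1 ->
  exists2 phi, area_preserving phi & forall q, moeb g (log_point q) = log_point (phi q).
Proof.
move=> dg; case: (eqVneq (g 1 0) 0) => [c0|c0].
  exists (translate_log (g 0 0 * g 0 1) \o dilate_log (ln (g 0 0 ^+ 2))).
    exact: area_preserving_comp (area_preserving_dilate _) (area_preserving_translate _).
  by move=> q; exact: moeb_log_upper.
exists (fun q => translate_log (g 0 0 / g 1 0) (dilate_log (- ln (g 1 0 ^+ 2))
    (invert_log (translate_log (g 1 1 / g 1 0) q)))).
  apply: (@area_preserving_comp (fun q => dilate_log (- ln (g 1 0 ^+ 2))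
    (invert_log (translate_log (g 1 1 / g 1 0) q)))) (area_preserving_translate _).
  apply: (@area_preserving_comp (fun q => invert_log (translate_log (g 1 1 / g 1 0) q)))
    (area_preserving_dilate _).
  exact: area_preserving_comp (area_preserving_translate _) area_preserving_invert.
move=> q; apply: uval_inj; rewrite moebE// uval_translate uval_dilate uval_invert uval_translate.
rewrite expRN lnK ?posrE ?lt0r ?sqr_ge0 ?sqrf_eq0 ?c0//.
rewrite /cfac; set t := uval (log_point q).
have tI : 0 < complex.Im t by exact: uvalP.
have c0' : (g 1 0)%:C%C != 0 by rewrite fmorph_eq0.
have n0 : (g 1 0)%:C%C * t + (g 1 1)%:C%C != 0.
  apply/eqP => /(congr1 (@complex.Im R)); case: t tI => x y /= y0.
  by rewrite !mul0r !addr0 => /eqP; rewrite mulf_eq0 (negbTE c0) gt_eqF.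
have -> : (g 0 1)%:C%C = ((g 0 0)%:C%C * (g 1 1)%:C%C - 1) / (g 1 0)%:C%C.
  apply: (mulIf c0'); rewrite divfK// -!rmorphM -(rmorph1 (real_complex R)) -rmorphB -dg det_mx2.
  by congr (_%:C%C); ring.
rewrite fmorphV !rmorphXn /= !rmorphM/= !fmorphV.
by field; rewrite [t * _]mulrC; apply/andP; split.
Qed.

End PlaneMaps.

(** * The cocycle c tau + d and the action on the upper half-plane *)

Section Moebius.
Context {R : realType}.
Implicit Types (g h : 'M[R]_2) (t : uhp R) (a b : R).

Lemma mulmx2 g h i j : (g *m h) i j = g i 0 * h 0 j + g i 1 * h 1 j.
Proof.
rewrite mxE !big_ord_recl big_ord0 addr0.
by congr (_ + g _ _ * h _ _); apply/val_inj.
Qed.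

Lemma eq_mx2 g h : g 0 0 = h 0 0 -> g 0 1 = h 0 1 -> g 1 0 = h 1 0 -> g 1 1 = h 1 1 ->
  g = h.
Proof.
move=> e1 e2 e3 e4; apply/matrixP => i j.
have o2 (k : 'I_2) : k = 0 \/ k = 1.
  by case: k => -[|[|//]] ?; [left|right]; apply/val_inj.
by case: (o2 i) => ->; case: (o2 j) => ->.
Qed.

Definition mx2 (a b c d : R) : 'M[R]_2 :=
  \matrix_(i, j) if i == 0 then (if j == 0 then a else b) else (if j == 0 then c else d).

Lemma mx2E a b c d : ((mx2 a b c d 0 0 = a) * (mx2 a b c d 0 1 = b) *
  (mx2 a b c d 1 0 = c) * (mx2 a b c d 1 1 = d))%type.
Proof. by rewrite /mx2 !mxE. Qed.

Lemma invmx2 g : \det g = 1 -> invmx g = mx2 (g 1 1) (- g 0 1) (- g 1 0) (g 0 0).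
Proof.
move=> dg; have /(congr1 (mulmx (invmx g))) :
    g *m mx2 (g 1 1) (- g 0 1) (- g 1 0) (g 0 0) = 1%:M.
  rewrite det_mx2 in dg.
  by apply: eq_mx2; rewrite mulmx2 !mx2E !mxE /= -?dg; ring.
by rewrite mulKmx ?unitmxE ?dg ?unitr1// mulmx1.
Qed.

Lemma cfac_neq0 g t : \det g = 1 -> cfac g t != 0.
Proof.
move=> dg; apply/eqP; rewrite /cfac; case: t => -[x y] /= y0.
move=> /eqP; rewrite eq_complex /= !mul0r !subr0 !addr0 => /andP[/eqP e1].
rewrite mulf_eq0 (gt_eqF y0) orbF => /eqP c0.
move: e1; rewrite c0 mul0r add0r => d0.
by move: dg; rewrite det_mx2 c0 d0 !mulr0 subrr => /eqP; rewrite eq_sym oner_eq0.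
Qed.

Lemma cfacM g h t : \det h = 1 ->
  cfac (g *m h) t = cfac g (moeb h t) * cfac h t.
Proof.
move=> dh; have := cfac_neq0 t dh; rewrite [cfac g _]/cfac moebE// => h0.
rewrite [RHS]mulrDl -[X in _ = X + _]mulrA divfK// /cfac !mulmx2 !rmorphD !rmorphM /=.
by ring.
Qed.

Lemma moebM g h t : \det g = 1 -> \det h = 1 ->
  moeb (g *m h) t = moeb g (moeb h t).
Proof.
move=> dg dh; have dgh : \det (g *m h) = 1 by rewrite det_mulmx dg dh mulr1.
apply: uval_inj; rewrite !moebE// cfacM//.
have h0 := cfac_neq0 t dh; have g0 := cfac_neq0 (moeb h t) dg.
rewrite invfM mulrC -mulrA mulrC; congr (_ / _).
rewrite !mulmx2 !rmorphD !rmorphM /=; move: h0; rewrite /cfac => h0.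
by field.
Qed.

End Moebius.

(** * Discrete groups of upper triangular matrices have infinite covolume *)

Section UpperTriangular.
Context {R : realType}.
Notation mu := (@lebesgue_measure R).
Notation mu2 := (mu \x mu)%E.
Implicit Types (a b c : R) (E : set (R * R)).

Definition upper_mx a b : 'M[R]_2 := mx2 a b 0 a^-1.

Lemma det_upper a b : a != 0 -> \det (upper_mx a b) = 1.
Proof. by move=> a0; rewrite det_mx2 !mx2E mulfV// mulr0 subr0. Qed.

Lemma upper_mxM a b a' b' : a != 0 -> a' != 0 ->
  upper_mx a b *m upper_mx a' b' = upper_mx (a * a') (a * b' + b / a').
Proof.
move=> a0 a0'; apply: eq_mx2; rewrite mulmx2 !mx2E ?mulr0 ?mul0r ?addr0 ?add0r//.
by rewrite invfM.
Qed.

Lemma invmx_upper a b : a != 0 -> invmx (upper_mx a b) = upper_mx a^-1 (- b).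
Proof.
move=> a0; rewrite invmx2 ?det_upper// !mx2E.
by apply: eq_mx2; rewrite !mx2E ?oppr0// invrK.
Qed.

Lemma upper_mx_eq (g : 'M[R]_2) : \det g = 1 -> g 1 0 = 0 ->
  g 0 0 != 0 /\ g = upper_mx (g 0 0) (g 0 1).
Proof.
move=> dg c0; have := dg; rewrite det_mx2 c0 mulr0 subr0 => ad.
have a0 : g 0 0 != 0 by apply: contra_eq_neq ad => ->; rewrite mul0r eq_sym oner_eq0.
split=> //; apply: eq_mx2; rewrite !mx2E//.
by apply: (mulfI a0); rewrite ad mulfV.
Qed.

Lemma plane_measure_rows_infty E c : measurable E -> 0 < c ->
  (forall s : R, s <= 0 -> (c%:E <= mu (ysection E s))%E) -> mu2 E = +oo%E.
Proof.
move=> mE c0 cE; rewrite plane_measure_ysection//; apply/eqP.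
rewrite -leye_eq.
have mf : measurable_fun setT (fun s => mu (ysection E s)).
  exact: measurable_fun_ysection.
apply: (@le_trans _ _ (\int[mu]_(s in `]-oo, 0%R]) mu (ysection E s))%E); last first.
  exact: ge0_subset_integral.
apply: (@le_trans _ _ (\int[mu]_(s in `]-oo, 0%R]) c%:E)%E).
  by rewrite integral_cst//= lebesgue_measure_itv/= ltNyr gt0_muley// lte_fin.
apply: ge0_le_integral => //; first by move=> s _; rewrite lee_fin ltW.
exact: measurable_funTS.
Qed.

Lemma plane_measure_columns_infty E c : measurable E -> 0 < c ->
  (forall w, c%:E <= mu (xsection E w))%E -> mu2 E = +oo%E.
Proof.
move=> mE c0 cE; rewrite /product_measure1; apply/eqP; rewrite -leye_eq.
have mf : measurable_fun setT (fun s => mu (xsection E s)).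
  exact: measurable_fun_xsection.
apply: (@le_trans _ _ (\int[mu]_s c%:E)%E).
  rewrite integral_cst//= (_ : mu [set: R] = +oo%E) ?gt0_muley ?lte_fin//.
  by rewrite -set_itvNyy lebesgue_measure_itv.
apply: ge0_le_integral => //; first by move=> s _; rewrite lee_fin ltW.
by move=> w _; exact: cE.
Qed.

Variable G : set 'M[R]_2.
Hypotheses (SG : SL2_subgroup G) (dG : G `<=` isolated G).

Lemma isolated_one : exists2 e, 0 < e & forall a b, G (upper_mx a b) ->
  `|a - 1| < e -> `|a^-1 - 1| < e -> `|b| < e -> a = 1 /\ b = 0.
Proof.
have [_ G1 _ _] := SG; have [_ [V /nbhs_ballP[e e0 eV] VG]] := dG G1.
exists e => // a b Gab a1 ai1 be.
suff H : upper_mx a b = 1%:M.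
  have := congr1 (fun g : 'M[R]_2 => (g 0 0, g 0 1)) H.
  by rewrite !mx2E !mxE /= => -[-> ->].
have : (V `&` G) (upper_mx a b); last by rewrite VG.
split => //; apply: eV; split=> // i j.
have o2 (k : 'I_2) : k = 0 \/ k = 1.
  by case: k => -[|[|//]] ?; [left|right]; apply/val_inj.
rewrite /ball /= !mxE.
case: (o2 i) => ->; case: (o2 j) => -> /=; rewrite ?sub0r ?normrN ?subrr ?normr0//.
- by rewrite distrC.
- by rewrite distrC.
Qed.

Let GM a b a' b' : a != 0 -> a' != 0 -> G (upper_mx a b) -> G (upper_mx a' b') ->
  G (upper_mx (a * a') (a * b' + b / a')).
Proof. by have [_ _ H _] := SG; move=> *; rewrite -upper_mxM//; exact: H. Qed.

Let GV a b : a != 0 -> G (upper_mx a b) -> G (upper_mx a^-1 (- b)).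
Proof. by have [_ _ _ H] := SG; move=> *; rewrite -invmx_upper//; exact: H. Qed.

(** By [moeb_log_upper], this means that [B], read in logarithmic coordinates, meets every orbit of
    the upper triangular elements of [G]. *)
Let cover B := forall q, exists a b, [/\ a != 0, G (upper_mx a b) &
  B (translate_log (a * b) (dilate_log (ln (a ^+ 2)) q))].

(** The row s is moved by translations a b e^(-s), distinct ones being at least (e / 2) e^(-s)
    apart, hence at least e / 2 for s <= 0; half of this bounds the length of [B] in the row. *)
Lemma unipotent_cover_infty (B : set (R * R)) : measurable B ->
  (forall a b, a != 0 -> G (upper_mx a b) -> a ^+ 2 = 1) ->
  cover B -> mu2 B = +oo%E.
Proof.
move=> mB uni cov; have [e e0 He] := isolated_one.
apply: (@plane_measure_rows_infty _ (e / 4)) => //; first by rewrite divr_gt0.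
move=> s s0.
pose T := [set t | exists a b, [/\ a != 0, G (upper_mx a b) & t = a * b * expR (- s)]].
have es : 1 <= expR (- s) by rewrite -expR0 ler_expR oppr_ge0.
have es0 : 0 < expR (- s) by exact: expR_gt0.
apply: (@le_trans _ _ ((e / 2 * expR (- s) / 2)%:E)).
  rewrite lee_fin (_ : e / 4 = e / 2 * 1 / 2); last by field.
  by rewrite ler_pM2r// ler_pM2l// divr_gt0.
apply: (@separated_translates_measure _ T).
- by rewrite mulr_gt0// divr_gt0.
- move=> _ _ [a [b [a0 Gab ->]]] [a' [b' [a0' Gab' ->]]].
  rewrite -mulrBl normrM [`|expR _|]gtr0_norm// ler_pM2r// leNgt => H; apply/negP => small.
  have u := uni _ _ a0 Gab; have u' := uni _ _ a0' Gab'.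
  have ai : a^-1 = a by apply: (mulfI a0); rewrite mulfV// -expr2.
  have ai' : a'^-1 = a' by apply: (mulfI a0'); rewrite mulfV// -expr2.
  have v0 : a'^-1 != 0 by rewrite invr_eq0.
  have G1 := GM v0 a0 (GV a0' Gab') Gab.
  have r0 : a'^-1 * a != 0 by rewrite mulf_neq0.
  (* The quotient of the two elements may have diagonal entries -1; its square is the translation by
     2 (a b - a' b'), which is shorter than [e] and therefore trivial. *)
  have := GM r0 r0 G1 G1.
  rewrite invfM !ai !ai'.
  have -> : a' * a * (a' * a) = 1.
    by transitivity (a' ^+ 2 * a ^+ 2); [ring|rewrite u u' mulr1].
  have -> : a' * a * (a' * b + - b' * a) + (a' * b + - b' * a) * (a' * a) =
      2 * (a * b - a' * b').
    have -> : 2 * (a * b - a' * b') = 2 * (a' ^+ 2 * (a * b) - a ^+ 2 * (a' * b')).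
      by rewrite u u' !mul1r.
    ring.
  move=> /He; rewrite invr1 subrr normr0 => /(_ e0 e0) [].
    by rewrite normrM ger0_norm// mulrC -ltr_pdivlMr.
  move=> _ /eqP; rewrite mulf_eq0 pnatr_eq0 /= subr_eq0 => /eqP E.
  by move: H; rewrite E eqxx.
- exact: measurable_ysection.
- move=> x; have [a [b [a0 Gab]]] := cov (x, s).
  rewrite (uni _ _ a0 Gab) ln1 /translate_log /dilate_log /= addr0 => Bq.
  exists (a * b * expR (- s)); first by exists a, b.
  by rewrite /ysection /= inE.
Qed.

Section Hyperbolic.
Variables a0 b0 : R.
Hypotheses (a00 : a0 != 0) (Gab0 : G (upper_mx a0 b0)) (a02 : a0 ^+ 2 != 1).

(** Conjugating by the hyperbolic element or by its inverse multiplies translations by a0^2 or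
    a0^-2, whichever is less than 1. *)
Let contraction : exists2 q, 0 < q < 1 &
  forall th, G (upper_mx 1 th) -> G (upper_mx 1 (q * th)).
Proof.
have sq0 : 0 < a0 ^+ 2 by rewrite lt0r sqr_ge0 sqrf_eq0 a00.
have n1 : (1 : R) != 0 by exact: oner_neq0.
have n0 : a0^-1 != 0 by rewrite invr_eq0.
have [lt1|gt1|/eqP] := ltgtP (a0 ^+ 2) 1; last by rewrite (negbTE a02).
  exists (a0 ^+ 2); first by rewrite sq0.
  move=> th Gth; have := GM _ n0 (GM a00 n1 Gab0 Gth) (GV a00 Gab0).
  rewrite mulr1 mulfV// => /(_ a00); congr (G (upper_mx 1 _)).
  by rewrite invrK; field.
exists (a0 ^+ 2)^-1; first by rewrite invr_gt0 sq0 invf_lt1.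
move=> th Gth; have := GM _ a00 (GM n0 n1 (GV a00 Gab0) Gth) Gab0.
rewrite mulr1 mulVf// => /(_ n0); congr (G (upper_mx 1 _)).
by field.
Qed.

(** Otherwise the contracted translations by q^n th would accumulate at the identity of a discrete
    group. *)
Let no_translation th : G (upper_mx 1 th) -> th = 0.
Proof.
move=> Gth; have [q /andP[q0 q1] Hq] := contraction.
have Gn n : G (upper_mx 1 (q ^+ n * th)).
  by elim: n => [|n IH]; rewrite ?expr0 ?mul1r// exprS -mulrA; exact: Hq.
have [e e0 He] := isolated_one.
have : (fun n => q ^+ n * th) @ \oo --> 0.
  rewrite -(mul0r th); apply: cvgMr_tmp.
  by apply: cvg_expr; rewrite gtr0_norm.
move=> /cvgrPdist_lt /(_ e e0) [n _ /(_ n (leqnn n))] /=; rewrite sub0r normrN => H.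
have := He _ _ (Gn n); rewrite invr1 subrr normr0 => /(_ e0 e0 H)[_ /eqP].
by rewrite mulf_eq0 expf_eq0 gt_eqF//= andbF /= => /eqP.
Qed.

(** The finite fixed point of z |-> a0^2 z + a0 b0. *)
Let x0 := a0 * b0 / (1 - a0 ^+ 2).

(** The commutator with the hyperbolic element is a translation, hence trivial, so both fix [x0].
    For a^2 = 1 the formula says b = 0. *)
Let common_fixpoint a b : a != 0 -> G (upper_mx a b) -> a * b = x0 * (1 - a ^+ 2).
Proof.
move=> an0 Gab; have n0 : a0^-1 != 0 by rewrite invr_eq0.
have m0 : a^-1 != 0 by rewrite invr_eq0.
have d0 : 1 - a0 ^+ 2 != 0 by rewrite subr_eq0 eq_sym.
have aa0 : a * a0 != 0 by rewrite mulf_neq0.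
have aa0' : a^-1 * a0^-1 != 0 by rewrite mulf_neq0.
have := GM aa0 aa0' (GM an0 a00 Gab Gab0) (GM m0 n0 (GV an0 Gab) (GV a00 Gab0)).
have -> : a * a0 * (a^-1 * a0^-1) = 1 by field; rewrite an0 a00.
move=> /no_translation H.
have {H} : a * b * (1 - a0 ^+ 2) = a0 * b0 * (1 - a ^+ 2).
  apply/eqP; rewrite -subr_eq0 -[X in _ == X]H; apply/eqP.
  by field; rewrite an0 a00.
by move=> H; apply: (mulIf d0); rewrite H /x0; field.
Qed.

(** The quotient of two elements is determined up to sign by a / a'. Its square has the positive
    diagonal entry rho = (a / a')^2 and the off-diagonal entry x0 (rho^-1 - rho), so it is close to
    the identity when rho is close to 1. *)
Let log_separated : exists2 del, 0 < del & forall a b a' b', a != 0 -> a' != 0 ->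
  G (upper_mx a b) -> G (upper_mx a' b') ->
  ln (a ^+ 2) != ln (a' ^+ 2) -> del <= `|ln (a ^+ 2) - ln (a' ^+ 2)|.
Proof.
have [e e0 He] := isolated_one.
(* Small enough for the diagonal entries to be within [e] of 1, and for x0 (rho^-1 - rho), of
   modulus at most 2 |x0| eta, to be less than [e]. *)
pose eta := e / (2 * (`|x0| + 1)).
have x1 : 0 < `|x0| + 1 by rewrite ltr_wpDl.
have eta0 : 0 < eta by rewrite divr_gt0// mulr_gt0.
have eta_e : eta <= e / 2.
  rewrite /eta ler_pM2l// lef_pV2 ?posrE ?mulr_gt0//.
  by rewrite ler_peMr// lerDr.
have x0eta : `|x0| * (eta + eta) < e.
  have -> : eta + eta = e / (`|x0| + 1) by rewrite /eta; field; rewrite gt_eqF.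
  by rewrite mulrA ltr_pdivrMr// mulrC ltr_pM2l// ltrDl.
have := @continuous_expR R 0; rewrite /continuous_at expR0 => /cvgrPdist_lt /(_ eta eta0).
move=> /nbhs_ballP[del /= del0 Hdel].
have {}Hdel x : `|x| < del -> `|expR x - 1| < eta.
  move=> xd; have /Hdel /= : ball (0 : R) del x by rewrite /ball /= sub0r normrN.
  by rewrite distrC.
exists del => // a b a' b' an0 an0' Gab Gab' ne.
rewrite leNgt; apply/negP => small; move/negP: ne; apply.
have v0 : a'^-1 != 0 by rewrite invr_eq0.
have r0 : a'^-1 * a != 0 by rewrite mulf_neq0.
have G1 := GM v0 an0 (GV an0' Gab') Gab.
have G2 := GM r0 r0 G1 G1.
have rr0 : a'^-1 * a * (a'^-1 * a) != 0 by rewrite mulf_neq0.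
have cf := common_fixpoint rr0 G2.
set rho := a'^-1 * a * (a'^-1 * a) in rr0 cf G2.
set be := (X in upper_mx rho X) in G2 cf.
have rho_gt0 : 0 < rho by rewrite /rho -expr2 lt0r sqr_ge0 sqrf_eq0 r0.
have pos c : c != 0 -> 0 < c ^+ 2 by move=> c0; rewrite lt0r sqr_ge0 sqrf_eq0 c0.
have lnrho : ln rho = ln (a ^+ 2) - ln (a' ^+ 2).
  rewrite -lnV ?posrE ?pos// -lnM ?posrE ?invr_gt0 ?pos//.
  by congr ln; rewrite /rho; field.
have h1 : `|rho - 1| < eta by rewrite -[rho]lnK ?posrE//; apply: Hdel; rewrite lnrho.
have h2 : `|rho^-1 - 1| < eta.
  by rewrite -[rho]lnK ?posrE// -expRN; apply: Hdel; rewrite normrN lnrho.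
have beE : be = x0 * (rho^-1 - rho).
  by apply: (mulfI rr0); rewrite cf; field.
have h3 : `|be| < e.
  apply: le_lt_trans x0eta; rewrite beE normrM ler_wpM2l//.
  rewrite (_ : rho^-1 - rho = (rho^-1 - 1) - (rho - 1)); last by ring.
  by apply: le_trans (ler_normB _ _) _; apply: lerD; exact: ltW.
have eta_le : eta <= e by lra.
have [rho1 _] := He _ _ G2 (lt_le_trans h1 eta_le) (lt_le_trans h2 eta_le) h3.
by rewrite -subr_eq0 -lnrho rho1 ln1.
Qed.

(** Once [x0] is translated to 0, which preserves area, the group moves every column by the
    separated numbers ln (a^2), so [B] has length at least [del / 2] in each column. *)
Lemma hyperbolic_cover_infty (B : set (R * R)) : measurable B ->
  cover B -> mu2 B = +oo%E.
Proof.
move=> mB cov; have [mB' <-] := area_preserving_translate x0 mB.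
have [del del0 sep] := log_separated.
apply: (@plane_measure_columns_infty _ (del / 2)) => //; first by rewrite divr_gt0.
move=> w.
pose T := [set t | exists a b, [/\ a != 0, G (upper_mx a b) & t = ln (a ^+ 2)]].
apply: (@separated_translates_measure _ T) => //.
- move=> _ _ [a [b [an0 Gab ->]]] [a' [b' [an0' Gab' ->]]]; exact: sep Gab Gab'.
- exact: measurable_xsection.
- move=> s; have [a [b [an0 Gab]]] := cov (translate_log x0 (w, s)).
  rewrite (common_fixpoint an0 Gab) => Bq.
  exists (ln (a ^+ 2)); first by exists a, b.
  rewrite /xsection /= inE /=; congr (B _): Bq.
  rewrite /translate_log /dilate_log /=; congr pair.
  rewrite opprD expRD [expR (- ln _)]expRN lnK ?posrE ?lt0r ?sqr_ge0 ?sqrf_eq0 ?an0//.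
  by field.
Qed.

End Hyperbolic.

Lemma upper_cover_infty (B : set (R * R)) : measurable B ->
  cover B -> mu2 B = +oo%E.
Proof.
move=> mB cov.
case: (pselect (forall a b, a != 0 -> G (upper_mx a b) -> a ^+ 2 = 1)) => [uni|].
  exact: unipotent_cover_infty.
move=> /existsNP[a /existsNP[b /not_implyP[a0 /not_implyP[Gab /eqP a2]]]].
exact: (hyperbolic_cover_infty a0 Gab a2).
Qed.

End UpperTriangular.

(** * The values of c / (c tau + d) on a lattice *)

Section LatticeOrbit.
Context {R : realType}.
Notation mu := (@lebesgue_measure R).
Notation mu2 := (mu \x mu)%E.
Implicit Types (g : 'M[R]_2) (A : set (uhp R)) (t : uhp R).

Definition finite_log_area A :=
  measurable (@log_point R @^-1` A) /\ (mu2 (@log_point R @^-1` A) < +oo)%E.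

Lemma measurable_log_chart :
  measurable_fun setT (fun q : R * R => (q.1 * expR q.2, expR q.2)).
Proof.
have me : measurable_fun setT (fun q : R * R => expR q.2).
  apply: (measurableT_comp (f := @expR R)); first exact: measurable_expR.
  exact: measurable_snd.
apply: measurable_fun_pair; last exact: me.
by apply: measurable_funM; [exact: measurable_fst|exact: me].
Qed.

Lemma finite_hyp_area A : measurable (uhp_coords @` A) -> (hyp_area A < +oo)%E ->
  finite_log_area A.
Proof.
move=> mA fA; rewrite /finite_log_area.
have -> : @log_point R @^-1` A =
    (fun q : R * R => (q.1 * expR q.2, expR q.2)) @^-1` (uhp_coords @` A).
  apply/seteqP; split=> q /=; first by move=> Aq; exists (log_point q).
  move=> [t At [ex ey]]; suff <- : t = log_point q by [].
  by apply: uval_inj; apply/eqP; rewrite eq_complex /= ex ey !eqxx.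
split; first by rewrite -[X in measurable X]setTI; exact: measurable_log_chart.
by rewrite area_log// => _ [t _ <-]; exact: uvalP.
Qed.

Lemma finite_log_area_moeb g A : \det g = 1 -> finite_log_area A ->
  finite_log_area (moeb g @^-1` A).
Proof.
move=> dg [mA fA]; have [phi hphi E] := moeb_log dg; have [mphi ephi] := hphi _ mA.
rewrite /finite_log_area.
have -> : @log_point R @^-1` (moeb g @^-1` A) = phi @^-1` (@log_point R @^-1` A).
  by apply/seteqP; split=> q /=; rewrite E.
by split; [exact: mphi|rewrite ephi].
Qed.

Lemma finite_log_areaU A B : finite_log_area A -> finite_log_area B ->
  finite_log_area (A `|` B).
Proof.
move=> [mA fA] [mB fB]; split; first by rewrite preimage_setU; exact: measurableU.
rewrite preimage_setU.
have H := measureU2 (mu \x mu)%E mA mB.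
exact: le_lt_trans H (lte_add_pinfty fA fB).
Qed.

Lemma finite_log_area0 : finite_log_area set0.
Proof. by rewrite /finite_log_area preimage_set0 measure0; split. Qed.

(** Equal values mean proportional bottom rows, hence elements that differ by an upper triangular
    factor on the left. With finitely many values, finitely many translates of a fundamental domain,
    of finite total area, would meet all orbits of the upper triangular elements. *)
Theorem lattice_cfac_infinite (G : set 'M[R]_2) t (s : seq R[i]) : lattice G ->
  exists2 g, G g & (g 1 0)%:C%C / cfac g t \notin s.
Proof.
move=> [SG dG [A [mA fund] fA]]; apply: contrapT => nog.
have Xs g : G g -> (g 1 0)%:C%C / cfac g t \in s.
  by move=> Gg; apply: contrapT => /negP ns; apply: nog; exists g.
have [det1 G1 GM GV] := SG.
have [reps [repsG Hreps]] : exists reps : seq 'M[R]_2, (forall g, g \in reps -> G g) /\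
    forall g, G g -> exists2 h, h \in reps &
      (g 1 0)%:C%C / cfac g t = (h 1 0)%:C%C / cfac h t.
  (* What remains after removing one value is no longer a group, so the induction runs over
     arbitrary sets [G]. *)
  elim: s {nog} G {SG dG fund det1 G1 GM GV} Xs => [|x s IH] G Xs.
    by exists [::]; split=> // g /Xs.
  have [|reps [rG Hr]] := IH [set g | G g /\ (g 1 0)%:C%C / cfac g t != x].
    by move=> g [/Xs]; rewrite inE => /predU1P[->|//]; rewrite eqxx.
  case: (pselect (exists2 h, G h & (h 1 0)%:C%C / cfac h t = x)) => [[h Gh hx]|nh].
      exists (h :: reps); split.
        by move=> g; rewrite inE => /predU1P[->//|/rG[]].
      move=> g Gg; case: (eqVneq ((g 1 0)%:C%C / cfac g t) x) => [gx|gx].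
        by exists h; rewrite ?mem_head// gx hx.
      by have [h' h'r ->] := Hr g (conj Gg gx); exists h' => //; rewrite inE h'r orbT.
    exists reps; split; first by move=> g /rG[].
    move=> g Gg; apply: Hr; split=> //; apply/eqP => gx.
    by apply: nh; exists g.
pose B := [set u | exists2 h, h \in reps & A (moeb (invmx h) u)].
have detV h : G h -> \det (invmx h) = 1 by move=> /GV /det1.
have fB : finite_log_area B.
  rewrite {}/B; elim: reps {Hreps} repsG => [|h reps IH] repsG.
    have -> : [set u | exists2 h, h \in [::] & A (moeb (invmx h) u)] = set0.
      by apply/seteqP; split=> // u [].
    exact: finite_log_area0.
  have -> : [set u | exists2 h', h' \in h :: reps & A (moeb (invmx h') u)] =
      moeb (invmx h) @^-1` A `|` [set u | exists2 h, h \in reps & A (moeb (invmx h) u)].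
    apply/seteqP; split=> u /=.
      move=> [h']; rewrite inE => /predU1P[->|h'r] Au; first by left.
      by right; exists h'.
    move=> [Au|[h' h'r Au]]; first by exists h; rewrite ?mem_head.
    by exists h' => //; rewrite inE h'r orbT.
  apply: finite_log_areaU.
    apply: finite_log_area_moeb; first by apply/detV/repsG/mem_head.
    exact: finite_hyp_area.
  by apply: IH => h' h'r; apply: repsG; rewrite inE h'r orbT.
have [mB ltB] := fB.
suff : mu2 (@log_point R @^-1` B) = +oo%E by move=> E; rewrite E in ltB.
apply: (upper_cover_infty SG dG mB) => q.
have [a [[Aa [g Gg ag]] _]] := fund (log_point q).
have [h hr gh] := Hreps _ (GV _ Gg).
have Gh := repsG _ hr; have dh := det1 _ Gh; have dg := det1 _ Gg.
have dgi := detV _ Gg; have dhi := detV _ Gh.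
(* This is h g, upper triangular because g^-1 and h share their value; as h^-1 k = g moves the point
   into [A], its image under [k] lies in [B]. *)
pose k := invmx (invmx g *m invmx h).
have Gk : G k by apply/GV/GM; exact: GV.
have dk := det1 _ Gk.
have k10 : k 1 0 = 0.
  rewrite /k invmx2 ?det_mulmx ?dgi ?dhi ?mulr1// mx2E.
  apply/eqP; rewrite oppr_eq0; apply/eqP.
  rewrite mulmx2 (invmx2 dh) !mx2E; set gi := invmx g in gh dgi *.
  have n1 := cfac_neq0 t dgi; have n2 := cfac_neq0 t dh.
  have : (gi 1 0)%:C%C * cfac h t = (h 1 0)%:C%C * cfac gi t.
    by move: gh => /eqP; rewrite eqr_div// => /eqP ->.
  rewrite /cfac => H.
  apply: complexI; rewrite rmorphD !rmorphM /= rmorph0 rmorphN.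
  have {H} : (gi 1 0)%:C%C * (h 1 1)%:C%C = (h 1 0)%:C%C * (gi 1 1)%:C%C.
    apply: (addrI ((gi 1 0)%:C%C * ((h 1 0)%:C%C * uval t))).
    by rewrite -mulrDr H; ring.
  by move=> ->; ring.
have [k0 kE] := upper_mx_eq dk k10.
exists (k 0 0), (k 0 1); split=> //; first by rewrite -kE.
rewrite /preimage /= -moeb_log_upper//.
exists h => //; rewrite -moebM//.
suff -> : invmx h *m k = g by rewrite -ag.
rewrite /k.
have ug : g \in unitmx by rewrite unitmxE dg unitr1.
have uh : h \in unitmx by rewrite unitmxE dh unitr1.
have ugh : invmx g *m invmx h \in unitmx by rewrite unitmx_mul !unitmx_inv ug uh.
have : invmx h *m invmx (invmx g *m invmx h) =
    g *m (invmx g *m invmx h) *m invmx (invmx g *m invmx h).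
  by rewrite mulmxA mulmxV// mul1mx.
by move=> ->; rewrite -mulmxA mulmxV// mulmx1.
Qed.

End LatticeOrbit.

(** * Modular linear differential operators *)

Section Derivation.
Context {R : realType}.
Implicit Types (f h : ufun R) (t : uhp R) (z l : R[i]) (g : 'M[R]_2).

Lemma uextE f t : uext f (uval t) = f t.
Proof. by rewrite /uext valK. Qed.

Lemma uext_pos f z (z0 : 0 < complex.Im z) : uext f z = f (Uhp z0).
Proof. by rewrite -[z in LHS]/(uval (Uhp z0)) uextE. Qed.

Lemma uhp_ball t z : normc (z - uval t) < complex.Im (uval t) -> 0 < complex.Im z.
Proof.
move=> H; have := le_lt_trans (normc_geIm _) H.
have -> : complex.Im (z - uval t) = complex.Im z - complex.Im (uval t).
  by case: z {H} (uval t) => ? ? [].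
by rewrite ltr_norml => /andP[+ _]; rewrite ltrBrDr addrC subrr.
Qed.

Lemma two_pi_i_neq0 : two_pi_i != 0 :> R[i].
Proof.
by rewrite /two_pi_i eq_complex /= eqxx /= gt_eqF// mulr_gt0// pi_gt0.
Qed.

(** A relational form of D: it asserts differentiability together with the value, so each rule below
    provides both at once. *)
Definition has_Dq f t l :=
  is_derive (uval t : R[i]^o) 1 (uext f : R[i]^o -> R[i]^o) (two_pi_i * l).

Lemma has_DqE f t l : has_Dq f t l -> Dq f t = l.
Proof.
move=> [_ H]; rewrite /Dq derive1E H mulrA mulVf ?mul1r//; exact: two_pi_i_neq0.
Qed.

Lemma holomorphic_has_Dq f t : holomorphic f -> has_Dq f t (Dq f t).
Proof.
move=> /(_ t) /derivableP df; rewrite /has_Dq /Dq derive1E mulrA mulfV ?mul1r//.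
exact: two_pi_i_neq0.
Qed.

Lemma has_Dq_holomorphic f : (forall t, exists l, has_Dq f t l) -> holomorphic f.
Proof. by move=> H t; have [l []] := H t. Qed.

(** A formula [F] valid on the half-plane agrees with [uext f] on the ball of radius Im t, so
    derivatives can be computed on explicit expressions. *)
Lemma has_Dq_near f t l (F : R[i]^o -> R[i]^o) :
  (forall u, f u = F (uval u)) ->
  is_derive (uval t : R[i]^o) 1 F (two_pi_i * l) -> has_Dq f t l.
Proof.
move=> fF; apply: is_derive_near; exists (complex.Im (uval t)); first exact: uvalP.
by move=> z /uhp_ball z0; rewrite (uext_pos _ z0) fF.
Qed.

Lemma holomorphic_Dq f : holomorphic f -> holomorphic (Dq f).
Proof.
move=> hf; apply: has_Dq_holomorphic => t.
have d : derivable (fun z : R[i]^o => 'D_1 (uext f : R[i]^o -> R[i]^o) z) (uval t : R[i]^o) 1.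
  apply: (@derivable_derive _ _ _ (complex.Im (uval t))); first exact: uvalP.
  by move=> z /uhp_ball z0; exact: (hf (Uhp z0)).
have c0 := @is_derive_cst _ R[i]^o R[i]^o (two_pi_i^-1) (uval t : R[i]^o) 1.
have H := is_derive_mulc c0 (derivableP d).
set m := (X in is_derive _ _ _ X) in H; exists (two_pi_i^-1 * m).
apply: (@has_Dq_near _ _ _ (fun z => two_pi_i^-1 * 'D_1 (uext f : R[i]^o -> R[i]^o) z)).
  by move=> u; rewrite /Dq derive1E.
by rewrite mulVKf ?two_pi_i_neq0.
Qed.

Lemma holomorphic_iter_Dq f n : holomorphic f -> holomorphic (iter n Dq f).
Proof.
by move=> hf; elim: n => [|n IH]; [exact: hf|exact: (holomorphic_Dq IH)].
Qed.

Lemma has_DqM f h t l m : has_Dq f t l -> has_Dq h t m ->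
  has_Dq (f * h) t (f t * m + h t * l).
Proof.
move=> Hf Hh; have := is_derive_mulc Hf Hh; rewrite !uextE => H.
apply: (@has_Dq_near _ _ _ (fun z => uext f z * uext h z)).
  by move=> u; rewrite !uextE.
by rewrite mulrDr ![two_pi_i * (_ * _)]mulrCA.
Qed.

Lemma has_DqD f h t l m : has_Dq f t l -> has_Dq h t m ->
  has_Dq (f + h) t (l + m).
Proof.
move=> Hf Hh.
apply: (@has_Dq_near _ _ _ (fun z => uext f z + uext h z)).
  by move=> u; rewrite !uextE.
by rewrite mulrDr; exact: is_deriveD.
Qed.

Lemma has_Dq_cst z t : has_Dq (fun=> z) t 0.
Proof.
apply: (@has_Dq_near _ _ _ (fun=> z)); first by [].
by rewrite mulr0; exact: is_derive_cst.
Qed.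

Lemma has_Dq_sum n (F : 'I_n -> ufun R) t (l : 'I_n -> R[i]) :
  (forall i, has_Dq (F i) t (l i)) -> has_Dq (\sum_i F i) t (\sum_i l i).
Proof.
elim: n F l => [|n IH] F l H.
  by rewrite !big_ord0; exact: has_Dq_cst.
rewrite !big_ord_recr; apply: has_DqD; last exact: H.
by apply: IH => i; exact: H.
Qed.

Lemma has_DqZ z f t l : has_Dq f t l -> has_Dq (fun u => z * f u) t (z * l).
Proof.
by move=> Hf; have := has_DqM (has_Dq_cst z t) Hf; rewrite mulr0 addr0.
Qed.

Lemma has_DqX f n t l : has_Dq f t l -> has_Dq (f ^+ n) t (n%:R * f t ^+ n.-1 * l).
Proof.
move=> Hf; elim: n => [|n IH]; first by rewrite expr0 !mul0r; exact: has_Dq_cst.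
have fX m : (f ^+ m) t = f t ^+ m by elim: m => // m E; rewrite !exprS -E.
rewrite exprS; have := has_DqM Hf IH; congr has_Dq; rewrite fX.
case: n {IH} => [|n]; first by rewrite !mul0r mulr0 add0r /= expr0 !mul1r.
by rewrite /= -[in RHS]natr1 exprS; ring.
Qed.

Lemma is_derive_affine (p q : R[i]) z :
  is_derive (z : R[i]^o) 1 (fun w : R[i]^o => p * w + q : R[i]^o) p.
Proof.
apply/is_derive_complexP; exists (fun=> p); split; [exact: continuous_complex_cst|by []|].
by move=> w; ring.
Qed.

Definition qm_var g : ufun R := fun t => two_pi_i^-1 * ((g 1 0)%:C / cfac g t)%C.

Lemma has_Dq_cfacV g t : \det g = 1 ->
  has_Dq (fun u => (cfac g u)^-1) t (- (qm_var g t * (cfac g t)^-1)).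
Proof.
move=> dg; have n0 := cfac_neq0 t dg.
have H := is_derive_affine (g 1 0)%:C%C (g 1 1)%:C%C (uval t).
have := @is_derive_comp _ (fun w => w^-1) _ (uval t) _ _ (is_derive_inv n0) H.
rewrite /comp => H'.
apply: (@has_Dq_near _ _ _ (fun z => ((g 1 0)%:C%C * z + (g 1 1)%:C%C)^-1)); first by [].
suff -> : two_pi_i * - (qm_var g t / cfac g t) =
  - ((g 1 0)%:C%C * uval t + (g 1 1)%:C%C) ^- 2 * (g 1 0)%:C%C by [].
by rewrite /qm_var /cfac; field; rewrite two_pi_i_neq0 n0.
Qed.

(** Along with D j^(-k) = - k X j^(-k) for j = c tau + d, this Riccati equation keeps the
    derivatives of a slashed function polynomial in X. *)
Lemma has_Dq_var g t : \det g = 1 -> has_Dq (qm_var g) t (- qm_var g t ^+ 2).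
Proof.
move=> dg; have := has_DqZ (two_pi_i^-1 * (g 1 0)%:C%C) (has_Dq_cfacV t dg).
congr has_Dq; last by rewrite /qm_var; ring.
by apply/funext => u; rewrite /qm_var mulrA.
Qed.

Lemma has_Dq_cfacX g t (k : int) : \det g = 1 ->
  has_Dq (fun u => cfac g u ^ (- k)) t (- (k%:~R * qm_var g t * cfac g t ^ (- k))).
Proof.
move=> dg; have n0 u := cfac_neq0 u dg.
case: k => n.
  have := has_DqX n (has_Dq_cfacV t dg); congr has_Dq.
    apply/funext => u; rewrite -exprnN -exprVn.
    by elim: n => // n IH; rewrite !exprS -IH.
  rewrite -exprnN -exprVn; case: n => [|n]; first by rewrite !mul0r oppr0.
  by rewrite /= exprS; ring.
have -> : - Negz n = n.+1 by rewrite NegzE opprK.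
have Hc : has_Dq (cfac g) t (two_pi_i^-1 * (g 1 0)%:C%C).
  apply: (@has_Dq_near _ _ _ (fun z => (g 1 0)%:C%C * z + (g 1 1)%:C%C)); first by [].
  rewrite mulrA mulfV ?two_pi_i_neq0// mul1r; exact: is_derive_affine.
have := has_DqX n.+1 Hc; congr has_Dq.
  apply/funext => u; rewrite -exprnP.
  by elim: n.+1 => // m IH; rewrite !exprS -IH.
rewrite NegzE mulrNz mulNr mulNr opprK -exprnP /= exprS /qm_var.
rewrite -pmulrn.
by field; rewrite two_pi_i_neq0 n0.
Qed.

Lemma has_Dq_moeb f g t l : \det g = 1 -> has_Dq f (moeb g t) l ->
  has_Dq (fun u => f (moeb g u)) t (cfac g t ^- 2 * l).
Proof.
move=> dg Hf; have n0 := cfac_neq0 t dg.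
pose M (z : R[i]^o) : R[i]^o := ((g 0 0)%:C%C * z + (g 0 1)%:C%C) *
  ((g 1 0)%:C%C * z + (g 1 1)%:C%C)^-1.
have Ha := is_derive_affine (g 0 0)%:C%C (g 0 1)%:C%C (uval t).
have Hc := is_derive_affine (g 1 0)%:C%C (g 1 1)%:C%C (uval t).
have Hi := @is_derive_comp _ (fun w => w^-1) _ (uval t) _ _ (is_derive_inv n0) Hc.
pose m : R[i] := ((g 0 0)%:C%C * uval t + (g 0 1)%:C%C) *
  (- cfac g t ^- 2 * (g 1 0)%:C%C) +
  (cfac g t)^-1 * (g 0 0)%:C%C.
have HM : is_derive (uval t : R[i]^o) 1 M m := is_derive_mulc Ha Hi.
have E : M (uval t) = uval (moeb g t) by rewrite moebE.
have Hf' : is_derive (M (uval t) : R[i]^o) 1 (uext f : R[i]^o -> R[i]^o) (two_pi_i * l).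
  by rewrite E.
have H := is_derive_comp Hf' HM.
have mE : m = cfac g t ^- 2.
  have : (g 0 0)%:C%C * (g 1 1)%:C%C - (g 0 1)%:C%C * (g 1 0)%:C%C = 1 :> R[i].
    by rewrite -!rmorphM -rmorphB -det_mx2 dg.
  rewrite /m /cfac /= => d1; rewrite /cfac in n0.
  by rewrite -[RHS]mulr1 -[X in _ = _ * X]d1; field.
apply: (@has_Dq_near _ _ _ (uext f \o M)).
  by move=> u; rewrite /= /M -moebE// uextE.
by rewrite -mE [m * l]mulrC mulrA.
Qed.

Lemma has_Dq_slash f g t (k : int) : \det g = 1 -> holomorphic f ->
  has_Dq (slash k g f) t
    (slash (k + 2) g (Dq f) t - k%:~R * qm_var g t * slash k g f t).
Proof.
move=> dg hf; have n0 := cfac_neq0 t dg.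
have := has_DqM (has_Dq_cfacX t k dg) (has_Dq_moeb dg (holomorphic_has_Dq (moeb g t) hf)).
congr has_Dq; rewrite /slash opprD expfzDr//.
have -> : cfac g t ^ (- (2 : int)) = cfac g t ^- 2 by rewrite -exprnN.
by ring.
Qed.

End Derivation.

(** * Iterated derivatives of a slashed function *)

Section IteratedDerivative.
Context {R : realType}.
Implicit Types (f h : ufun R) (t : uhp R) (z l : R[i]) (g : 'M[R]_2) (k : nat).

Lemma ufun_sumE (I : finType) (F : I -> ufun R) t : (\sum_i F i) t = \sum_i F i t.
Proof. by elim/big_ind2: _ => // x u y v <- <-. Qed.

Lemma rising0 k : rising k 0 = 1%N.
Proof. by rewrite /rising big_ord0. Qed.

Lemma risingS k r : rising k r.+1 = (rising k r * (k + r))%N.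
Proof. by rewrite /rising big_ord_recr. Qed.

Lemma risingSl k r : rising k r.+1 = (k * rising k.+1 r)%N.
Proof.
rewrite /rising big_ord_recl addn0; congr (_ * _)%N.
by apply: eq_bigr => i _; rewrite /= /bump /= addnA addn1.
Qed.

Lemma rising_gt0 k r : (0 < k)%N -> (0 < rising k r)%N.
Proof. by move=> k0; apply: prodn_gt0 => i; rewrite addn_gt0 k0. Qed.

Lemma risingD k m n : rising k (m + n) = (rising k m * rising (k + m) n)%N.
Proof.
elim: n => [|n IH]; first by rewrite addn0 rising0 muln1.
by rewrite addnS !risingS IH -mulnA addnA.
Qed.

Definition slash_coef k r j := ('C(r, j) * rising (k + j) (r - j))%N.

(** The effect of one more derivative: the power (-X)^(r - j) contributes r - j and the slash of
    weight k + 2 j contributes k + 2 j, in total k + r + j, while differentiating D^j f shifts the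
    index. *)
Lemma slash_coefS k r j : (j < r.+1)%N ->
  slash_coef k r.+1 j.+1 =
    (slash_coef k r j.+1 * (k + r + j.+1) + slash_coef k r j)%N.
Proof.
rewrite ltnS leq_eqVlt => /predU1P[->|jr].
  by rewrite /slash_coef !subSS !subnn !rising0 !binn bin_small// mul0n.
have [m ->] : exists m, r = (j + m.+1)%N by exists (r - j.+1)%N; lia.
rewrite /slash_coef; have := mul_bin_left (j + m.+1) j.
have -> : (j + m.+1 - j = m.+1)%N by lia.
have -> : ((j + m.+1).+1 - j.+1 = m.+1)%N by lia.
have -> : (j + m.+1 - j.+1 = m)%N by lia.
rewrite binS [rising (k + j.+1) m.+1]risingS [rising (k + j) m.+1]risingSl !addnS.
set A := 'C(_, j.+1); set B := 'C(_, j); set r1 := rising _ m => E.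
transitivity (r1 * (A * (k + j + m).+1 + B * m.+1 + B * (k + j)))%N; first by nia.
by rewrite [(B * m.+1)%N]mulnC -E; nia.
Qed.

Lemma iter_Dq_slash f g k r : \det g = 1 -> holomorphic f ->
  iter r Dq (slash k%:Z g f) =
    \sum_(j < r.+1) (fun t => (slash_coef k r j)%:R * (- qm_var g t) ^+ (r - j) *
                            slash (k + j.*2)%:Z g (iter j Dq f) t).
Proof.
move=> dg hf; elim: r => [|r IH].
  rewrite big_ord_recl big_ord0 addr0; apply/funext => t /=.
  by rewrite /slash_coef bin0 rising0 muln1 expr0 mul1r double0 addn0 mul1r.
rewrite iterS {}IH; apply/funext => t.
pose Y := - qm_var g t.
pose s j := slash (k + j.*2)%:Z g (iter j Dq f) t.
have dY : has_Dq (fun u => - qm_var g u) t (Y ^+ 2).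
  have := has_DqZ (-1) (has_Dq_var t dg); congr has_Dq.
    by apply/funext => u; rewrite mulN1r.
  by rewrite mulN1r opprK /Y sqrrN.
have dY' m : has_Dq (fun u => (- qm_var g u) ^+ m) t (m%:R * Y ^+ m.+1).
  have := has_DqX m dY; congr has_Dq.
    by apply/funext => u; elim: m => // m E; rewrite !exprS -E.
  case: m => [|m]; first by rewrite !mul0r.
  by rewrite /= -mulrA -exprD addnC.
have ds j : has_Dq (slash (k + j.*2)%:Z g (iter j Dq f)) t
    (s j.+1 + (k + j.*2)%:R * Y * s j).
  have := has_Dq_slash t (k + j.*2)%:Z dg (@holomorphic_iter_Dq _ f j hf); congr has_Dq.
  have E : (k + j.+1.*2)%:Z = (k + j.*2)%:Z + 2 by lia.
  by rewrite /s E -pmulrn /Y; ring.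
have dterm (j : 'I_r.+1) :
  has_Dq (fun t => (slash_coef k r j)%:R * (- qm_var g t) ^+ (r - j) *
     slash (k + j.*2)%:Z g (iter j Dq f) t) t
   ((slash_coef k r j * (k + r + j))%:R * Y ^+ (r.+1 - j) * s j +
    (slash_coef k r j)%:R * Y ^+ (r - j) * s j.+1).
  have := has_DqZ (slash_coef k r j)%:R (has_DqM (dY' (r - j)%N) (ds j)); congr has_Dq.
    by apply/funext => u; rewrite mulrA.
  have jr : (j <= r)%N by rewrite -ltnS.
  rewrite -/(s j) -/Y subSn// exprS natrM.
  have -> : (k + r + j)%:R = (r - j)%:R + (k + j.*2)%:R :> R[i].
    by rewrite -natrD; congr _%:R; lia.
  by ring.
rewrite (has_DqE (has_Dq_sum dterm)) ufun_sumE -/Y.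
(* The extreme terms, of indices 0 and r + 1, are split off; the others match by [slash_coefS]. *)
rewrite big_split /= [RHS]big_ord_recl [X in X + _]big_ord_recl.
rewrite [X in _ + X = _]big_ord_recr /= [X in _ = _ + X]big_ord_recr /=.
rewrite /bump /= !addrA; congr (_ + _); last first.
  by rewrite /slash_coef !binn !subnn !rising0.
rewrite -addrA; congr (_ + _).
  by rewrite /slash_coef !bin0 !mul1n !addn0 !subn0 risingS /s double0 addn0.
rewrite -big_split /=; apply: eq_bigr => i _.
rewrite !add1n slash_coefS ?ltnS ?(ltnW (ltn_ord i))// subSS natrD.
by rewrite /s add0n; ring.
Qed.

End IteratedDerivative.

(** * Stability of holomorphy and moderate growth; rules for the slash action *)

Section Closure.
Context {R : realType}.
Implicit Types (f h : ufun R) (t : uhp R) (z l : R[i]) (g : 'M[R]_2).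

Definition good_fun f := holomorphic f /\ moderate f.

Lemma holomorphicM f h : holomorphic f -> holomorphic h -> holomorphic (f * h).
Proof.
move=> hf hh; apply: has_Dq_holomorphic => t; eexists.
exact: has_DqM (holomorphic_has_Dq t hf) (holomorphic_has_Dq t hh).
Qed.

Lemma holomorphicD f h : holomorphic f -> holomorphic h -> holomorphic (f + h).
Proof.
move=> hf hh; apply: has_Dq_holomorphic => t; eexists.
exact: has_DqD (holomorphic_has_Dq t hf) (holomorphic_has_Dq t hh).
Qed.

Lemma holomorphic_cst z : holomorphic (fun=> z : R[i]).
Proof. by apply: has_Dq_holomorphic => t; exists 0; exact: has_Dq_cst. Qed.

Let height t : R := (1 + normc (uval t) ^+ 2) / complex.Im (uval t).

(** Growth bounds with different exponents can therefore be brought to a common exponent. *)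
Let height_ge1 t : 1 <= height t.
Proof.
have y0 := uvalP t; rewrite /height ler_pdivlMr// mul1r.
have := normc_geIm (uval t); rewrite gtr0_norm// => ny.
have n0 : 0 <= normc (uval t) by exact: normc_ge0.
have [y1|y1] := leP (complex.Im (uval t)) 1.
  by apply: le_trans y1 _; rewrite lerDl sqr_ge0.
have n1 : 1 <= normc (uval t) by lra.
by rewrite expr2; nra.
Qed.

Let moderateP f : moderate f ->
  exists C N, 0 <= C /\ forall t, normc (f t) <= C * height t ^+ N.
Proof.
move=> [C [N H]]; exists `|C|, N; split=> // t; apply: le_trans (H t) _.
by rewrite ler_wpM2r ?ler_norm// exprn_ge0// (le_trans ler01)// height_ge1.
Qed.

Lemma moderateM f h : moderate f -> moderate h -> moderate (f * h).
Proof.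
move=> /moderateP[C [N [C0 fC]]] /moderateP[C' [N' [C0' hC]]].
exists (C * C'), (N + N')%N => t.
rewrite -[(f * h) t]/(f t * h t) ComplexField.Normc.normcM exprD mulrACA.
by apply: ler_pM; rewrite ?normc_ge0.
Qed.

Lemma moderateD f h : moderate f -> moderate h -> moderate (f + h).
Proof.
move=> /moderateP[C [N [C0 fC]]] /moderateP[C' [N' [C0' hC]]].
exists (C + C'), (N + N')%N => t.
rewrite -[(f + h) t]/(f t + h t); apply: le_trans (normcD _ _) _.
rewrite mulrDl; apply: lerD.
  apply: le_trans (fC t) _; rewrite ler_wpM2l// exprD ler_peMr//.
    by rewrite exprn_ge0// (le_trans ler01)// height_ge1.
  by rewrite exprn_ege1// height_ge1.
apply: le_trans (hC t) _; rewrite ler_wpM2l// exprD ler_peMl//.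
  by rewrite exprn_ge0// (le_trans ler01)// height_ge1.
by rewrite exprn_ege1// height_ge1.
Qed.

Lemma moderate_cst z : moderate (fun=> z : R[i]).
Proof. by exists (normc z), 0%N => t; rewrite expr0 mulr1. Qed.

Lemma good_funM f h : good_fun f -> good_fun h -> good_fun (f * h).
Proof.
by move=> [? ?] [? ?]; split; [exact: holomorphicM|exact: moderateM].
Qed.

Lemma good_funD f h : good_fun f -> good_fun h -> good_fun (f + h).
Proof.
by move=> [? ?] [? ?]; split; [exact: holomorphicD|exact: moderateD].
Qed.

Lemma good_fun_cst z : good_fun (fun=> z).
Proof. by split; [exact: holomorphic_cst|exact: moderate_cst]. Qed.

Lemma good_fun0 : good_fun 0.
Proof. exact: (good_fun_cst 0). Qed.

Lemma good_funZ z f : good_fun f -> good_fun (fun t => z * f t).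
Proof. exact: good_funM (good_fun_cst z). Qed.

Lemma good_funN f : good_fun f -> good_fun (- f).
Proof.
move=> /(good_funZ (-1)); congr good_fun; apply/funext => t.
by rewrite mulN1r.
Qed.

Lemma good_funMn f n : good_fun f -> good_fun (f *+ n).
Proof.
move=> gf; elim: n => [|n IH]; first by rewrite mulr0n; exact: good_fun0.
by rewrite mulrS; exact: good_funD.
Qed.

Definition good_poly (P : {poly ufun R}) := forall r, good_fun P`_r.

Lemma good_polyB (P Q : {poly ufun R}) : good_poly P -> good_poly Q -> good_poly (P - Q).
Proof. by move=> gP gQ r; rewrite coefB; apply: good_funD; [|apply: good_funN]. Qed.

Lemma good_polyD (P Q : {poly ufun R}) : good_poly P -> good_poly Q -> good_poly (P + Q).
Proof. by move=> gP gQ r; rewrite coefD; apply: good_funD. Qed.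

Lemma good_polyZ f (P : {poly ufun R}) : good_fun f -> good_poly P -> good_poly (f *: P).
Proof. by move=> gf gP r; rewrite coefZ; apply: good_funM. Qed.

Lemma good_poly0 : good_poly 0.
Proof. by move=> r; rewrite coef0; exact: good_fun0. Qed.

Lemma good_poly_deriv (P : {poly ufun R}) : good_poly P -> good_poly P^`().
Proof. by move=> gP r; rewrite coef_deriv; apply: good_funMn. Qed.

Lemma slashM (k l : int) g f h : \det g = 1 ->
  slash (k + l) g (f * h) = slash k g f * slash l g h.
Proof.
move=> dg; apply/funext => t; rewrite /slash -[RHS]/(_ * _ * (_ * _)).
by rewrite opprD expfzDr ?cfac_neq0// mulrACA.
Qed.

Lemma slashD (k : int) g f h : slash k g (f + h) = slash k g f + slash k g h.
Proof. by apply/funext => t; rewrite /slash -[RHS]/(_ * _ + _ * _) -mulrDr. Qed.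

Lemma slash1 (k : int) f : slash k 1%:M f = f.
Proof.
apply/funext => t; rewrite /slash.
have E : cfac 1%:M t = 1 by rewrite /cfac !mxE /= mul0r add0r.
rewrite E exp1rz mul1r; congr f; apply: uval_inj.
by rewrite moebE ?det1// E !mxE /= mul1r addr0 divr1.
Qed.

Lemma slash_slash (k : int) g (h : 'M[R]_2) f : \det g = 1 -> \det h = 1 ->
  slash k (g *m h) f = slash k h (slash k g f).
Proof.
move=> dg dh; apply/funext => t; rewrite /slash moebM// cfacM// expfzMl.
by rewrite [X in X * _]mulrC -mulrA.
Qed.

End Closure.

(** * Uniqueness and transformation of quasimodular expansions *)

Section Expansions.
Context {R : realType}.
Variables (G : set 'M[R]_2) (latG : lattice G).
Implicit Types (F f : ufun R) (t : uhp R) (g h : 'M[R]_2) (K : int)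
  (P Q : {poly ufun R}) (k : nat).

Lemma lattice_det g : G g -> \det g = 1.
Proof. by have [[H _ _ _] _ _] := latG; exact: H. Qed.

Lemma latticeM g h : G g -> G h -> G (g *m h).
Proof. by have [[_ _ H _] _ _] := latG; exact: H. Qed.

Lemma ufun_mulrn f n t : (f *+ n) t = f t *+ n.
Proof. by elim: n => // n IH; rewrite !mulrS -IH. Qed.

(** Over the ring of functions a nonzero polynomial may have infinitely many roots; freezing [t]
    gives a polynomial over a field, possibly of smaller size. *)
Definition eval_at t P : {poly R[i]} := \poly_(i < size P) P`_i t.

Lemma coef_eval_at t P i : (eval_at t P)`_i = P`_i t.
Proof.
rewrite coef_poly; case: ltnP => // Pi.
by rewrite (nth_default 0 Pi).
Qed.

Lemma size_eval_at t P : (size (eval_at t P) <= size P)%N.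
Proof. exact: size_poly. Qed.

Lemma horner_eval_at t P x : (eval_at t P).[x] = \sum_(r < size P) P`_r t * x ^+ r.
Proof. by rewrite horner_poly. Qed.

Lemma eval_at_deriv t P : eval_at t P^`() = (eval_at t P)^`().
Proof.
apply/polyP => i; rewrite coef_eval_at !coef_deriv coef_eval_at.
exact: ufun_mulrn.
Qed.

Lemma eval_atD t P Q : eval_at t (P + Q) = eval_at t P + eval_at t Q.
Proof. by apply/polyP => i; rewrite !(coef_eval_at, coefD). Qed.

Lemma eval_atZ t f P : eval_at t (f *: P) = f t *: eval_at t P.
Proof. by apply/polyP => i; rewrite !(coef_eval_at, coefZ). Qed.

Lemma eval_at_inj P Q : (forall t, eval_at t P = eval_at t Q) -> P = Q.
Proof.
move=> E; apply/polyP => i; apply/funext => t.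
by rewrite -!coef_eval_at E.
Qed.

Lemma qm_var_infinite t (s : seq R[i]) : exists2 g, G g & qm_var g t \notin s.
Proof.
have [g Gg ns] := lattice_cfac_infinite t (map ( *%R two_pi_i) s) latG.
exists g => //; apply: contra ns => xs; apply/mapP.
by exists (qm_var g t) => //; rewrite /qm_var mulrA mulfV ?mul1r ?two_pi_i_neq0.
Qed.

Lemma poly_qm_var_eq0 t (p : {poly R[i]}) : (forall g, G g -> p.[qm_var g t] = 0) -> p = 0.
Proof.
move=> H; apply: contrapT => /eqP p0.
have [r E] := closed_field_poly_normal p.
have [g Gg] := qm_var_infinite t r; apply/negP; rewrite negbK.
have := H g Gg; rewrite E hornerZ => /eqP; rewrite mulf_eq0 lead_coef_eq0 (negbTE p0) /=.
by rewrite -/(root _ _) root_prod_XsubC.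
Qed.

Lemma qm_expansionP K F P : qm_expansion G K F P <->
  [/\ good_fun F, good_poly P & forall g, G g -> forall t,
      slash K g F t = (eval_at t P).[qm_var g t]].
Proof.
by split=> -[? ? H]; split=> // g Gg t; rewrite (H g Gg t) horner_eval_at.
Qed.

Lemma qm_expansion_unique K F P Q :
  qm_expansion G K F P -> qm_expansion G K F Q -> P = Q.
Proof.
move=> /qm_expansionP[_ _ HP] /qm_expansionP[_ _ HQ].
apply: eval_at_inj => t; apply/eqP; rewrite -subr_eq0; apply/eqP.
apply: (@poly_qm_var_eq0 t) => g Gg.
by rewrite hornerD hornerN -HP// -HQ// subrr.
Qed.

(** [qm_poly] is defined by choice; this makes [depth] and [delta] computable from any expansion at
    hand. *)
Lemma qm_polyE K F P : qm_expansion G K F P -> qm_poly G K F = P.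
Proof.
move=> HP; apply: (@qm_expansion_unique K F) => //.
by rewrite /qm_poly; case: xgetP => [Q -> //|/(_ P)].
Qed.

Lemma quasimodularP K F : quasimodular G K F -> qm_expansion G K F (qm_poly G K F).
Proof. by move=> [P HP]; rewrite (qm_polyE HP). Qed.

Lemma qm_expansion_coef0 K F P : qm_expansion G K F P -> P`_0 = F.
Proof.
move=> /qm_expansionP[_ _ H]; have [[_ G1 _ _] _ _] := latG.
apply/funext => t; have := H _ G1 t; rewrite slash1 => ->.
by rewrite /qm_var !mxE /= mul0r mulr0 horner_coef0 coef_eval_at.
Qed.

(** It amounts to c_(gh) j_h = c_g + c_h j_(gh), a consequence of det h = 1. *)
Lemma qm_varM g h t : \det g = 1 -> \det h = 1 ->
  qm_var (g *m h) t = qm_var g (moeb h t) / cfac h t ^+ 2 + qm_var h t.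
Proof.
move=> dg dh; rewrite /qm_var cfacM//.
have n1 := cfac_neq0 t dh; have n2 := cfac_neq0 (moeb h t) dg.
have E : ((g *m h) 1 0)%:C%C * cfac h t =
    (g 1 0)%:C%C + (h 1 0)%:C%C * (cfac g (moeb h t) * cfac h t).
  rewrite -cfacM// /cfac !mulmx2 !rmorphD !rmorphM /=.
  have d1 : (h 0 0)%:C%C * (h 1 1)%:C%C - (h 0 1)%:C%C * (h 1 0)%:C%C = 1 :> R[i].
    by rewrite -!rmorphM -rmorphB -det_mx2 dh.
  by rewrite -[X in _ = X + _]mulr1 -d1; ring.
apply: (mulfI two_pi_i_neq0); apply: (mulIf n2); apply: (mulIf n1); apply: (mulIf n1).
transitivity (((g *m h) 1 0)%:C%C * cfac h t).
  by field; rewrite n1 n2 two_pi_i_neq0.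
by rewrite E; field; rewrite n1 n2 two_pi_i_neq0.
Qed.

(* Comparing the expansions along [g *m h], for all [g], as polynomials in
   [qm_var g (moeb h t)], which takes infinitely many values. *)
Lemma qm_coef_slash K F P h t r : qm_expansion G K F P -> G h ->
  slash (K - r.*2%:Z) h P`_r t = ((eval_at t P)^`N(r)).[qm_var h t].
Proof.
move=> /qm_expansionP[_ _ H] Gh; have dh := lattice_det Gh.
have j0 := cfac_neq0 t dh; set j := cfac h t in j0 *.
pose A := j ^ (- K) *: eval_at (moeb h t) P.
(* A Taylor expansion at X_h with divided derivatives: as X_(gh) = X_h + j^-2 X_g(h t), both [A] and
   [B] take the value of F |_K (g h) at X_g(h t). *)
pose B := \poly_(i < size (eval_at t P)) (((eval_at t P)^`N(i)).[qm_var h t] * (j ^- 2) ^+ i).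
have AB : A = B.
  apply/eqP; rewrite -subr_eq0; apply/eqP; apply: (@poly_qm_var_eq0 (moeb h t)) => g Gg.
  have dg := lattice_det Gg.
  rewrite hornerD hornerN hornerZ -H//.
  have -> : j ^ (- K) * slash K g F (moeb h t) = slash K (g *m h) F t.
    by rewrite slash_slash.
  rewrite H; last exact: latticeM.
  rewrite qm_varM// -/j [_ / _ + _]addrC nderiv_taylor; last exact: mulrC.
  rewrite /B horner_poly; apply/eqP; rewrite subr_eq0; apply/eqP.
  by apply: eq_bigr => i _; rewrite exprMn -mulrA [_ ^+ i * _ ^+ i]mulrC.
have := congr1 (fun p : {poly R[i]} => p`_r) AB.
rewrite /A /B coefZ coef_eval_at coef_poly.
have -> : slash (K - r.*2%:Z) h P`_r t = j ^ (- K) * P`_r (moeb h t) * j ^+ r.*2.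
  rewrite /slash -/j opprB addrC expfzDr// -exprnP.
  by rewrite mulrAC.
move=> ->; case: ltnP => hr.
  rewrite -mulrA -mul2n exprM -exprMn.
  by rewrite mulVf ?expf_neq0// expr1n mulr1.
rewrite mul0r; have -> : (eval_at t P)^`N(r) = 0.
  apply/polyP => i; rewrite coef_nderivn coef0 nth_default ?mul0rn//.
  exact: leq_trans hr (leq_addr _ _).
by rewrite horner0.
Qed.

(** The case r = 1 of [qm_coef_slash]: on expansions, [delta] is the formal derivative, which is the
    origin of delta^r F = r! F_r. *)
Lemma qm_expansion_deriv K F P : qm_expansion G K F P ->
  qm_expansion G (K - 2) P`_1 P^`().
Proof.
move=> HP; have [gF gP _] := (qm_expansionP _ _ _).1 HP.
apply/qm_expansionP; split; [exact: gP|exact: good_poly_deriv|] => g Gg t.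
have := qm_coef_slash t 1 HP Gg; rewrite nderivn1 => ->.
by rewrite eval_at_deriv.
Qed.

Lemma delta_iterE K F P r : qm_expansion G K F P ->
  delta_iter G K r F = P`_r *+ r`!.
Proof.
elim: r K F P => [|r IH] K F P HP; first by rewrite /= mulr1n (qm_expansion_coef0 HP).
rewrite /= /delta (qm_polyE HP) (IH _ _ _ (qm_expansion_deriv HP)).
by rewrite coef_deriv -mulrnA factS.
Qed.

Lemma size_poly_coef_eq0 (P Q : {poly ufun R}) :
  (forall r, P`_r = 0 <-> Q`_r = 0) -> size P = size Q.
Proof.
have H (A B : {poly ufun R}) : (forall r, A`_r = 0 -> B`_r = 0) -> (size B <= size A)%N.
  by move=> AB; apply/leq_sizeP => j /leq_sizeP Aj; apply: AB; exact: Aj.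
by move=> PQ; apply/eqP; rewrite eqn_leq !H// => r /PQ.
Qed.

(** The factor of F_r D^r in L_{F,k}, once delta^r F = r! F_r has cancelled the factorial. *)
Definition qm_const k r : R[i] := (-1) ^+ r / (rising k r)%:R.

Lemma qm_const_neq0 k r : (0 < k)%N -> qm_const k r != 0.
Proof.
move=> k0; rewrite mulf_neq0 ?expf_neq0 ?oppr_eq0 ?oner_eq0// invr_eq0 pnatr_eq0.
by rewrite -lt0n rising_gt0.
Qed.

Lemma coef_qm_diffop k K F P r : (0 < k)%N -> qm_expansion G K F P ->
  (qm_diffop G k K F)`_r = (fun t => qm_const k r * P`_r t).
Proof.
move=> k0 HP; rewrite /qm_diffop coef_poly /depth (qm_polyE HP).
(* For F = 0 the bound is 1 although [P] has size 0; beyond the bound, size P <= (size P).-1 + 1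
   suffices. *)
case: ifPn => [_|]; last first.
  rewrite -leqNgt => hr; apply/funext => t; rewrite nth_default ?mulr0//.
  exact: leq_trans (leqSpred _) hr.
apply/funext => t; rewrite (delta_iterE r HP) ufun_mulrn /qm_const natrM.
rewrite -mulr_natr; have f0 : (r`!)%:R != 0 :> R[i] by rewrite pnatr_eq0 -lt0n fact_gt0.
have r0 : (rising k r)%:R != 0 :> R[i] by rewrite pnatr_eq0 -lt0n rising_gt0.
by field; rewrite f0 r0.
Qed.

(** Since the factors [qm_const k r] do not vanish, the same coefficients are zero on both sides. *)
Lemma size_qm_diffop k K F P : (0 < k)%N -> qm_expansion G K F P ->
  size (qm_diffop G k K F) = size P.
Proof.
move=> k0 HP; apply: size_poly_coef_eq0 => r; rewrite (coef_qm_diffop r k0 HP).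
split=> [/(congr1 (fun f : ufun R => f)) E|->]; last by apply/funext => t; rewrite mulr0.
apply/funext => t; have := congr1 (fun f : ufun R => f t) E.
by move=> /eqP; rewrite mulf_eq0 (negbTE (qm_const_neq0 r k0)) => /eqP.
Qed.

End Expansions.

(** * From quasimodular forms to equivariant operators and back *)

Section Correspondence.
Context {R : realType}.
Variables (G : set 'M[R]_2) (latG : lattice G).
Implicit Types (F f : ufun R) (t : uhp R) (g h : 'M[R]_2) (K : int)
  (P Q L : {poly ufun R}) (k : nat).

Lemma diffop_applyE N L f : (size L <= N)%N ->
  diffop_apply L f = \sum_(r < N) L`_r * iter r Dq f.
Proof.
move=> LN; rewrite /diffop_apply (big_ord_widen N (fun r => L`_r * iter r Dq f) LN).
rewrite big_mkcond; apply: eq_bigr => i _; case: ltnP => // iL.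
by rewrite nth_default// mul0r.
Qed.

Lemma diffop_applyB L Q f : diffop_apply (L - Q) f = diffop_apply L f - diffop_apply Q f.
Proof.
pose N := maxn (size L) (size Q).
rewrite !(@diffop_applyE N) ?leq_maxl ?leq_maxr//; last first.
  by apply: leq_trans (size_polyD _ _) _; rewrite size_polyN.
by rewrite -sumrB; apply: eq_bigr => i _; rewrite coefB mulrBl.
Qed.

Lemma diffop_applyZ F L f : diffop_apply (F *: L) f = F * diffop_apply L f.
Proof.
rewrite (@diffop_applyE (size L) (F *: L)) ?size_scale_leq//.
by rewrite /diffop_apply mulr_sumr; apply: eq_bigr => i _; rewrite coefZ mulrA.
Qed.

Lemma iter_Dq_cst j (z : R[i]) : iter j.+1 Dq (fun=> z) = (fun=> 0 : R[i]).
Proof.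
have D0 (x : R[i]) : Dq (fun=> x) = (fun=> 0).
  by apply/funext => t; exact: has_DqE (has_Dq_cst x t).
by elim: j => [|j IH]; [exact: D0|rewrite iterS IH D0].
Qed.

(** The added terms vanish with C(r, j) for j > r; a range independent of r allows the double sum
    over r and j to be exchanged. *)
Lemma iter_Dq_slash_wide f g k r N : \det g = 1 -> holomorphic f -> (r < N)%N ->
  iter r Dq (slash k%:Z g f) =
    \sum_(j < N) (fun t => (slash_coef k r j)%:R * (- qm_var g t) ^+ (r - j) *
                            slash (k + j.*2)%:Z g (iter j Dq f) t).
Proof.
move=> dg hf rN; rewrite iter_Dq_slash//.
pose T j := (fun t => (slash_coef k r j)%:R * (- qm_var g t) ^+ (r - j) *
  slash (k + j.*2)%:Z g (iter j Dq f) t) : ufun R.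
rewrite (big_ord_widen N T rN) big_mkcond; apply: eq_bigr => j _.
case: ifP => // /negbT; rewrite -leqNgt => rj; apply/funext => t.
by rewrite /slash_coef bin_small// mul0n !mul0r.
Qed.

Lemma horner_nderivn (p : {poly R[i]}) N j x : (size p <= N)%N ->
  (p^`N(j)).[x] = \sum_(r < N) p`_r * 'C(r, j)%:R * x ^+ (r - j).
Proof.
move=> pN; have {1}-> : p = \sum_(r < N) p`_r *: 'X^r.
  rewrite -poly_def; apply/polyP => i; rewrite coef_poly; case: ltnP => // Ni.
  by rewrite nth_default// (leq_trans pN).
rewrite linear_sum /= horner_sum; apply: eq_bigr => r _.
by rewrite linearZ /= nderivnXn hornerZ hornerMn hornerXn -mulr_natl mulrA.
Qed.

(** The signs (-1)^(r - j) and the factors (k + j)_(r - j) cancel, so that [r] occurs only as in a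
    Taylor coefficient. *)
Lemma qm_const_slash_coef k r j (x : R[i]) : (0 < k)%N -> (j <= r)%N ->
  qm_const k r * (slash_coef k r j)%:R * (- x) ^+ (r - j) =
  qm_const k j * 'C(r, j)%:R * x ^+ (r - j).
Proof.
move=> k0 jr; rewrite /qm_const /slash_coef.
have -> : rising k r = (rising k j * rising (k + j) (r - j))%N by rewrite -risingD subnKC.
rewrite !natrM [(- x) ^+ _]exprNn.
have -> : (-1) ^+ r = (-1) ^+ j * (-1) ^+ (r - j) :> R[i] by rewrite -exprD subnKC.
have r1 : (rising k j)%:R != 0 :> R[i] by rewrite pnatr_eq0 -lt0n rising_gt0.
have r2 : (rising (k + j) (r - j))%:R != 0 :> R[i].
  by rewrite pnatr_eq0 -lt0n rising_gt0// addn_gt0 k0.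
have s2 : (-1) ^+ (r - j) * (-1) ^+ (r - j) = 1 :> R[i].
  by rewrite -exprMn mulrNN mulr1 expr1n.
set s := (-1) ^+ (r - j) in s2 *.
transitivity (s * s * ((-1) ^+ j / (rising k j)%:R * 'C(r, j)%:R * x ^+ (r - j))).
  by field; rewrite r1 r2.
by rewrite s2 mul1r.
Qed.

Lemma MLDO_qm_diffop k K F P : (0 < k)%N -> qm_expansion G K F P ->
  MLDO G k%:Z K (qm_diffop G k K F).
Proof.
move=> k0 HP; have [gF gP _] := (qm_expansionP _ _ _ _).1 HP.
have cL r := coef_qm_diffop latG r k0 HP; have sL := size_qm_diffop latG k0 HP.
split=> [r|f hf g Gg]; first by rewrite cL; exact: (good_funZ _ (gP r)).
have dg := lattice_det latG Gg; apply/funext => t.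
rewrite {2}/slash !(@diffop_applyE (size P)) ?sL// !ufun_sumE.
pose s (j : nat) := slash (k + j.*2)%:Z g (iter j Dq f) t.
pose X := qm_var g t.
transitivity (\sum_(r < size P) \sum_(j < size P)
    qm_const k r * P`_r t * ((slash_coef k r j)%:R * (- X) ^+ (r - j) * s j)).
  apply: eq_bigr => r _; rewrite cL (iter_Dq_slash_wide _ dg hf (ltn_ord r)).
  by rewrite -[LHS]/(_ * (\sum_j _) t) ufun_sumE mulr_sumr.
rewrite exchange_big /= mulr_sumr; apply: eq_bigr => j _.
(* Summed over r, the terms F_r C(r, j) X^(r - j) form the j-th divided derivative at X, which
   [qm_coef_slash] identifies with F_j slashed in weight K - 2 j. *)
transitivity (qm_const k j * slash (K - j.*2%:Z) g P`_j t * s j).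
  rewrite (qm_coef_slash latG _ _ HP Gg) (@horner_nderivn _ (size P)) ?size_eval_at//.
  rewrite mulr_sumr mulr_suml; apply: eq_bigr => r _; rewrite coef_eval_at.
  case: (leqP j r) => jr; last first.
    by rewrite /slash_coef bin_small// mul0n mulr0n !(mul0r, mulr0).
  have := qm_const_slash_coef X k0 jr; rewrite -/X => E.
  transitivity (qm_const k r * (slash_coef k r j)%:R * (- X) ^+ (r - j) * P`_r t * s j).
    by ring.
  by rewrite E; ring.
have -> : ((qm_diffop G k K F)`_j * iter j Dq f) (moeb g t) =
  qm_const k j * P`_j (moeb g t) * iter j Dq f (moeb g t) by rewrite cL.
rewrite /s.
(* The weights K - 2 j of F_j and k + 2 j of D^j f add up to k + K. *)
have -> : - (k%:Z + K) = - (K - j.*2%:Z) - (k + j.*2)%:Z by rewrite PoszD; ring.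
rewrite expfzDr ?cfac_neq0// /slash.
by ring.
Qed.

Lemma MLDO_expansion k K L : (0 < k)%N -> MLDO G k%:Z K L ->
  qm_expansion G K L`_0 (\poly_(r < size L) (fun t => (qm_const k r)^-1 * L`_r t)).
Proof.
move=> k0 [gL HL]; set P := \poly_(r < size L) _.
have cP r : P`_r = fun t => (qm_const k r)^-1 * L`_r t.
  rewrite coef_poly; case: ltnP => // Lr; apply/funext => t.
  by rewrite nth_default// mulr0.
apply/qm_expansionP; split; [exact: gL|by move=> r; rewrite cP; exact: (good_funZ _ (gL r))|].
move=> g Gg t; have dg := lattice_det latG Gg; have j0 := cfac_neq0 t dg.
(* The slash of 1 is (c tau + d)^(-k), and its r-th derivative is (k)_r (-X)^r (c tau + d)^(-k),
   because only the term of index 0 in [iter_Dq_slash] survives. *)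
have E := congr1 (fun f : ufun R => f t) (HL (fun=> 1) (@holomorphic_cst R 1) g Gg).
move: E; rewrite {2}/slash.
have -> : diffop_apply L (fun=> 1) = L`_0.
  rewrite (@diffop_applyE (size L).+1)// big_ord_recl big1 => [|i _].
    by rewrite addr0 mulr1.
  by rewrite iter_Dq_cst; apply/funext => u; exact: mulr0.
rewrite /diffop_apply ufun_sumE => E.
(* Multiplying by (c tau + d)^k turns weight k + K into weight K and cancels the factor (c tau +
   d)^(-k) in the derivatives of the slashed constant. *)
have -> : slash K g L`_0 t = cfac g t ^ k%:Z * (cfac g t ^ (- (k%:Z + K)) * L`_0 (moeb g t)).
  rewrite /slash mulrA -expfzDr//; congr (_ ^ _ * _); ring.
rewrite -{}E mulr_sumr horner_eval_at.
rewrite (big_ord_widen (size L) (fun r => P`_r t * qm_var g t ^+ r)) ?size_poly//.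
rewrite [RHS]big_mkcond /=; apply: eq_bigr => r _.
have -> : (if (r < size P)%N then P`_r t * qm_var g t ^+ r else 0) = P`_r t * qm_var g t ^+ r.
  by case: ltnP => // Pr; rewrite nth_default// mul0r.
rewrite cP -[(L`_r * _) t]/(_ * _) iter_Dq_slash ?ufun_sumE//; last first.
  exact: (@holomorphic_cst R 1).
rewrite big_ord_recl big1 => [|j _]; last first.
  by rewrite iter_Dq_cst /slash !mulr0.
rewrite addr0 /slash_coef bin0 mul1n addn0 subn0 /= /slash ?addn0 mulr1.
have ck : cfac g t ^ k%:Z * cfac g t ^ (- k%:Z) = 1 by rewrite -expfzDr// subrr expr0z.
rewrite /qm_const invfM invrK -exprVn invrN1 exprNn.
transitivity (cfac g t ^ k%:Z * cfac g t ^ (- k%:Z) *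
  ((-1) ^+ r * (rising k r)%:R * L`_r t * qm_var g t ^+ r)); first by ring.
by rewrite ck mul1r.
Qed.

End Correspondence.

(** * The isomorphism of filtered graded modules *)

Section Isomorphism.
Context {R : realType}.
Variables (G : set 'M[R]_2) (latG : lattice G).
Implicit Types (F f : ufun R) (t : uhp R) (g h : 'M[R]_2) (K l : int)
  (P Q L : {poly ufun R}).

Lemma qm_expansion0 K : qm_expansion G K 0 0.
Proof.
apply/qm_expansionP; split; [exact: good_fun0|exact: good_poly0|] => g Gg t.
by rewrite horner_eval_at size_poly0 big_ord0 /slash mulr0.
Qed.

Lemma slashN K g F : slash K g (- F) = - slash K g F.
Proof. by apply/funext => t; rewrite /slash -[RHS]/(- (_ * _)) -mulrN. Qed.

Lemma qm_expansionD K F P f Q : qm_expansion G K F P -> qm_expansion G K f Q ->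
  qm_expansion G K (F + f) (P + Q).
Proof.
move=> /qm_expansionP[gF gP HP] /qm_expansionP[gf gQ HQ]; apply/qm_expansionP; split.
- exact: good_funD.
- exact: good_polyD.
- move=> g Gg t; rewrite slashD eval_atD hornerD -HP// -HQ//.
Qed.

Lemma qm_expansionZ l K F f P : modular_form G l F -> qm_expansion G K f P ->
  qm_expansion G (l + K) (F * f) (F *: P).
Proof.
move=> [hF mF HF] /qm_expansionP[gf gP HP]; apply/qm_expansionP; split.
- exact: good_funM.
- exact: good_polyZ.
- move=> g Gg t; have dg := lattice_det latG Gg.
  by rewrite slashM// HF// eval_atZ hornerZ -HP.
Qed.

(** Scalars are modular forms of weight 0, so negation of expansions is a case of scaling. *)
Lemma modular_form_cst (z : R[i]) : modular_form G 0 (fun=> z).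
Proof.
split; [exact: holomorphic_cst|exact: moderate_cst|] => g Gg.
by apply/funext => t; rewrite /slash oppr0 expr0z mul1r.
Qed.

Lemma qm_expansionN K F P : qm_expansion G K F P -> qm_expansion G K (- F) (- P).
Proof.
move=> /(qm_expansionZ (modular_form_cst (-1))); rewrite add0r.
congr qm_expansion.
  by apply/funext => t; exact: mulN1r.
apply/polyP => i; rewrite coefZ coefN; apply/funext => t; exact: mulN1r.
Qed.

Lemma quasimodular_expansion K F : quasimodular G K F ->
  exists2 P, qm_expansion G K F P & qm_poly G K F = P.
Proof.
by move=> qF; exists (qm_poly G K F) => //; exact: quasimodularP.
Qed.

Lemma is_fgmod_QM : is_fgmod (modular_form G) (QM_fgmod G).
Proof.
split.
- move=> K; apply/seteqP; split=> [F qF|F [p _ []]//].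
  by exists (size (qm_poly G K F)) => //; split=> //; exact: leqnSn.
- by move=> p K F [qF sF]; split=> //; exact: leq_trans sF _.
- move=> p K; split; first by exists 0; exact: qm_expansion0.
  by rewrite (qm_polyE latG (qm_expansion0 K)) size_poly0.
- move=> p K F f [/quasimodular_expansion[P HP PE] sF] [/quasimodular_expansion[Q HQ QE] sf].
  have H := qm_expansionD HP (qm_expansionN HQ).
  split; first by exists (P - Q).
  rewrite (qm_polyE latG H); apply: leq_trans (size_polyD _ _) _.
  by rewrite size_polyN geq_max -PE sF -QE.
- move=> p l K a F ma [/quasimodular_expansion[P HP PE] sF].
  have H := qm_expansionZ ma HP.
  split; first by exists (a *: P).
  rewrite (qm_polyE latG H); apply: leq_trans (size_scale_leq _ _) _.
  by rewrite -PE.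
Qed.

Lemma is_fgmod_MLDO k : is_fgmod (modular_form G) (MLDO_fgmod G k).
Proof.
split.
- move=> K; apply/seteqP; split=> [L mL|L [p _ []]//].
  by exists (size L) => //; split=> //; exact: leqnSn.
- by move=> p K L [mL sL]; split=> //; exact: leq_trans sL _.
- move=> p K; split; last by rewrite size_poly0.
  split=> [r|f hf g Gg]; first by rewrite coef0; exact: good_fun0.
  rewrite /diffop_apply size_poly0 !big_ord0.
  by apply/funext => t; rewrite /slash mulr0.
- move=> p K L Q [[gL HL] sL] [[gQ HQ] sQ]; split.
    split=> [r|f hf g Gg]; first exact: (good_polyB gL gQ).
    by rewrite !diffop_applyB HL// HQ// slashD slashN.
  by apply: leq_trans (size_polyD _ _) _; rewrite size_polyN geq_max sL.
- move=> p l K a L [ha ma Ha] [[gL HL] sL]; split; last first.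
    exact: leq_trans (size_scale_leq _ _) sL.
  split=> [r|f hf g Gg]; first exact: (good_polyZ (conj ha ma) gL).
  have dg := lattice_det latG Gg.
  rewrite !diffop_applyZ HL// addrCA slashM//.
  by rewrite Ha.
Qed.

Variables (k : nat) (k0 : (0 < k)%N).

(** [P + Q] is an expansion of [F + f], hence, by uniqueness, the one that [qm_poly] selects. *)
Lemma qm_diffopD K F f : quasimodular G K F -> quasimodular G K f ->
  qm_diffop G k K (F + f) = qm_diffop G k K F + qm_diffop G k K f.
Proof.
move=> [P HP] [Q HQ]; apply/polyP => r.
rewrite coefD !(coef_qm_diffop latG r k0 HP, coef_qm_diffop latG r k0 HQ).
rewrite (coef_qm_diffop latG r k0 (qm_expansionD HP HQ)) coefD.
by apply/funext => t; exact: mulrDr.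
Qed.

Lemma qm_diffopZ l K F f : modular_form G l F -> quasimodular G K f ->
  qm_diffop G k (l + K) (F * f) = F *: qm_diffop G k K f.
Proof.
move=> mF [P HP]; apply/polyP => r.
rewrite coefZ (coef_qm_diffop latG r k0 HP).
rewrite (coef_qm_diffop latG r k0 (qm_expansionZ mF HP)) coefZ.
by apply/funext => t; exact: mulrCA.
Qed.

Lemma qm_diffop0 K : qm_diffop G k K 0 = 0.
Proof.
apply/eqP; rewrite -size_poly_eq0 (size_qm_diffop latG k0 (qm_expansion0 K)).
by rewrite size_poly0.
Qed.

Lemma coef0_qm_diffop K F : quasimodular G K F -> (qm_diffop G k K F)`_0 = F.
Proof.
move=> [P HP]; rewrite (coef_qm_diffop latG 0 k0 HP) (qm_expansion_coef0 latG HP).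
by apply/funext => t; rewrite /qm_const rising0 expr0 invr1 !mul1r.
Qed.

(** [MLDO_expansion] divides the coefficients of [L] by [qm_const], and [qm_diffop] multiplies them
    back. *)
Lemma qm_diffop_coef0 K L : MLDO G k%:Z K L ->
  quasimodular G K L`_0 /\ qm_diffop G k K L`_0 = L.
Proof.
move=> /(MLDO_expansion latG k0) HP; split.
  by exists (\poly_(r < size L) (fun t => (qm_const k r)^-1 * L`_r t)).
apply/polyP => r; rewrite (coef_qm_diffop latG r k0 HP) coef_poly.
apply/funext => t; case: ltnP => Lr.
  by rewrite mulVKf// qm_const_neq0.
by rewrite nth_default// mulr0.
Qed.

Lemma quasimodularD K F f : quasimodular G K F -> quasimodular G K f ->
  quasimodular G K (F + f).
Proof. by move=> [P HP] [Q HQ]; exists (P + Q); exact: qm_expansionD. Qed.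

Lemma quasimodularZ l K F f : modular_form G l F -> quasimodular G K f ->
  quasimodular G (l + K) (F * f).
Proof. by move=> mF [P HP]; exists (F *: P); exact: qm_expansionZ. Qed.

Lemma qm_to_MLDO_scale (m : int -> ufun R) (u : int -> (ufun R)^o) :
  dsum (modular_form G) m -> dsum (piece (QM_fgmod G)) u ->
  qm_to_MLDO G k (gr_scale m u) = gr_scale m (qm_to_MLDO G k u).
Proof.
move=> [fm mm] [_ uq]; apply/funext => K; rewrite /qm_to_MLDO /gr_scale.
(* The support of [m] alone makes the sum over all weights finite, and the same list of weights
   serves both sides. *)
pose D := [set l | m l <> 0]; pose sD : seq int := finmap.enum_fset (fset_set D).
have E (W : lmodType (ufun R)) (w : int -> W) :
    \sum_(l \in [set: int]) m l *: w l = \sum_(l <- sD) m l *: w l.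
  rewrite -(fsbig_widen D [set: int])//; last first.
    by move=> l [_ /contrapT] /= ->; rewrite scale0r.
  by rewrite fsbig_finite.
rewrite (E _ (fun l => u (K - l))) (E _ (fun l => qm_diffop G k (K - l) (u (K - l)))).
(* Quasimodularity of the partial sums is carried through the induction because [qm_diffopD]
   requires it. *)
suff [] : quasimodular G K (\sum_(l <- sD) m l *: u (K - l)) /\
  qm_diffop G k K (\sum_(l <- sD) m l *: u (K - l)) =
  \sum_(l <- sD) m l *: qm_diffop G k (K - l) (u (K - l)) by [].
elim: sD {E} => [|l s [qs IH]].
  rewrite !big_nil; split; last exact: qm_diffop0.
  by exists 0; exact: qm_expansion0.
have ql := quasimodularZ (mm l) (uq (K - l)).
have el := qm_diffopZ (mm l) (uq (K - l)).
rewrite subrKC in ql el.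
rewrite !big_cons; split; first exact: quasimodularD.
by rewrite qm_diffopD// IH el.
Qed.

Lemma fgmod_iso_qm_MLDO :
  fgmod_iso (modular_form G) (QM_fgmod G) (MLDO_fgmod G k) (qm_to_MLDO G k) constant_coef.
Proof.
have phi0 K : qm_diffop G k K 0 = 0 := qm_diffop0 K.
have SXY u : dsum (piece (QM_fgmod G)) u -> dsum (piece (MLDO_fgmod G k)) (qm_to_MLDO G k u).
  move=> [fu uq]; split.
    apply: sub_finite_set fu => K /= H uK; apply: H.
    by rewrite /qm_to_MLDO uK phi0.
  by move=> K; have [P HP] := uq K; exact: (MLDO_qm_diffop latG k0 HP).
split; first by split; [exact: is_fgmod_QM|exact: is_fgmod_MLDO].
split; split.
- exact: SXY.
- move=> w [fw wm]; split.
    apply: sub_finite_set fw => K /= H wK; apply: H.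
    by rewrite /constant_coef wK coef0.
  by move=> K; have [] := qm_diffop_coef0 (wm K).
- by move=> u [_ uq]; apply/funext => K; exact: (coef0_qm_diffop (uq K)).
- move=> w [_ wm]; apply/funext => K.
  by have [_] := qm_diffop_coef0 (wm K).
- move=> u v [_ uq] [_ vq]; apply/funext => K; exact: (qm_diffopD (uq K) (vq K)).
- exact: qm_to_MLDO_scale.
- move=> K u [_ uq]; split=> H l lK.
    by rewrite /qm_to_MLDO H// phi0.
  (* Each component is recovered as the constant coefficient of its operator. *)
  by rewrite -(coef0_qm_diffop (uq l)) -/(qm_to_MLDO G k u l) H// coef0.
- move=> p u su; have [fu uq] := su; have [fv _] := SXY u su.
  (* Equality of sizes, and not just an inequality, transports the filtration in both directions. *)
  have sz K : size (qm_diffop G k K (u K)) = size (qm_poly G K (u K)).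
    exact: (size_qm_diffop latG k0 (quasimodularP latG (uq K))).
  split=> -[_ H]; split=> // K.
    split; last by rewrite /qm_to_MLDO sz; have [] := H K.
    by have [P HP] := uq K; exact: (MLDO_qm_diffop latG k0 HP).
  by split; [exact: uq|rewrite -sz; have [] := H K].
Qed.

End Isomorphism.

Theorem theorem8 (R : realType) (G : set 'M[R]_2) (hG : lattice G) :
  (forall (K : int) (F : uhp R -> R[i]) (n : nat),
     quasimodular G K F -> has_depth G K F n ->
     forall k : nat, (0 < k)%N ->
       MLDO G k%:Z K (qm_diffop G k K F) /\ has_order (qm_diffop G k K F) n)
  /\
  (forall k : nat, (0 < k)%N ->
     fgmod_iso (modular_form G) (QM_fgmod G) (MLDO_fgmod G k)
       (qm_to_MLDO G k) constant_coef).
Proof.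
split=> [K F n qF dF k k0|k k0]; last exact: (fgmod_iso_qm_MLDO hG k0).
have HP := quasimodularP hG qF; split; first exact: (MLDO_qm_diffop hG k0 HP).
by rewrite /has_order (size_qm_diffop hG k0 HP).
Qed.
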